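(* There exists a sequentially efficient $2$-ADPLS for the minimum metric Steiner tree problem with proof size $O(\log n+\log W)$.
   Context: All graphs are finite, connected and undirected, $G=(V,E)$, $n=|V|$, $N(v)$ is the set of neighbors of $v$; each node distinguishes its incident edges by port numbers. An input assignment $\mathsf{I}:V\to\{0,1\}^*$ gives each node a local input; an input graph $\langle G,\mathsf I\rangle$ is a configuration graph with $S=\mathsf I$. Given a universe $\mathcal U$ of configuration graphs and disjoint families $\mathcal F_Y,\mathcal F_N\subseteq\mathcal U$, a gap proof labeling scheme (GPLS) consists of a prover which, given a configuration graph in $\mathcal F_Y$, assigns a label $L(v)\in\{0,1\}^*$ to every node, and a verifier which at each node $v$ receives only $\langle S(v),L(v),L^N(v)\rangle$, where $L^N(v)$ is the vector of labels of $v$'s neighbors (indexed by port), and outputs True or False; the verifier accepts if all nodes output True and rejects otherwise. The GPLS is correct if (i) for every configuration graph in $\mathcal F_Y$ the verifier accepts under the prover's labels, and (ii) for every configuration graph in $\mathcal F_N$ the verifier rejects under every label assignment. Its proof size is the maximum label length over $\mathcal F_Y$. It is sequentially efficient if the prover runs in time polynomial in the encoding length of the configuration graph and the verifier at $v$ runs in time polynomial in $|S(v)|$, $|L(v)|$ and $\sum_{u\in N(v)}|L(u)|$. For an optimization problem with optimum value $OPT(G,\mathsf I)$, $\alpha\ge1$ and $k\in\mathbb Z$, an $\alpha$-ADPLS for the problem and $k$ is a GPLS over the universe of legal input graphs (those admitting a feasible solution) with $\mathcal F_Y=\{OPT\ge k\}$, $\mathcal F_N=\{OPT<k/\alpha\}$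 for a minimization problem. ''There exists an $\alpha$-ADPLS with proof size $s$'' means that for every $k\in\mathbb Z$ there is one with that proof size bound. Minimum metric Steiner tree: $G$ is a metric graph (complete graph whose edge weights $w:E\to\{1,\dots,W\}$ satisfy the triangle inequality); the input gives each node a unique identifier of $O(\log n)$ bits, the weights of its incident edges, and whether it belongs to a terminal set $S\subseteq V$; a feasible solution is a tree $T=(V_T,E_T)$ with $S\subseteq V_T\subseteq V$, $E_T\subseteq E$, and $w(T)=\sum_{e\in E_T}w(e)$ is minimized. *)

(* Defs.v *)
From mathcomp Require Import all_boot all_order all_algebra.
Unset Printing Implicit Defensive.
Import GRing.Theory Num.Theory.

Definition bits := seq bool.

Fixpoint bin_aux (fuel n : nat) : bits :=
  match fuel with
  | 0 => [::]
  | f.+1 => if n is 0 then [::] else odd n :: bin_aux f n./2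
  end.
Definition bin (n : nat) : bits := bin_aux n n.

Definition enc_str (s : bits) : bits :=
  flatten [seq [:: true; b] | b <- s] ++ [:: false; false].
Definition enc_tuple (ss : seq bits) : bits := flatten (map enc_str ss).

(* Single-tape Turing machines over {0,1,blank} (two-way infinite tape)      *)
Inductive move := MoveL | MoveR | Stay.
Definition sym := option bool.  (* None = blank *)

Record TM := MkTM {
  tm_q : nat;
  tm_delta : 'I_tm_q.+1 -> sym -> 'I_tm_q.+1 * sym * move;
  tm_halt : 'I_tm_q.+1 -> bool
}.

(* configuration: state, tape left of head (reversed), symbol under head,
   tape right of head; all other cells are blank *)
Definition config (M : TM) := ('I_(tm_q M).+1 * seq sym * sym * seq sym)%type.

Definition tm_step (M : TM) (c : config M) : config M :=
  let: (q, l, a, r) := c in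
  if tm_halt M q then c else
  let: (q', b, m) := tm_delta M q a in
  match m with
  | Stay => (q', l, b, r)
  | MoveL => (q', behead l, head None l, b :: r)
  | MoveR => (q', b :: l, head None r, behead r)
  end.

Definition tm_init (M : TM) (x : bits) : config M :=
  (ord0, [::], head None (map Some x), behead (map Some x)).

Fixpoint read_out (s : seq sym) : bits :=
  match s with Some b :: s' => b :: read_out s' | _ => [::] end.

Definition tm_computes_within (M : TM) (x y : bits) (t : nat) : bool :=
  let: (q, l, a, r) := iter t (tm_step M) (tm_init M x) in
  tm_halt M q && (read_out (a :: r) == y).

(* The graph is the complete graph on 'I_nn; node v reaches its neighbour    *)
(* port v i through port i : 'I_nn.-1.                                       *)
Record inst := Inst {
  nn : nat;
  port : 'I_nn -> 'I_nn.-1 -> 'I_nn;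
  ident : 'I_nn -> nat;
  wt : 'I_nn -> 'I_nn -> nat;
  term : 'I_nn -> bool
}.

(* legal input graphs (every valid instance admits a feasible solution);
   cid is the constant in "identifiers of O(log n) bits" *)
Definition valid (cid : nat) (G : inst) : Prop :=
  [/\ 0 < nn G,
      (forall v, injective (port G v)) /\ (forall v i, port G v i != v),
      injective (ident G) /\
        (forall v, size (bin (ident G v)) <= cid * (trunc_log 2 (nn G)).+1),
      (forall u v, wt G u v = wt G v u) /\ (forall u v, u != v -> 0 < wt G u v)
    & forall u v x, u != v -> u != x -> x != v ->
        wt G u v <= wt G u x + wt G x v].

Definition maxw (G : inst) : nat :=
  \max_(u : 'I_(nn G)) \max_(v : 'I_(nn G) | v != u) wt G u v.

Definition tadj {n : nat} (ET : {set 'I_n * 'I_n}) : rel 'I_n :=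
  fun x y => ((x, y) \in ET) || ((y, x) \in ET).

(* (VT, ET) is a tree of G (connected, |ET| = |VT| - 1, nonempty) with
   S ⊆ VT; an edge {u,v} is stored as the pair (u,v) with u < v *)
Definition steiner_tree (G : inst) (VT : {set 'I_(nn G)})
    (ET : {set 'I_(nn G) * 'I_(nn G)}) : Prop :=
  [/\ forall v, term G v -> v \in VT,
      forall e, e \in ET -> [/\ e.1 \in VT, e.2 \in VT & (e.1 < e.2)%N],
      VT != set0,
      #|ET|.+1 = #|VT|
    & forall x y, x \in VT -> y \in VT -> connect (tadj (n:=nn G) ET) x y].

Definition tree_weight (G : inst) (ET : {set 'I_(nn G) * 'I_(nn G)}) : nat :=
  \sum_(e in ET) wt G e.1 e.2.

Definition is_opt (G : inst) (m : nat) : Prop :=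
  (exists VT ET, steiner_tree G VT ET /\ tree_weight G ET = m) /\
  (forall VT ET, steiner_tree G VT ET -> m <= tree_weight G ET).

Definition FY (k : int) (G : inst) : Prop :=
  exists m, is_opt G m /\ (k <= m%:Z)%R.
Definition FN (alpha : nat) (k : int) (G : inst) : Prop :=
  exists m, is_opt G m /\ ((alpha * m)%:Z < k)%R.

Definition prover_t := forall G : inst, 'I_(nn G) -> bits.
Definition verifier_t := bits -> bits -> seq bits -> bool.

Definition local_input (G : inst) (v : 'I_(nn G)) : bits :=
  enc_tuple ([:: bin (ident G v); [:: term G v]] ++
             [seq bin (wt G v (port G v i)) | i <- enum 'I_(nn G).-1]).

Definition nbr_labels (G : inst) (L : 'I_(nn G) -> bits) (v : 'I_(nn G))
  : seq bits := [seq L (port G v i) | i <- enum 'I_(nn G).-1].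

Definition verifier_accepts (ver : verifier_t) (G : inst)
    (L : 'I_(nn G) -> bits) : Prop :=
  forall v, ver (local_input G v) (L v) (nbr_labels G L v).

Definition gpls_correct (U FYes FNo : inst -> Prop)
    (P : prover_t) (ver : verifier_t) : Prop :=
  (forall G, U G -> FYes G -> verifier_accepts ver G (P G)) /\
  (forall G, U G -> FNo G -> forall L, ~ verifier_accepts ver G L).

Definition enc_inst (G : inst) : bits :=
  enc_tuple ([:: bin (nn G)] ++ [seq local_input G v | v <- enum 'I_(nn G)] ++
    [seq enc_tuple [seq bin (port G v i) | i <- enum 'I_(nn G).-1]
       | v <- enum 'I_(nn G)]).

Definition enc_labels (G : inst) (L : 'I_(nn G) -> bits) : bits :=
  enc_tuple [seq L v | v <- enum 'I_(nn G)].

Definition verifier_input (G : inst) (L : 'I_(nn G) -> bits) (v : 'I_(nn G))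
  : bits := enc_tuple (local_input G v :: L v :: nbr_labels G L v).

Definition seq_efficient (U FYes : inst -> Prop)
    (P : prover_t) (ver : verifier_t) : Prop :=
  (exists (M : TM) (a d : nat), forall G, U G -> FYes G ->
     tm_computes_within M (enc_inst G) (enc_labels G (P G))
       (a * (size (enc_inst G)).+1 ^ d)) /\
  (exists (M : TM) (a d : nat), forall G (L : 'I_(nn G) -> bits) v, U G ->
     tm_computes_within M (verifier_input G L v)
       [:: ver (local_input G v) (L v) (nbr_labels G L v)]
       (a * (size (verifier_input G L v)).+1 ^ d)).

Definition proof_size_le (c : nat) (U FYes : inst -> Prop) (P : prover_t)
  : Prop :=
  forall G, U G -> FYes G -> forall v,
    size (P G v) <= c * (trunc_log 2 (nn G) + trunc_log 2 (maxw G)).+1.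

(* Main.v *)
Require Import Defs.
From mathcomp Require Import all_boot all_order all_algebra zify ring.
From Stdlib Require Import FunctionalExtensionality ClassicalEpsilon.
Set Implicit Arguments.
Unset Strict Implicit.
Unset Printing Implicit Defensive.
Import GRing.Theory Num.Theory.

(** If OPT >= k, the minimum spanning tree of the terminals weighs at least k;
    if OPT < k/2 it weighs less than k.  Run Prim's algorithm on the terminals:
    terminal number r is attached at cost g(r), and the minimality of the choice
    gives w(u,v) >= g(l) for all rk(u) < rk(l) <= rk(v).  The label of a terminal
    is (r, g(r)), with g truncated at k.  In a complete graph every terminal sees
    all labels, so it can check these inequalities on its own edges and check
    that the gaps sum to at least k.  Conversely such labels force every walk
    through all terminals (in particular a doubled Steiner tree) to weigh at
    least the sum of the gaps: for each threshold s, the walk changes blocks at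
    least as often as there are gaps larger than s.

    Since k is fixed before the machines are chosen and weights are at least 1,
    more than k terminals force OPT >= k, and otherwise only the at most k^2
    weights between terminals, truncated at k, matter.  So both machines
    merely extract boundedly many bits and then consult a finite table.  They
    are programs of a small language in which every loop runs as often as the
    input has bits (hence polynomial time), compiled to stacks interleaved on a
    single tape. *)

(** * Structured tape programs *)

(** The factor 2 is lost only in soundness, where a tour of a Steiner tree pays every edge twice;
    completeness compares with the optimum itself, since the tree found by Prim's algorithm is one
    of the Steiner trees. Truncation at k is harmless on both sides: a gap that is at most min(k, w)
    is at most w, and a sum that reaches k still reaches it after each term is truncated at k.
    Terminals are recognised by nonempty labels, because the input of a node does not tell which of
    its neighbours are terminals.

    The finite table is evaluated while the machine is being built. Its entries may therefore come
    from any function, even from a choice operator, and neither Prim's algorithm nor the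
    inequalities ever have to be programmed. The price is that the machines and their polynomials
    depend on k; the constant of the proof size does not. *)

Definition tape := (int -> sym)%type.
Definition tupd (f : tape) (p : int) (s : sym) : tape :=
  fun z => if z == p then s else f z.

Inductive tcmd :=
  | TMv of move
  | TWr of sym
  | TSq of tcmd & tcmd
  | TBr of tcmd & tcmd & tcmd
  | TWh of tcmd.

Definition shift (d : move) (p : int) : int :=
  match d with MoveL => (p - 1)%R | MoveR => (p + 1)%R | Stay => p end.

Definition branch {A} (s : sym) (x0 x1 x2 : A) : A :=
  match s with None => x0 | Some false => x1 | Some true => x2 end.

(** The last index is the exact number of machine steps of the compiled code: sequencing is free,
    since exit addresses are wired directly, and each test costs one step. *)
Inductive ev : tcmd -> tape * int -> tape * int -> nat -> Prop :=
  | ev_mv d x : ev (TMv d) x (x.1, shift d x.2) 1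
  | ev_wr s x : ev (TWr s) x (tupd x.1 x.2 s, x.2) 1
  | ev_sq c1 c2 x y z t1 t2 : ev c1 x y t1 -> ev c2 y z t2 ->
      ev (TSq c1 c2) x z (t1 + t2)
  | ev_br c0 c1 c2 x y t : ev (branch (x.1 x.2) c0 c1 c2) x y t ->
      ev (TBr c0 c1 c2) x y t.+1
  | ev_wh0 c x : x.1 x.2 = None -> ev (TWh c) x x 1
  | ev_wh1 c x y z t1 t2 : x.1 x.2 <> None -> ev c x y t1 ->
      ev (TWh c) y z t2 -> ev (TWh c) x z (t1 + t2).+1.

Definition instr := (sym -> sym * move * nat)%type.

Fixpoint tlen (c : tcmd) : nat :=
  match c with
  | TMv _ | TWr _ => 1
  | TSq c1 c2 => tlen c1 + tlen c2
  | TBr c0 c1 c2 => (tlen c0 + (tlen c1 + tlen c2)).+1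
  | TWh c => (tlen c).+1
  end.

(* Code for c placed at address a, with exit address e. *)
Fixpoint tcode (a e : nat) (c : tcmd) : seq instr :=
  match c with
  | TMv d => [:: fun s => (s, d, e)]
  | TWr b => [:: fun _ => (b, Stay, e)]
  | TSq c1 c2 => tcode a (a + tlen c1) c1 ++ tcode (a + tlen c1) e c2
  | TBr c0 c1 c2 =>
      (fun s => (s, Stay,
         branch s a.+1 (a.+1 + tlen c0) (a.+1 + tlen c0 + tlen c1)))
      :: tcode a.+1 e c0 ++ (tcode (a.+1 + tlen c0) e c1 ++
         tcode (a.+1 + tlen c0 + tlen c1) e c2)
  | TWh c =>
      (fun s => (s, Stay, if s is None then e else a.+1)) :: tcode a.+1 a c
  end.

Lemma size_tcode c a e : size (tcode a e c) = tlen c.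
Proof.
elim: c a e => //= [c1 IH1 c2 IH2|c0 IH0 c1 IH1 c2 IH2|c IH] a e.
- by rewrite size_cat IH1 IH2.
- by rewrite !size_cat IH0 IH1 IH2.
- by rewrite IH.
Qed.

(** Default value for [nth]; its target 0 is a legal address, so [tcode_target] can be stated for
    every index. *)
Definition halt_instr : instr := fun s => (s, Stay, 0).

Definition fstep (pr : seq instr) (x : nat * (tape * int)) :=
  let: (q, (f, p)) := x in
  if q == size pr then x else
  let: (b, m, e) := nth halt_instr pr q (f p) in
  (e, (tupd f p b, shift m p)).
Arguments fstep : simpl never.

Definition placed (pr : seq instr) (a : nat) (cs : seq instr) :=
  forall i, i < size cs -> nth halt_instr pr (a + i) = nth halt_instr cs i.

Lemma placed_cat pr a cs1 cs2 : placed pr a (cs1 ++ cs2) ->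
  placed pr a cs1 /\ placed pr (a + size cs1) cs2.
Proof.
move=> H; split=> i Hi.
  by rewrite H ?size_cat ?nth_cat ?Hi //; lia.
rewrite -addnA H ?size_cat ?nth_cat; last by lia.
by rewrite ltnNge leq_addr /= addKn.
Qed.

Lemma placed_cons pr a c cs : placed pr a (c :: cs) ->
  nth halt_instr pr a = c /\ placed pr a.+1 cs.
Proof.
move=> H; split; first by have /= := H 0 isT; rewrite addn0.
by move=> i Hi; rewrite addSnnS H.
Qed.

Lemma tupd_id f p : tupd f p (f p) = f.
Proof. by apply: functional_extensionality => z; rewrite /tupd; case: eqP => // ->. Qed.

Lemma fstep_nth pr a ins f p : a < size pr -> nth halt_instr pr a = ins ->
  fstep pr (a, (f, p)) =
  ((ins (f p)).2, (tupd f p (ins (f p)).1.1, shift (ins (f p)).1.2 p)).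
Proof.
move=> Ha Hn; rewrite /fstep ltn_eqF // Hn.
by case: (ins (f p)) => [[]].
Qed.

Lemma ev_fsteps c x y t : ev c x y t -> forall a e pr,
  a + tlen c <= size pr -> placed pr a (tcode a e c) ->
  iter t (fstep pr) (a, x) = (e, y).
Proof.
elim=> {c x y t}.
- move=> d [f p] a e pr /= Ha /placed_cons[Hn _].
  by rewrite (fstep_nth _ _ _ Hn) ?tupd_id //; lia.
- move=> s [f p] a e pr /= Ha /placed_cons[Hn _].
  by rewrite (fstep_nth _ _ _ Hn) //; lia.
- move=> c1 c2 x y z t1 t2 _ IH1 _ IH2 a e pr /= Ha /placed_cat[H1 H2].
  rewrite size_tcode in H2.
  by rewrite addnC iterD (IH1 _ _ _ _ H1) ?(IH2 _ _ _ _ H2) //; lia.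
- move=> c0 c1 c2 [f p] y t _ IH a e pr Ha /placed_cons[Hn]; rewrite /= in Ha.
  move=> /placed_cat[H0] /placed_cat[H1 H2]; rewrite !size_tcode in H1 H2.
  rewrite iterSr (fstep_nth _ _ _ Hn) /= ?tupd_id; last by lia.
  move: IH => /=; case: (f p) => [[]|] /= IH.
  + by apply: IH H2; lia.
  + by apply: IH H1; lia.
  + by apply: IH H0; lia.
- move=> c [f p] /= Hf a e pr Ha /placed_cons[Hn _].
  by rewrite (fstep_nth _ _ _ Hn) /= ?tupd_id ?Hf //; lia.
- move=> c [f p] y z t1 t2 Hf _ IH1 _ IH2 a e pr Ha Hpl.
  have /placed_cons[Hn Hc] := Hpl; rewrite /= in Ha Hf.
  rewrite iterSr (fstep_nth _ _ _ Hn) /= ?tupd_id; last by lia.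
  have -> : (if f p is None then e else a.+1) = a.+1 by case: (f p) Hf.
  by rewrite addnC iterD (IH1 _ _ _ _ Hc) ?(IH2 _ _ _ _ Hpl) //=; lia.
Qed.

(** * From tape programs to Turing machines *)

Section ToTM.
Variable c : tcmd.
Let pr := tcode 0 (tlen c) c.

Definition TM_of : TM :=
  @MkTM (tlen c)
    (fun q a => let: (b, m, e) := nth halt_instr pr q a in (inord e, b, m))
    (fun q => q == tlen c :> nat).

(** Reading both lists with default [None] identifies lists that differ only in blanks at the far
    end. *)
Definition conf_rep (k : config TM_of) (x : nat * (tape * int)) :=
  let: (q, l, a, r) := k in
  [/\ q = x.1 :> nat, a = x.2.1 x.2.2,
      forall j : nat, nth None l j = x.2.1 (x.2.2 - 1 - j%:Z)%R
    & forall j : nat, nth None r j = x.2.1 (x.2.2 + 1 + j%:Z)%R].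

(** Jump addresses stay within the states of [TM_of], so that [inord] does not alter them. *)
Lemma tcode_target a e c0 i s : a + tlen c0 <= tlen c -> e <= tlen c ->
  (nth halt_instr (tcode a e c0) i s).2 <= tlen c.
Proof.
elim: c0 a e i => //= [d|b|c1 IH1 c2 IH2|c0 IH0 c1 IH1 c2 IH2|c1 IH] a e i Ha He.
- by case: i => [|[]].
- by case: i => [|[]].
- by rewrite nth_cat; case: ifP => _; [apply: IH1|apply: IH2]; lia.
- case: i => [|i] /=; first by case: (s) => [[]|] /=; lia.
  rewrite nth_cat; case: ifP => _; first by apply: IH0; lia.
  by rewrite nth_cat; case: ifP => _; [apply: IH1|apply: IH2]; lia.
- case: i => [|i] /=; first by case: (s) => [_|] /=; lia.
  by apply: IH; lia.
Qed.

Lemma nth_behead_None (l : seq sym) j : nth None (behead l) j = nth None l j.+1.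
Proof. by case: l => //=; rewrite nth_nil. Qed.

Lemma conf_rep_step k x : conf_rep k x -> conf_rep (tm_step TM_of k) (fstep pr x).
Proof.
move: k x => [[[q l] a] r] [q' [f p]] [/= Hq Ha Hl Hr].
rewrite /fstep size_tcode -Hq; case: eqP => [Hh|Hh].
  by split.
have Ht := @tcode_target 0 (tlen c) c q (f p) (leqnn _) (leqnn _).
rewrite -/pr in Ht; rewrite Ha.
case E: (nth halt_instr pr q (f p)) Ht => [[b m] e] /= He.
have Hin : nat_of_ord (inord e : 'I_(tlen c).+1) = e by rewrite inordK.
case: m E => E; split => //=; rewrite /tupd.
- by rewrite ifF -?nth0 ?Hl; [congr f; lia|apply/eqP; lia].
- by move=> j; rewrite nth_behead_None Hl ifF; [congr f; lia|apply/eqP; lia].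
- case=> [|j] /=; first by rewrite ifT //; apply/eqP; lia.
  by rewrite Hr ifF; [congr f; lia|apply/eqP; lia].
- by rewrite ifF -?nth0 ?Hr; [congr f; lia|apply/eqP; lia].
- case=> [|j] /=; first by rewrite ifT //; apply/eqP; lia.
  by rewrite Hl ifF; [congr f; lia|apply/eqP; lia].
- by move=> j; rewrite nth_behead_None Hr ifF; [congr f; lia|apply/eqP; lia].
- by rewrite eqxx.
- by move=> j; rewrite Hl ifF //; apply/eqP; lia.
- by move=> j; rewrite Hr ifF //; apply/eqP; lia.
Qed.

Definition tape_of (x : bits) : tape :=
  fun z => if z is Posz j then nth None (map Some x) j else None.

(** The case [j = size y] matters: it requires the blank at which [read_out] stops. *)
Lemma read_out_nth (s : seq sym) y :
  (forall j, j <= size y -> nth None s j = nth None (map Some y) j) -> read_out s = y.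
Proof.
elim: y s => [|b y IH] [|[b'|] s] // H.
- by have := H 0 isT.
- by have := H 0 isT.
- have /= [->] := H 0 isT; congr cons.
  by apply: IH => j Hj; apply: (H j.+1).
- by have := H 0 isT.
Qed.

Lemma TM_of_computes x y f p t T :
  ev c (tape_of x, 0%R) (f, p) t -> t <= T ->
  (forall j : nat, j <= size y -> f (p + j%:Z)%R = nth None (map Some y) j) ->
  tm_computes_within TM_of x y T.
Proof.
move=> He HT Hy.
have Hf : iter T (fstep pr) (0, (tape_of x, 0%R)) = (tlen c, (f, p)).
  rewrite -(subnK HT) iterD (ev_fsteps (pr := pr) (a := 0) (e := tlen c) He).
  (* At the exit address the program idles, so an upper bound on the time is enough. *)
  - elim: (T - t) => //= n ->.
    by rewrite /fstep size_tcode eqxx.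
  - by rewrite size_tcode.
  - by [].
have : conf_rep (iter T (tm_step TM_of) (tm_init TM_of x))
                (iter T (fstep pr) (0, (tape_of x, 0%R))).
  elim: T {HT Hf} => [|T IH]; last exact: conf_rep_step.
  split => //=.
  - by move=> j; rewrite nth_nil; case: j.
  - by move=> j; rewrite nth_behead_None; congr nth; lia.
rewrite Hf /tm_computes_within.
case: (iter _ _ _) => [[[q l] a] r] [/= -> Ha Hl Hr]; rewrite eqxx andTb.
apply/eqP; apply: (@read_out_nth (a :: r)) => -[|j] Hj.
  by rewrite -Hy //= Ha addr0.
by rewrite -Hy //= Hr; congr f; lia.
Qed.

End ToTM.

(** * Stack machines on one tape *)

Definition store := (nat -> bits)%type.
Definition sset (s : store) (i : nat) (v : bits) : store :=
  fun j => if j == i then v else s j.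

Inductive scmd :=
  | SSkip
  | SPush of nat & bool
  | SCase of nat & scmd & scmd & scmd
  | SSeq of scmd & scmd
  | SWhile of nat & scmd & scmd.

Inductive exec : scmd -> store -> store -> nat -> Prop :=
  | ex_skip s : exec SSkip s s 1
  | ex_push i b s : exec (SPush i b) s (sset s i (b :: s i)) 1
  | ex_case0 i c0 cF cT s s' t : s i = [::] -> exec c0 s s' t ->
      exec (SCase i c0 cF cT) s s' t.+1
  | ex_case1 i c0 cF cT b r s s' t : s i = b :: r ->
      exec (if b then cT else cF) (sset s i r) s' t ->
      exec (SCase i c0 cF cT) s s' t.+1
  | ex_seq c1 c2 s s1 s2 t1 t2 : exec c1 s s1 t1 -> exec c2 s1 s2 t2 ->
      exec (SSeq c1 c2) s s2 (t1 + t2)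
  | ex_wh0 i cF cT s : s i = [::] -> exec (SWhile i cF cT) s s 1
  | ex_wh1 i cF cT b r s s1 s2 t1 t2 : s i = b :: r ->
      exec (if b then cT else cF) (sset s i r) s1 t1 ->
      exec (SWhile i cF cT) s1 s2 t2 ->
      exec (SWhile i cF cT) s s2 (t1 + t2).+1.

(** A time bound is also a bound on the growth of every stack, and hence on the cost of walking
    along it. *)
Lemma exec_size c s s' t : exec c s s' t -> forall i, size (s' i) <= size (s i) + t.
Proof.
elim=> {c s s' t} //=.
- by move=> s i; lia.
- by move=> i b s j; rewrite /sset; case: eqP => [->|_] /=; lia.
- by move=> i c0 cF cT s s' t _ _ IH j; have := IH j; lia.
- move=> i c0 cF cT b r s s' t E _ IH j; have := IH j; rewrite /sset.
  by case: eqP => [->|_]; rewrite ?E /=; lia.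
- by move=> c1 c2 s s1 s2 t1 t2 _ IH1 _ IH2 j; have := IH1 j; have := IH2 j; lia.
- by move=> *; lia.
- move=> i cF cT b r s s1 s2 t1 t2 E _ IH1 _ IH2 j.
  have := IH1 j; have := IH2 j; rewrite /sset.
  by case: eqP => [->|_]; rewrite ?E /=; lia.
Qed.

Definition evle (c : tcmd) (x y : tape * int) (T : nat) :=
  exists2 t, t <= T & ev c x y t.

Lemma evle_le c x y T1 T2 : T1 <= T2 -> evle c x y T1 -> evle c x y T2.
Proof. by move=> H [t Ht He]; exists t => //; lia. Qed.

Lemma evle_sq c1 c2 x y z T1 T2 : evle c1 x y T1 -> evle c2 y z T2 ->
  evle (TSq c1 c2) x z (T1 + T2).
Proof.
by move=> [t1 H1 E1] [t2 H2 E2]; exists (t1 + t2); [lia|apply: ev_sq E1 E2].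
Qed.

Lemma evle_wh1 c x y z T1 T2 : x.1 x.2 <> None -> evle c x y T1 ->
  evle (TWh c) y z T2 -> evle (TWh c) x z (T1 + T2).+1.
Proof.
by move=> H [t1 H1 E1] [t2 H2 E2]; exists (t1 + t2).+1; [lia|apply: ev_wh1 H E1 E2].
Qed.

Lemma evle_wh0 c x : x.1 x.2 = None -> evle (TWh c) x x 1.
Proof. by move=> H; exists 1 => //; apply: ev_wh0. Qed.

Lemma evle_br c0 c1 c2 x y T : evle (branch (x.1 x.2) c0 c1 c2) x y T ->
  evle (TBr c0 c1 c2) x y T.+1.
Proof. by move=> [t Ht E]; exists t.+1 => //; apply: ev_br. Qed.

Fixpoint mvs (d : move) (n : nat) : tcmd :=
  if n is n'.+1 then TSq (TMv d) (mvs d n') else TMv Stay.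

Definition shiftn (d : move) (n : nat) (p : int) : int :=
  match d with MoveL => (p - n%:Z)%R | MoveR => (p + n%:Z)%R | Stay => p end.

Lemma ev_mvs d n f p : ev (mvs d n) (f, p) (f, shiftn d n p) n.+1.
Proof.
elim: n p => [|n IH] p /=.
  have -> : shiftn d 0 p = p by case: (d) => /=; lia.
  exact: (ev_mv Stay (f, p)).
have -> : shiftn d n.+1 p = shiftn d n (shift d p) by case: (d) => /=; lia.
exact: (ev_sq (t1 := 1) (ev_mv d (f, p)) (IH _)).
Qed.

Section Stacks.
Variable m : nat.
Hypothesis m_gt0 : 0 < m.

(* Register 0 lives on the cells 0, 1, 2, ...; registers 1..m are interleaved
   on the cells left of -m, with stride m.  In both cases [pos i 0] is a cell
   which always stays blank, and cell -1 is the resting place of the head. *)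
Definition pos (i k : nat) : int :=
  if i is i'.+1 then (-1 - (i' + k * m)%:Z)%R else (k%:Z - 1)%R.

Lemma pos_inj i k i' k' : i <= m -> i' <= m ->
  pos i k.+1 = pos i' k'.+1 -> i = i' /\ k = k'.
Proof.
case: i i' => [|i] [|i'] //= Hi Hi'; try lia.
move=> H; have {}H : i + k * m = i' + k' * m by lia.
have div_m a b : a < m -> (a + b * m) %/ m = b.
  by move=> Ha; rewrite addnC divnMDl // divn_small // addn0.
have /= E := congr1 (fun x => x %/ m) H; rewrite !div_m // in E.
by rewrite E in H *; split=> //; lia.
Qed.

Lemma pos_guard i k i' : i <= m -> i' <= m -> pos i k.+1 <> pos i' 0.
Proof. case: i i' => [|i] [|i'] //= Hi Hi'; nia. Qed.

(** A stack grows away from its guard cell, so its bottom comes first on the track, whence [rev].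
    For register 0 the tape read from left to right shows the stack from bottom to top. *)
Definition rep (s : store) (f : tape) :=
  (forall i k, i <= m -> f (pos i k.+1) = nth None (rev (map Some (s i))) k) /\
  (forall i, i <= m -> f (pos i 0) = None).

Lemma rep_upd s f i v k x : rep s f -> i <= m ->
  (forall k', nth None (rev (map Some v)) k' =
     if k' == k then x else nth None (rev (map Some (s i))) k') ->
  rep (sset s i v) (tupd f (pos i k.+1) x).
Proof.
move=> [Hr Hg] Hi Hv; split=> [i' k' Hi'|i' Hi']; rewrite /tupd /sset.
  case: eqP => [E|E].
    by have [-> ->] := pos_inj Hi' Hi E; rewrite eqxx Hv eqxx.
  rewrite Hr //; case: eqP => // Ei; rewrite Ei in E *.
  by rewrite Hv; case: eqP => // Ek; rewrite Ek in E.
by case: eqP => [/esym/(pos_guard Hi Hi')//|_]; apply: Hg.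
Qed.

Lemma rep_push s f i b : rep s f -> i <= m ->
  rep (sset s i (b :: s i)) (tupd f (pos i (size (s i)).+1) (Some b)).
Proof.
move=> H Hi; apply: rep_upd => // k'; rewrite /= rev_cons nth_rcons size_rev size_map.
by case: ltngtP => // H'; rewrite nth_default // size_rev size_map ltnW.
Qed.

Lemma rep_pop s f i b r : rep s f -> i <= m -> s i = b :: r ->
  rep (sset s i r) (tupd f (pos i (size (s i))) None).
Proof.
move=> H Hi E; rewrite E; apply: rep_upd => // k'.
rewrite E /= rev_cons nth_rcons size_rev size_map.
by case: ltngtP => // H'; rewrite nth_default // size_rev size_map ?H' // ltnW.
Qed.

Lemma rep_ne s f i k : rep s f -> i <= m -> 0 < k <= size (s i) -> f (pos i k) <> None.
Proof.
case: k => // k [Hr _] Hi /= Hk; rewrite Hr // nth_rev ?size_map //.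
by rewrite (nth_map false) //; lia.
Qed.

Lemma rep_end s f i : rep s f -> i <= m -> f (pos i (size (s i)).+1) = None.
Proof. by move=> [Hr _] Hi; rewrite Hr // nth_default // size_rev size_map. Qed.

Definition dirf i := if i is 0 then MoveR else MoveL.
Definition dirb i := if i is 0 then MoveL else MoveR.
Definition stride i := if i is 0 then 1 else m.
Definition fwd i := mvs (dirf i) (stride i).
Definition back i := mvs (dirb i) (stride i).
Definition walk i := TSq (mvs (dirf i) i.-1) (TSq (fwd i) (TWh (fwd i))).
Definition goback i := TSq (TWh (back i)) (mvs (dirb i) i.-1).
(** The head ends on the top of the stack. For an empty stack this is the guard cell, whose blank
    serves as the test for emptiness. *)
Definition peek i := TSq (walk i) (back i).
Definition popc i := TSq (TWr None) (TSq (back i) (goback i)).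

(** Up to a small factor, the time of one traversal: at most D strides of m cells each, and the way
    between the resting place and the guard cell. *)
Definition op_cost D := (m + 3) * (D + 3).

Lemma stride_le i : (stride i).+1 <= m + 1.
Proof. by case: i => //=; lia. Qed.

Lemma evle_fwd i k f : evle (fwd i) (f, pos i k) (f, pos i k.+1) (m + 1).
Proof.
exists (stride i).+1; first exact: stride_le.
have -> : pos i k.+1 = shiftn (dirf i) (stride i) (pos i k) by case: i => /=; lia.
exact: ev_mvs.
Qed.

Lemma evle_back i k f : evle (back i) (f, pos i k.+1) (f, pos i k) (m + 1).
Proof.
exists (stride i).+1; first exact: stride_le.
have -> : pos i k = shiftn (dirb i) (stride i) (pos i k.+1) by case: i => /=; lia.
exact: ev_mvs.
Qed.

Lemma evle_climb s f i n : rep s f -> i <= m -> n <= size (s i) ->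
  evle (TWh (fwd i)) (f, pos i ((size (s i)).+1 - n)) (f, pos i (size (s i)).+1)
    (n * (m + 2) + 1).
Proof.
move=> Hr Hi; elim: n => [|n IH] Hn.
  by rewrite subn0; apply: evle_wh0; apply: rep_end.
have -> : n.+1 * (m + 2) + 1 = ((m + 1) + (n * (m + 2) + 1)).+1 by lia.
apply: evle_wh1 (IH (ltnW Hn)).
  by apply: rep_ne Hr Hi _; lia.
have -> : (size (s i)).+1 - n = ((size (s i)).+1 - n.+1).+1 by lia.
exact: evle_fwd.
Qed.

Lemma evle_walk s f i D : rep s f -> i <= m -> size (s i) <= D ->
  evle (walk i) (f, (-1)%R) (f, pos i (size (s i)).+1) (3 * op_cost D).
Proof.
move=> Hr Hi HD; rewrite /op_cost.
apply: (@evle_le _ _ _ (m + 1 + (m + 1 + (size (s i) * (m + 2) + 1)))); first by nia.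
apply: (@evle_sq _ _ _ (f, pos i 0)).
  exists i.-1.+1; first by lia.
  have -> : pos i 0 = shiftn (dirf i) i.-1 (-1)%R by case: i {Hi HD} => /=; lia.
  exact: ev_mvs.
apply: evle_sq (evle_fwd _ _ _) _.
have {1}-> : 1 = (size (s i)).+1 - size (s i) by lia.
exact: evle_climb.
Qed.

Lemma evle_goback s f i k D : rep s f -> i <= m -> k <= size (s i) -> k <= D ->
  evle (goback i) (f, pos i k) (f, (-1)%R) (2 * op_cost D).
Proof.
move=> Hr Hi Hk HD; rewrite /op_cost.
apply: (@evle_le _ _ _ ((k * (m + 2) + 1) + (m + 1))); first by nia.
apply: (@evle_sq _ _ _ (f, pos i 0)).
  elim: k Hk {HD} => [|k IH] Hk.
    by apply: evle_wh0; apply: Hr.2.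
  have -> : k.+1 * (m + 2) + 1 = ((m + 1) + (k * (m + 2) + 1)).+1 by lia.
  by apply: evle_wh1 (evle_back _ _ _) (IH (ltnW Hk)); apply: rep_ne Hr Hi _.
exists i.-1.+1; first by lia.
have -> : (-1)%R = shiftn (dirb i) i.-1 (pos i 0) by case: i {Hi Hk} => /=; lia.
exact: ev_mvs.
Qed.

Lemma evle_peek s f i D : rep s f -> i <= m -> size (s i) <= D ->
  evle (peek i) (f, (-1)%R) (f, pos i (size (s i))) (4 * op_cost D).
Proof.
move=> Hr Hi HD; apply: (evle_le _ (evle_sq (evle_walk Hr Hi HD) (evle_back _ _ _))).
by rewrite /op_cost; nia.
Qed.

Lemma evle_popc s f i b r D : rep s f -> i <= m -> s i = b :: r -> size (s i) <= D ->
  evle (popc i) (f, pos i (size (s i)))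
    (tupd f (pos i (size (s i))) None, (-1)%R) (4 * op_cost D).
Proof.
move=> Hr Hi E HD; have Hr' := rep_pop Hr Hi E.
apply: (@evle_le _ _ _ (1 + ((m + 1) + 2 * op_cost D))); first by rewrite /op_cost; nia.
apply: evle_sq.
  by exists 1 => //; apply: (ev_wr _ (f, _)).
rewrite /=; move: Hr' HD; rewrite E /= => Hr' HD.
apply: evle_sq (evle_back _ _ _) _.
by apply: evle_goback Hr' Hi _ _; rewrite /sset ?eqxx; lia.
Qed.

(** Inside the loop of [SWhile] the blank branch [TMv Stay] only fills a slot: [TWh] has just seen a
    nonblank cell. The loop keeps the head on top of stack i between iterations and returns to the
    resting place at the end. *)
Fixpoint scomp (c : scmd) : tcmd :=
  match c with
  | SSkip => TMv Stay
  | SPush i b => TSq (walk i) (TSq (TWr (Some b)) (goback i))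
  | SSeq c1 c2 => TSq (scomp c1) (scomp c2)
  | SCase i c0 cF cT =>
      TSq (peek i) (TBr (TSq (goback i) (scomp c0))
                        (TSq (popc i) (scomp cF)) (TSq (popc i) (scomp cT)))
  | SWhile i cF cT =>
      TSq (peek i) (TSq
        (TWh (TSq (TBr (TMv Stay) (TSq (popc i) (scomp cF)) (TSq (popc i) (scomp cT)))
                  (peek i)))
        (goback i))
  end.

Fixpoint sregs (c : scmd) : bool :=
  match c with
  | SSkip => true
  | SPush i _ => i <= m
  | SSeq c1 c2 => sregs c1 && sregs c2
  | SCase i c0 c1 c2 => [&& i <= m, sregs c0, sregs c1 & sregs c2]
  | SWhile i c1 c2 => [&& i <= m, sregs c1 & sregs c2]
  end.

Lemma rep_top s f i b r : rep s f -> i <= m -> s i = b :: r ->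
  f (pos i (size (s i))) = Some b.
Proof.
move=> [Hr _] Hi E; rewrite E /= Hr // E /= rev_cons nth_rcons size_rev size_map.
by rewrite ltnn eqxx.
Qed.

Definition outer c s s' t := sregs c ->
  forall f D, rep s f -> (forall i, i <= m -> size (s i) + t <= D) ->
  exists2 f', rep s' f' & evle (scomp c) (f, (-1)%R) (f', (-1)%R) (t * (20 * op_cost D)).

(** Induction on a run meets the remaining iterations of a loop as a run of the same loop, but the
    tape program performs them with the head on top of stack i; hence a second invariant. The 7
    units subtracted are reserved for the [peek] before the loop (4) and the [goback] after it
    (2). *)
Definition inner i cF cT s s' t := sregs (SWhile i cF cT) ->
  forall f D, rep s f -> (forall i, i <= m -> size (s i) + t <= D) ->
  exists2 f', rep s' f' & evle
    (TWh (TSq (TBr (TMv Stay) (TSq (popc i) (scomp cF)) (TSq (popc i) (scomp cT)))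
                  (peek i))) (f, pos i (size (s i))) (f', pos i 0)
     (t * (20 * op_cost D) - 7 * op_cost D).

Lemma inner_outer i cF cT s s' t : s' i = [::] -> exec (SWhile i cF cT) s s' t ->
  inner i cF cT s s' t -> outer (SWhile i cF cT) s s' t.
Proof.
move=> E0 He Hin Hs f D Hr HD; have [f' Hr' Hev] := Hin Hs f D Hr HD.
have /and3P[Hi _ _] := Hs.
have Ht : 0 < t by case: t He {Hin HD Hev} => // He; inversion He.
exists f' => //=.
apply: evle_le (evle_sq (evle_peek (D := D) Hr Hi _) (evle_sq Hev
  (evle_goback (D := D) Hr' Hi _ _))) => //.
- by nia.
- by have := HD _ Hi; lia.
Qed.

Lemma op_cost_gt0 D : 0 < op_cost D. Proof. by rewrite /op_cost; nia. Qed.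

Lemma exec_while_nil i cF cT s s' t : exec (SWhile i cF cT) s s' t -> s' i = [::].
Proof.
move E: (SWhile i cF cT) => c H; elim: H E => //.
by move=> i' cF' cT' s0 E0 [-> _ _].
Qed.

Lemma exec_evle_aux c s s' t : exec c s s' t ->
  outer c s s' t /\ (forall i cF cT, c = SWhile i cF cT -> inner i cF cT s s' t).
Proof.
elim=> {c s s' t}.
- move=> s; split=> // _ f D Hr HD; exists f => //=.
  by exists 1; [have := op_cost_gt0 D; lia|apply: (ev_mv Stay (f, _))].
- move=> i b s; split=> // Hi f D Hr HD /=.
  have Hr' := rep_push b Hr Hi; eexists; first exact: Hr'.
  have HDi := HD _ Hi.
  apply: evle_le (evle_sq (evle_walk (D := D) Hr Hi _) (evle_sq (T1 := 1) _
    (evle_goback (k := (size (s i)).+1) (D := D) Hr' Hi _ _))) => //.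
  + by have := op_cost_gt0 D; lia.
  + by lia.
  + by exists 1 => //; apply: (ev_wr _ (f, _)).
  + by rewrite /sset eqxx.
  + by lia.
- move=> i c0 cF cT s s' t E _ [IH _]; split=> // /= /and4P[Hi H0 HF HT] f D Hr HD.
  have [j Hj|f' Hr' Hev] := IH H0 f D Hr; first by have := HD _ Hj; lia.
  have HDi := HD _ Hi; exists f' => //.
  apply: evle_le (evle_sq (evle_peek (D := D) Hr Hi _) (evle_br (T := _) _)); last first.
  + rewrite /= E Hr.2 //=.
    by apply: evle_sq Hev; apply: (evle_goback (D := D) Hr Hi).
  + by lia.
  + by have := op_cost_gt0 D; lia.
- move=> i c0 cF cT b r s s' t E _ [IH _]; split=> // /= /and4P[Hi H0 HF HT] f D Hr HD.
  have HDi := HD _ Hi.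
  have [||f' Hr' Hev] := IH _ _ D (rep_pop Hr Hi E); first by case: (b).
    move=> j Hj; have := HD _ Hj; rewrite /sset; case: eqP => // [->|]; last by lia.
    by rewrite E /=; lia.
  exists f' => //.
  apply: evle_le (evle_sq (evle_peek (D := D) Hr Hi _) (evle_br (T := _) _)); last first.
  + rewrite /= (rep_top Hr Hi E) /=.
    by case: b E IH Hev => E IH Hev; apply: evle_sq (evle_popc (D := D) Hr Hi E _) Hev; lia.
  + by lia.
  + by have := op_cost_gt0 D; lia.
- move=> c1 c2 s s1 s2 t1 t2 H1 [IH1 _] _ [IH2 _]; split=> // /= /andP[Hs1 Hs2] f D Hr HD.
  have [j Hj|f1 Hr1 Hev1] := IH1 Hs1 f D Hr; first by have := HD _ Hj; lia.
  have [j Hj|f2 Hr2 Hev2] := IH2 Hs2 f1 D Hr1.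
    by have := HD _ Hj; have := exec_size H1 j; lia.
  by exists f2 => //; rewrite mulnDl; apply: evle_sq Hev1 Hev2.
- move=> i cF cT s E.
  have Hin : inner i cF cT s s 1.
    move=> /= /and3P[Hi _ _] f D Hr HD; exists f => //.
    rewrite E; apply: (@evle_le _ _ _ 1); first by have := op_cost_gt0 D; lia.
    by apply: evle_wh0; apply: Hr.2.
  split; last by move=> _ _ _ [<- <- <-].
  by apply: inner_outer Hin => //; apply: ex_wh0.
- move=> i cF cT b r s s1 s2 t1 t2 E H1 [IH1 _] H2 [_ IH2].
  have Hin : inner i cF cT s s2 (t1 + t2).+1.
    move=> Hs f D Hr HD; have /and3P[Hi HF HT] := Hs.
    have HDi := HD _ Hi.
    have Ht2 : 0 < t2 by case: (t2) H2 => // He; inversion He.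
    have [||f1 Hr1 Hev1] := IH1 _ _ D (rep_pop Hr Hi E); first by case: (b).
      move=> j Hj; have := HD _ Hj; rewrite /sset; case: eqP => // [->|]; last by lia.
      by rewrite E /=; lia.
    have Hsz j : j <= m -> size (s1 j) + t2 <= D.
      move=> Hj; have := HD _ Hj; have := exec_size H1 j; rewrite /sset.
      by case: eqP => [->|_]; rewrite ?E /=; lia.
    have [//|f2 Hr2 Hev2] := IH2 _ _ _ erefl Hs f1 D Hr1.
    exists f2 => //.
    apply: evle_le (evle_wh1 (y := (f1, pos i (size (s1 i)))) (T1 := 1 + 4 * op_cost D + t1 * (20 * op_cost D) + 4 * op_cost D) _ _ Hev2).
    + by have := op_cost_gt0 D; nia.
    + by rewrite /= (rep_top Hr Hi E).
    + apply: evle_sq (evle_peek Hr1 Hi _); last by have := Hsz _ Hi; lia.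
      rewrite -addnA; apply: evle_br.
      rewrite /= (rep_top Hr Hi E) /=.
      by case: b E IH1 Hev1 {H1} => E IH Hev; apply: evle_sq (evle_popc (D := D) Hr Hi E _) Hev; lia.
  split; last by move=> _ _ _ [<- <- <-].
  by apply: inner_outer Hin => //; [apply: exec_while_nil H2|apply: ex_wh1 E H1 H2].
Qed.

Lemma exec_evle c s s' t f D : exec c s s' t -> sregs c -> rep s f ->
  (forall i, i <= m -> size (s i) + t <= D) ->
  exists2 f', rep s' f' & evle (scomp c) (f, (-1)%R) (f', (-1)%R) (t * (20 * op_cost D)).
Proof. by move=> /exec_evle_aux[H _] Hs Hr HD; apply: H. Qed.

End Stacks.

(** * Programs with input-bounded loops *)

Inductive rcmd :=
  | RSkip
  | RPush of nat & bool
  | RCase of nat & rcmd & rcmd & rcmd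
  | RSeq of rcmd & rcmd
  | RRep of rcmd.

Fixpoint den (N : nat) (c : rcmd) (s : store) : store :=
  match c with
  | RSkip => s
  | RPush i b => sset s i (b :: s i)
  | RCase i c0 cF cT =>
      match s i with
      | [::] => den N c0 s
      | false :: r => den N cF (sset s i r)
      | true :: r => den N cT (sset s i r)
      end
  | RSeq c1 c2 => den N c2 (den N c1 s)
  | RRep c => iter N (den N c) s
  end.

(** For [RRep], an iteration pops one counter and pushes on another, and restoring the counter
    repeats this once more: 4 extra units. The 2 pays for the final tests of the two loops. *)
Fixpoint rcost (N : nat) (c : rcmd) : nat :=
  match c with
  | RSkip => 1
  | RPush _ _ => 1
  | RCase _ c0 cF cT => (rcost N c0 + rcost N cF + rcost N cT).+1
  | RSeq c1 c2 => rcost N c1 + rcost N c2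
  | RRep c => N * (rcost N c + 4) + 2
  end.

Fixpoint rdepth (c : rcmd) : nat :=
  match c with
  | RSkip | RPush _ _ => 0
  | RCase _ c0 cF cT => maxn (rdepth c0) (maxn (rdepth cF) (rdepth cT))
  | RSeq c1 c2 => maxn (rdepth c1) (rdepth c2)
  | RRep c => (rdepth c).+1
  end.

Fixpoint rregs (V : nat) (c : rcmd) : bool :=
  match c with
  | RSkip => true
  | RPush i _ => i < V
  | RCase i c0 cF cT => [&& i < V, rregs V c0, rregs V cF & rregs V cT]
  | RSeq c1 c2 => rregs V c1 && rregs V c2
  | RRep c => rregs V c
  end.

Lemma rcost_poly c : exists a, forall N, rcost N c <= a * N.+1 ^ rdepth c.
Proof.
have mono N a b d d' : d <= d' -> b <= a * N.+1 ^ d -> b <= a * N.+1 ^ d'.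
  by move=> Hd H; apply: leq_trans H _; rewrite leq_mul2l leq_pexp2l ?orbT.
elim: c => [|i b|i c0 [a0 H0] cF [aF HF] cT [aT HT]|c1 [a1 H1] c2 [a2 H2]|c [a H]] /=.
- by exists 1 => N.
- by exists 1 => N.
- exists (a0 + aF + aT).+1 => N; set d := maxn _ _.
  have := @mono N _ _ _ d _ (H0 N); have := @mono N _ _ _ d _ (HF N).
  have := @mono N _ _ _ d _ (HT N); rewrite /d !leq_max !leqnn !orbT.
  move=> /(_ isT) A /(_ isT) B /(_ isT) C.
  have : 0 < N.+1 ^ d by rewrite expn_gt0.
  by rewrite -/d in A B C *; nia.
- exists (a1 + a2) => N; set d := maxn _ _.
  have := @mono N _ _ _ d _ (H1 N); have := @mono N _ _ _ d _ (H2 N).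
  by rewrite /d !leq_max !leqnn !orbT => /(_ isT) A /(_ isT) B; nia.
- exists (a + 6) => N; have := H N; rewrite expnS.
  have : 0 < N.+1 ^ rdepth c by rewrite expn_gt0.
  by nia.
Qed.

Lemma ssetE s i v : sset s i v i = v. Proof. by rewrite /sset eqxx. Qed.
Lemma sset_neq s i v j : j != i -> sset s i v j = s j.
Proof. by rewrite /sset => /negbTE ->. Qed.
Lemma sset_ss s i v w : sset (sset s i v) i w = sset s i w.
Proof. by apply: functional_extensionality => j; rewrite /sset; case: eqP. Qed.
Lemma sset_id s i v : s i = v -> sset s i v = s.
Proof. by move=> <-; apply: functional_extensionality => j; rewrite /sset; case: eqP => [->|]. Qed.
Lemma sset_comm s i j v w : i != j -> sset (sset s i v) j w = sset (sset s j w) i v.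
Proof.
move=> H; apply: functional_extensionality => k; rewrite /sset.
by case: eqP => // ->; case: eqP => // E; rewrite E eqxx in H.
Qed.

(** Loop counters live in registers from V on; commands of the source program commute with changing
    them. *)
Lemma den_sset V N c s i v : rregs V c -> V <= i ->
  den N c (sset s i v) = sset (den N c s) i v.
Proof.
move=> Hc Hi.
have ne j : j < V -> j != i by move=> ?; apply/eqP; lia.
elim: c s Hc => [|j b|j c0 IH0 cF IHF cT IHT|c1 IH1 c2 IH2|c IH] s //=.
- by move=> /ne Hj; rewrite sset_neq // sset_comm // eq_sym.
- move=> /and4P[/ne Hj H0 HF HT]; rewrite sset_neq //.
  case: (s j) => [|[] r]; rewrite ?IH0 //.
  + by rewrite sset_comm 1?eq_sym // IHT.
  + by rewrite sset_comm 1?eq_sym // IHF.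
- by move=> /andP[H1 H2]; rewrite IH1 // IH2.
- by move=> Hc; elim: {1 3}N => //= n ->; rewrite IH.
Qed.

Lemma den_frame V N c s i : rregs V c -> V <= i -> den N c s i = s i.
Proof.
move=> Hc Hi; rewrite -{1}[s](@sset_id _ i (s i)) // (den_sset _ _ _ Hc Hi).
by rewrite ssetE.
Qed.

Lemma den_ext V N c s s' : rregs V c -> (forall i, i < V -> s i = s' i) ->
  forall i, i < V -> den N c s i = den N c s' i.
Proof.
elim: c s s' => [|j b|j c0 IH0 cF IHF cT IHT|c1 IH1 c2 IH2|c IH] s s' /= Hc Hs //.
- by move=> i Hi; rewrite /sset; case: eqP => _; rewrite ?Hs.
- have /and4P[Hj H0 HF HT] := Hc; rewrite Hs //.
  case: (s' j) => [|[] r]; first exact: IH0.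
  + by apply: IHT => // i Hi; rewrite /sset; case: eqP => _ //; apply: Hs.
  + by apply: IHF => // i Hi; rewrite /sset; case: eqP => _ //; apply: Hs.
- have /andP[H1 H2] := Hc.
  by apply: IH2 => //; apply: IH1.
- by elim: {1 3}N => //= n IHn; apply: IH.
Qed.

Lemma exec_eq c s s1 s2 t : s1 = s2 -> exec c s s1 t -> exec c s s2 t.
Proof. by move=> <-. Qed.

Lemma nseq_cat_cons k (b : bool) l : nseq k b ++ b :: l = nseq k.+1 b ++ l.
Proof. by elim: k => //= k ->. Qed.

Section Compile.
Variables (V N : nat).

(** Each nesting depth has two counters. [drv] starts with N bits and is unloaded into [done_drv],
    one bit per iteration; afterwards it is reloaded, so that the same loop can be entered again by
    an enclosing one. *)
Definition drv d := V + d.*2.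
Definition done_drv d := (V + d.*2).+1.

Fixpoint rcomp (d : nat) (c : rcmd) : scmd :=
  match c with
  | RSkip => SSkip
  | RPush i b => SPush i b
  | RCase i c0 cF cT => SCase i (rcomp d c0) (rcomp d cF) (rcomp d cT)
  | RSeq c1 c2 => SSeq (rcomp d c1) (rcomp d c2)
  | RRep c =>
      let body := SSeq (SPush (done_drv d) true) (rcomp d.+1 c) in
      SSeq (SWhile (drv d) body body)
           (SWhile (done_drv d) (SPush (drv d) true) (SPush (drv d) true))
  end.

Definition ready (d n : nat) (s : store) := forall d', d <= d' < n ->
  s (drv d') = nseq N true /\ s (done_drv d') = [::].

Lemma ready_den d n c s : rregs V c -> ready d n s -> ready d n (den N c s).
Proof.
move=> Hc Hr d' Hd'; have := Hr _ Hd'.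
by rewrite !(den_frame _ _ Hc) /drv /done_drv //; lia.
Qed.

Lemma ready_sset d n s i v : ready d n s -> i < V + d.*2 -> ready d n (sset s i v).
Proof.
move=> Hr Hi d' Hd'; have := Hr _ Hd'.
by rewrite /drv /done_drv !sset_neq //; apply/eqP; lia.
Qed.

Lemma ready_S d n s : ready d n s -> ready d.+1 n s.
Proof. by move=> H d' Hd; apply: H; lia. Qed.

Lemma rcomp_exec c d n s : rregs V c -> d + rdepth c <= n -> ready d n s ->
  exists2 t, t <= rcost N c & exec (rcomp d c) s (den N c s) t.
Proof.
elim: c d s => [|j b|j c0 IH0 cF IHF cT IHT|c1 IH1 c2 IH2|c IH] d s /= Hc Hd Hr.
- by exists 1 => //; constructor.
- by exists 1 => //; constructor.
- have /and4P[Hj H0 HF HT] := Hc.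
  case E: (s j) => [|b r].
    have [t Ht He] := IH0 d s H0 ltac:(lia) Hr.
    by exists t.+1; [lia|apply: ex_case0].
  have Hr' : ready d n (sset s j r) by apply: ready_sset => //; lia.
  case: b E => E.
    have [t Ht He] := IHT d _ HT ltac:(lia) Hr'.
    by exists t.+1; [lia|apply: ex_case1 E _].
  have [t Ht He] := IHF d _ HF ltac:(lia) Hr'.
  by exists t.+1; [lia|apply: ex_case1 E _].
- have /andP[H1 H2] := Hc.
  have [t1 Ht1 He1] := IH1 d s H1 ltac:(lia) Hr.
  have [t2 Ht2 He2] := IH2 d _ H2 ltac:(lia) (ready_den H1 Hr).
  by exists (t1 + t2); [lia|apply: ex_seq He1 He2].
- have [Hdr Hau] := Hr d ltac:(lia).
  set body := SSeq (SPush (done_drv d) true) _.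
  have ne : done_drv d != drv d by rewrite /done_drv /drv; apply/eqP; lia.
  have loop1 k s0 : ready d.+1 n s0 -> s0 (drv d) = nseq k true ->
    exists2 t, t <= k * (rcost N c + 2) + 1 & exec (SWhile (drv d) body body) s0
       (sset (sset (iter k (den N c) s0) (drv d) [::]) (done_drv d) (nseq k true ++ s0 (done_drv d))) t.
    elim: k s0 => [|k IHk] s0 Hr0 E.
      exists 1 => //=.
      rewrite (@sset_id s0) // (@sset_id s0) //.
      exact: ex_wh0.
    pose s1 := sset (sset s0 (drv d) (nseq k true)) (done_drv d) (true :: s0 (done_drv d)).
    have Hr1 : ready d.+1 n s1.
      by do 2![apply: ready_sset; last by rewrite /drv /done_drv; lia].
    have [t1 Ht1 He1] := IH d.+1 s1 Hc ltac:(lia) Hr1.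
    have Es1 : den N c s1 = sset (sset (den N c s0) (drv d) (nseq k true)) (done_drv d)
        (true :: s0 (done_drv d)).
      by rewrite /s1 !(den_sset _ _ _ Hc) // /drv /done_drv; lia.
    have [||t2 Ht2 He2] := IHk (den N c s1).
    + exact: ready_den.
    + by rewrite Es1 sset_neq 1?eq_sym // ssetE.
    exists (1 + t1 + t2).+1; first by nia.
    apply: ex_wh1 (E) _ _.
      apply: ex_seq (ex_push _ _ _) _.
      by rewrite (sset_neq _ _ ne); apply: He1.
    have it k' u i w : V <= i -> iter k' (den N c) (sset u i w) = sset (iter k' (den N c) u) i w.
      by move=> Hi; elim: k' => //= k' ->; rewrite (den_sset _ _ _ Hc).
    apply: exec_eq He2.
    rewrite Es1 !it ?ssetE; try by rewrite /drv /done_drv; lia.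
    rewrite -iterSr nseq_cat_cons.
    by apply: functional_extensionality => j; rewrite /sset; case: (j == done_drv d); case: (j == drv d).
  have loop2 k s0 : s0 (done_drv d) = nseq k true ->
    exec (SWhile (done_drv d) (SPush (drv d) true) (SPush (drv d) true)) s0
       (sset (sset s0 (done_drv d) [::]) (drv d) (nseq k true ++ s0 (drv d))) (k * 2 + 1).
    elim: k s0 => [|k IHk] s0 E /=.
      rewrite (@sset_id s0) // (@sset_id s0) //.
      exact: ex_wh0.
    pose s1 := sset (sset s0 (done_drv d) (nseq k true)) (drv d) (true :: s0 (drv d)).
    have := IHk s1; rewrite {1}/s1 sset_neq // ssetE => /(_ erefl).
    have -> : k.+1 * 2 + 1 = (1 + (k * 2 + 1)).+1 by lia.
    move=> He; apply: ex_wh1 E _ _.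
      exact: ex_push.
    rewrite sset_neq 1?eq_sym //.
    apply: exec_eq He.
    rewrite /s1 !ssetE nseq_cat_cons.
    by apply: functional_extensionality => j; rewrite /sset; case: (j == done_drv d); case: (j == drv d).
  have [t1 Ht1 He1] := loop1 N s (ready_S Hr) Hdr.
  exists (t1 + (N * 2 + 1)); first by nia.
  apply: ex_seq He1 _.
  set s1 := sset _ (done_drv d) _.
  have He2 := loop2 N s1; rewrite {1}/s1 ssetE Hau cats0 in He2.
  apply: exec_eq (He2 erefl).
  have fr i : V <= i -> iter N (den N c) s i = s i.
    by move=> Hi; elim: {1}N => //= k; rewrite (den_frame _ _ Hc).
  apply: functional_extensionality => j.
  rewrite /s1 {1}/sset; case: eqP => [->|H1].
    by rewrite sset_neq 1?eq_sym // ssetE cats0 fr ?Hdr // /drv; lia.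
  rewrite /sset; case: eqP => [->|H2]; first by rewrite fr ?Hau // /done_drv; lia.
  by case: eqP.
Qed.

Lemma rcomp_regs m c d : rregs V c -> V + (d + rdepth c).*2 <= m -> 0 < V ->
  sregs m (rcomp d c).
Proof.
elim: c d => [|j b|j c0 IH0 cF IHF cT IHT|c1 IH1 c2 IH2|c IH] d //= Hc Hm HV.
- by lia.
- have /and4P[Hj H0 HF HT] := Hc.
  by rewrite IH0 ?IHF ?IHT ?andbT //; lia.
- have /andP[H1 H2] := Hc.
  by rewrite IH1 ?IH2 //; lia.
- by rewrite IH // /done_drv /drv; lia.
Qed.

End Compile.

(** * Loading the counters and running a program *)

Section Program.
Variables (V : nat) (c : rcmd).
Hypotheses (V_gt1 : 1 < V) (c_regs : rregs V c).
Let n := rdepth c.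
Let m := V + n.*2.

Fixpoint fill (k : nat) : scmd :=
  if k is k'.+1 then SSeq (fill k') (SPush (drv V k') true) else SSkip.

(** Register 0 initially has the last input bit on top, so moving it to register 1 puts the first
    bit on top. Every bit moved loads one unit into each counter, which makes N the input length. *)
Definition prologue : scmd :=
  SWhile 0 (SSeq (SPush 1 false) (fill n)) (SSeq (SPush 1 true) (fill n)).

Definition machine : tcmd :=
  TSq (TMv MoveL) (TSq (scomp m (SSeq prologue (rcomp V 0 c))) (TMv MoveR)).

(** Closed form of the condition that i is [drv V d] for some d < k. *)
Definition isdrv k i := [&& V <= i, ~~ odd (i - V) & (i - V)./2 < k].

Lemma isdrv_drv k d : isdrv k (drv V d) = (d < k).
Proof. rewrite /isdrv /drv; lia. Qed.

Lemma fill_exec k s :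
  exec (fill k) s (fun i => if isdrv k i then true :: s i else s i) k.+1.
Proof.
elim: k => [|k IH].
  have -> : (fun i => if isdrv 0 i then true :: s i else s i) = s.
    by apply: functional_extensionality => i; rewrite /isdrv !andbF.
  exact: ex_skip.
rewrite -[k.+2]addn1; apply: ex_seq IH _.
set s1 := (X in exec _ X); set s2 := (X in exec _ _ X).
have -> : s2 = sset s1 (drv V k) (true :: s1 (drv V k)); last exact: ex_push.
apply: functional_extensionality => i; rewrite /s1 /s2 /sset isdrv_drv ltnn.
case: eqP => [->|ne]; first by rewrite isdrv_drv ltnS leqnn.
have -> // : isdrv k.+1 i = isdrv k i.
by move: ne; rewrite /isdrv /drv; lia.
Qed.

(* During the prologue: r is what is left of the input (last bit on top), l what has been moved. *)
Definition pstate (r l : bits) : store := fun i =>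
  if i == 0 then r else if i == 1 then l else
  if isdrv n i then nseq (size l) true else [::].

Lemma prologue_exec r l :
  exec prologue (pstate r l) (pstate [::] (catrev r l)) (size r * (n + 3) + 1).
Proof.
have V0 i : i <= 1 -> isdrv n i = false by move=> Hi; rewrite /isdrv; lia.
elim: r l => [|b r IH] l; first exact: ex_wh0.
have -> : size (b :: r) * (n + 3) + 1 = ((1 + n.+1) + (size r * (n + 3) + 1)).+1.
  by rewrite /=; lia.
apply: ex_wh1 (IH (b :: l)); first by [].
have -> : sset (pstate (b :: r) l) 0 r = pstate r l.
  by apply: functional_extensionality => i; rewrite /sset /pstate; case: eqP.
have H : exec (SSeq (SPush 1 b) (fill n)) (pstate r l) (pstate r (b :: l)) (1 + n.+1).
  apply: ex_seq (ex_push _ _ _) _.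
  set s1 := sset _ _ _.
  have -> : pstate r (b :: l) = (fun i => if isdrv n i then true :: s1 i else s1 i).
    apply: functional_extensionality => i; rewrite /s1 /sset /pstate.
    case: (i =P 0) => [->|H0]; first by rewrite V0.
    case: (i =P 1) => [->|H1]; first by rewrite V0.
    by case: (isdrv n i).
  exact: fill_exec.
by case: (b) H.
Qed.

Lemma fill_regs k : k <= n -> sregs m (fill k).
Proof.
elim: k => //= k IH Hk; rewrite IH ?(ltnW Hk) //= /m /drv.
by lia.
Qed.

Definition input_store (x : bits) : store := sset (fun _ => [::]) 1 x.

Lemma rep_input x : rep m (pstate (rev x) [::]) (tape_of x).
Proof.
have E i : pstate (rev x) [::] i = if i == 0 then rev x else [::].
  by rewrite /pstate; case: eqP => // _; case: eqP => // _; case: ifP.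
split=> [i k Hi|[|i] Hi]; last 2 first.
- by [].
- by have -> : pos m i.+1 0 = Negz i by rewrite /=; lia.
rewrite E; case: i Hi => [|i] Hi.
  have -> : pos m 0 k.+1 = Posz k by rewrite /pos; lia.
  by rewrite eqxx map_rev revK.
have -> : pos m i.+1 k.+1 = Negz (i + k.+1 * m) by rewrite /pos; lia.
by rewrite nth_nil.
Qed.

(** The output stack must hold [rev y] because the leftmost cell of its track is its bottom. *)
Theorem program_computes : exists (M : TM) (a d : nat), forall x y,
  den (size x) c (input_store x) 0 = rev y ->
  tm_computes_within M x y (a * (size x).+1 ^ d).
Proof.
have [ac Hac] := rcost_poly c.
pose q := (n + 4 + ac) .
(* The number of commands and the stack heights are both bounded by multiples of [N.+1 ^ n.+1], and
   the time by a multiple of their product; the 2 pays for the moves to the resting place and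
   back. *)
exists (TM_of machine), (2 + q * (20 * ((m + 3) * (q + 4)))), (n.+1 + n.+1) => x y Hden.
set N := size x in Hden *.
have m_gt0 : 0 < m by rewrite /m; lia.
have Hrd : ready V N 0 n (pstate [::] x).
  move=> d Hd; rewrite /pstate /drv /done_drv.
  have -> : (V + d.*2 == 0) = false by apply/eqP; lia.
  have -> : (V + d.*2 == 1) = false by apply/eqP; lia.
  have -> : isdrv n (V + d.*2).+1 = false by rewrite /isdrv; lia.
  have -> : ((V + d.*2).+1 == 1) = false by apply/eqP; lia.
  by rewrite -/(drv V d) isdrv_drv (andP Hd).2.
have [t2 Ht2 He2] := rcomp_exec (d := 0) c_regs (leqnn n) Hrd.
have He1 := prologue_exec (rev x) [::]; rewrite catrevE revK cats0 in He1.
have He := ex_seq He1 He2.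
set t := _ + t2 in He.
have Ht : t <= q * N.+1 ^ n.+1.
  rewrite /t /q size_rev -/N.
  have := Hac N; rewrite -/n => Hc.
  have : N.+1 ^ 1 <= N.+1 ^ n.+1 by apply: leq_pexp2l.
  rewrite expn1.
  have : N.+1 ^ n <= N.+1 ^ n.+1 by apply: leq_pexp2l.
  by nia.
have Hsr : sregs m (SSeq prologue (rcomp V 0 c)).
  rewrite /= !fill_regs // rcomp_regs //; last by lia.
  by rewrite /m; lia.
have [|f Hf [T HT Hev]] := exec_evle m_gt0 (D := N + t) He Hsr (rep_input x).
  move=> i Hi; rewrite leq_add2r /pstate.
  by case: eqP => _; [rewrite size_rev|case: eqP => _ //; case: ifP].
apply: (@TM_of_computes machine x y f 0%R (1 + (T + 1))).
- apply: (ev_sq (ev_mv MoveL _)); apply: ev_sq Hev _.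
  exact: (ev_mv MoveR (f, (-1)%R)).
- have H1 : N.+1 ^ 1 <= N.+1 ^ n.+1 by apply: leq_pexp2l.
  rewrite expn1 in H1.
  set X := N.+1 ^ n.+1 in Ht H1; rewrite expnD -/X.
  have H2 : N + t + 3 <= (q + 4) * X by rewrite mulnDl; lia.
  have H3 : t * (20 * op_cost m (N + t)) <= q * (20 * ((m + 3) * (q + 4))) * (X * X).
    have -> : q * (20 * ((m + 3) * (q + 4))) * (X * X) =
        (q * X) * (20 * ((m + 3) * ((q + 4) * X))) by ring.
    by rewrite /op_cost; apply: leq_mul => //; rewrite !leq_mul2l H2 !orbT.
  have H4 : 1 <= X * X by rewrite muln_gt0 /X expn_gt0.
  apply: leq_trans (_ : 2 + t * (20 * op_cost m (N + t)) <= _); first by lia.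
  by rewrite mulnDl; apply: leq_add => //; lia.
- move=> j Hj; have := Hf.1 0 j isT.
  have -> : pos m 0 j.+1 = (0 + j%:Z)%R by rewrite /=; lia.
  move=> ->; congr nth.
  rewrite -map_rev -[y]revK -Hden; congr (map _ (rev _)).
  apply: den_ext (c_regs) _ 0 (ltnW V_gt1) => i Hi.
  rewrite /input_store /sset /pstate.
  case: eqP => [->//|_]; case: eqP => // _.
  by rewrite /isdrv; case: ifP => //; lia.
Qed.

End Program.

(** * Operations on encoded strings *)

Notation "a ;; b" := (RSeq a b) (at level 60, right associativity).

(** Repeating N times a command that skips on an empty register acts as a while loop as long as the
    register holds at most N bits. This is the source of the size hypotheses in the specifications
    below. *)
Definition drain i cF cT := RRep (RCase i RSkip cF cT).
Definition clear i := drain i RSkip RSkip.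
Definition mv a b := drain a (RPush b false) (RPush b true).
Definition copy a b t :=
  mv a t ;; drain t (RPush a false ;; RPush b false) (RPush a true ;; RPush b true).
(* The body has to push [true] on the flag f in order to go on. *)
Definition until f c := RPush f true ;; RRep (RCase f RSkip RSkip c).
Definition peek_if i c0 c1 :=
  RCase i c0 (RPush i false ;; c1) (RPush i true ;; c1).
Definition readrev a b f :=
  until f (RCase a RSkip (RCase a RSkip RSkip RSkip)
    (RCase a RSkip (RPush b false ;; RPush f true) (RPush b true ;; RPush f true))).
Definition rd a b t f := readrev a t f ;; mv t b.
Definition writestr a o :=
  drain a (RPush o true ;; RPush o false) (RPush o true ;; RPush o true) ;;
  RPush o false ;; RPush o false.
Definition consstr t z :=
  RPush z false ;; RPush z false ;;
  drain t (RPush z false ;; RPush z true) (RPush z true ;; RPush z true).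
Fixpoint tk B a t :=
  if B is B'.+1 then
    RCase a RSkip (RPush t false ;; tk B' a t) (RPush t true ;; tk B' a t)
  else RSkip.
Definition constake B a t z := tk B a t ;; clear a ;; consstr t z.
Fixpoint emit (l : bits) o :=
  if l is b :: l' then emit l' o ;; RPush o b else RSkip.
(** A decision tree on the top B bits of register a. [F] is applied at the leaves while the program
    is constructed, so it may be any function at all. *)
Fixpoint tab B (acc : bits) a (F : bits -> bits) o :=
  if B is B'.+1 then
    RCase a (emit (F acc) o) (tab B' (rcons acc false) a F o)
      (tab B' (rcons acc true) a F o)
  else emit (F acc) o.
(** The flag e is popped at a mismatch; popping it again is harmless, since [RCase] skips on an
    empty register. *)
Definition eqstr a b e :=
  RPush e true ;;
  drain a (RCase b (RCase e RSkip RSkip RSkip) RSkip (RCase e RSkip RSkip RSkip))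
          (RCase b (RCase e RSkip RSkip RSkip) (RCase e RSkip RSkip RSkip) RSkip) ;;
  RCase b RSkip (RCase e RSkip RSkip RSkip) (RCase e RSkip RSkip RSkip) ;;
  clear b.
Definition incr a t f :=
  until f (RCase a (RPush a true) (RPush a true) (RPush t false ;; RPush f true)) ;;
  mv t a.

Ltac store_at :=
  repeat match goal with H : is_true (_ != _) |- _ => move/eqP: H => H end;
  rewrite /= /sset;
  repeat match goal with
  | |- context [@eq_op _ ?x ?y] => case: (@eqP _ x y) => ?
  end; try congruence.

Ltac store_eq :=
  let j := fresh "j" in
  repeat match goal with H : is_true (_ != _) |- _ => move/eqP: H => H end;
  apply: functional_extensionality => j; rewrite /sset;
  repeat match goal with
  | |- context [@eq_op _ ?x ?y] => case: (@eqP _ x y) => ?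
  end; try congruence.

Lemma den_seq N c1 c2 s : den N (c1 ;; c2) s = den N c2 (den N c1 s).
Proof. by []. Qed.
Lemma den_push N i b s : den N (RPush i b) s = sset s i (b :: s i).
Proof. by []. Qed.
Lemma den_case0 N i c0 cF cT s : s i = [::] -> den N (RCase i c0 cF cT) s = den N c0 s.
Proof. by move=> /= ->. Qed.
Lemma den_case1 N i c0 cF cT s b r : s i = b :: r ->
  den N (RCase i c0 cF cT) s = den N (if b then cT else cF) (sset s i r).
Proof. by move=> /= ->; case: b. Qed.

Section Den.
Variable N : nat.

Lemma iter_case_stop i cF cT s k : s i = [::] ->
  iter k (den N (RCase i RSkip cF cT)) s = s.
Proof. by move=> H; elim: k => //= k ->; rewrite H. Qed.

(** The loop invariant is indexed by what is left in register i, so the postcondition is its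
    instance at the empty string. *)
Lemma den_drain i cF cT (P : bits -> store -> Prop) s :
  size (s i) <= N -> P (s i) s ->
  (forall b r s', s' i = b :: r -> P (b :: r) s' ->
     let s1 := den N (if b then cT else cF) (sset s' i r) in s1 i = r /\ P r s1) ->
  P [::] (den N (drain i cF cT) s).
Proof.
move=> HN H0 Hs.
suff it k s1 : size (s1 i) <= k -> P (s1 i) s1 ->
  P [::] (iter k (den N (RCase i RSkip cF cT)) s1) by apply: it.
elim: k s1 => [|k IH] s1 H1 H2; first by move: H1 H2; case: (s1 i).
case E: (s1 i) H1 H2 => [|b r] H1 H2; first by rewrite iter_case_stop.
rewrite iterSr (den_case1 _ _ _ _ E).
have [H3 H4] := Hs b r s1 E H2.
by apply: IH; rewrite H3.
Qed.

Lemma den_clear i s : size (s i) <= N -> den N (clear i) s = sset s i [::].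
Proof.
move=> HN; apply: (@den_drain i RSkip RSkip (fun r s' => s' = sset s i r)) => //.
  by rewrite sset_id.
move=> b r s' _ -> /=; rewrite sset_ss.
by case: b; rewrite /= ssetE.
Qed.

Lemma den_mv a b s : a != b -> size (s a) <= N ->
  den N (mv a b) s = sset (sset s a [::]) b (catrev (s a) (s b)).
Proof.
move=> ne HN.
pose P r s' := exists l, catrev (s a) (s b) = catrev r l /\ s' = sset (sset s a r) b l.
suff [l [/= -> ->]] : P [::] (den N (mv a b) s) by [].
apply: den_drain => //.
  by exists (s b); rewrite (@sset_id s) // (@sset_id s).
move=> c r s' _ [l [E ->]] /=.
have -> : den N (if c then RPush b true else RPush b false)
    (sset (sset (sset s a (c :: r)) b l) a r) = sset (sset s a r) b (c :: l).
  have -> : (if c then RPush b true else RPush b false) = RPush b c by case: c {E}.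
  apply: functional_extensionality => j; rewrite /= /sset eqxx (eq_sym b a) (negbTE ne).
  by case: (j == b) => //; case: (j == a).
split; first by rewrite sset_neq // ssetE.
by exists (c :: l).
Qed.

Lemma den_copy a b t s : a != b -> a != t -> b != t -> s t = [::] -> size (s a) <= N ->
  den N (copy a b t) s = sset s b (s a ++ s b).
Proof.
move=> ab at_ bt st HN; rewrite den_seq den_mv // st.
set s1 := sset _ t _.
pose P r s' := exists l, catrev r l = s a /\ s' = sset (sset (sset s t r) a l) b (l ++ s b).
suff [l [/= E ->]] : P [::] (den N (drain t (RPush a false ;; RPush b false) (RPush a true ;; RPush b true)) s1).
  rewrite E (@sset_id s t) ?(@sset_id s a) //.
apply: den_drain.
- by rewrite /s1 ssetE catrevE cats0 size_rev.
- rewrite {1}/s1 ssetE; exists [::]; split; first by rewrite !catrevE !cats0 revK.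
  by rewrite /s1 /=; clear s1; store_eq.
move=> c r s' _ [l [E ->]].
have -> : (if c then RPush a true ;; RPush b true else RPush a false ;; RPush b false)
  = (RPush a c ;; RPush b c) by case: c {E}.
set s2 := den _ _ _; have -> : s2 = sset (sset (sset s t r) a (c :: l)) b ((c :: l) ++ s b).
  rewrite /s2 den_seq !den_push.
  by clear s2; store_eq.
split; last by exists (c :: l).
by rewrite sset_neq 1?eq_sym // sset_neq 1?eq_sym // ssetE.
Qed.

Lemma enc_str_cons b x : enc_str (b :: x) = true :: b :: enc_str x.
Proof. by []. Qed.

(** Each round consumes one pair of the self-delimiting code, and the closing pair takes a round of
    its own; hence the strict bound on [size x]. *)
Lemma den_readrev a b f s x r : a != b -> a != f -> b != f -> s f = [::] ->
  s a = enc_str x ++ r -> size x < N ->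
  den N (readrev a b f) s = sset (sset s a r) b (catrev x (s b)).
Proof.
move=> ab af bf sf sa HN; rewrite /readrev /until den_seq den_push sf.
set c := RCase f _ _ _; rewrite -[LHS]/(iter N (den N c) (sset s f [:: true])).
suff it k y s1 : size y < k -> s1 f = [:: true] -> s1 a = enc_str y ++ r ->
    iter k (den N c) s1 = sset (sset (sset s1 a r) b (catrev y (s1 b))) f [::].
  rewrite (it _ x) ?ssetE //; last by rewrite sset_neq.
  have -> : sset s f [:: true] b = s b by store_at.
  by store_eq.
elim: k y s1 => // k IH [|d y] s1 Hk Hf Ha.
  rewrite iterSr /c (den_case1 _ _ _ _ Hf) (den_case1 _ _ _ _ (b := false) (r := false :: r));
    last by rewrite sset_neq // Ha.
  rewrite (den_case1 _ _ _ _ (b := false) (r := r)); last by rewrite ssetE.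
  rewrite iter_case_stop; first by rewrite /=; store_eq.
  by store_at.
rewrite iterSr {2}/c (den_case1 _ _ _ _ Hf).
rewrite (den_case1 _ _ _ _ (b := true) (r := d :: enc_str y ++ r));
  last by rewrite sset_neq // Ha.
rewrite (den_case1 _ _ _ _ (b := d) (r := enc_str y ++ r)); last by rewrite ssetE.
have -> : (if d then RPush b true;; RPush f true else RPush b false;; RPush f true) =
   (RPush b d ;; RPush f true) by case: (d).
rewrite (IH y) //; last 2 first.
- by store_at.
- by store_at.
rewrite /=; set v := catrev y _; have -> : v = catrev y (d :: s1 b).
  by rewrite /v; congr catrev; clear v; store_at.
by store_eq.
Qed.

Lemma den_rd a b t f s x r : a != b -> a != t -> a != f -> b != t -> t != f ->
  s f = [::] -> s t = [::] -> s a = enc_str x ++ r -> size x < N ->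
  den N (rd a b t f) s = sset (sset s a r) b (x ++ s b).
Proof.
move=> ab at_ af bt tf sf st sa HN.
rewrite den_seq (den_readrev at_ af tf sf sa HN) den_mv 1?eq_sym // ssetE st; last first.
  by rewrite catrevE cats0 size_rev ltnW.
rewrite sset_neq // sset_neq 1?eq_sym // !catrevE cats0 revK.
by store_eq.
Qed.

Lemma den_writestr a o s : a != o -> size (s a) <= N ->
  den N (writestr a o) s = sset (sset s a [::]) o (rev (enc_str (s a)) ++ s o).
Proof.
move=> ao HN; rewrite /writestr den_seq.
pose P r s' := exists l, rev (enc_str (s a)) ++ s o = rev (enc_str r) ++ l /\ s' = sset (sset s a r) o l.
suff [l [E ->]] : P [::] (den N (drain a (RPush o true ;; RPush o false)
    (RPush o true ;; RPush o true)) s).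
  by rewrite E /= ssetE sset_ss ssetE sset_ss.
apply: den_drain => //.
  by exists (s o); split=> //; rewrite (@sset_id s) // (@sset_id s).
move=> c r s' _ [l [E ->]].
have -> : (if c then RPush o true ;; RPush o true else RPush o true ;; RPush o false) =
   (RPush o true ;; RPush o c) by case: (c).
have E2 : den N (RPush o true;; RPush o c) (sset (sset (sset s a (c :: r)) o l) a r) =
   sset (sset s a r) o (c :: true :: l).
  rewrite /= !ssetE [sset _ a r o]sset_neq 1?eq_sym // ssetE.
  by store_eq.
split; first by rewrite E2 sset_neq // ssetE.
exists (c :: true :: l); split=> //.
by rewrite E enc_str_cons !rev_cons -!cats1 -!catA.
Qed.

Lemma den_consstr t z s : t != z -> size (s t) <= N ->
  den N (consstr t z) s = sset (sset s t [::]) z (enc_str (rev (s t)) ++ s z).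
Proof.
move=> tz HN; rewrite /consstr !den_seq !den_push ssetE sset_ss.
set s1 := sset s z _.
pose P r s' := exists l, enc_str (rev (s t)) ++ s z = flatten [seq [:: true; b] | b <- rev r] ++ l /\ s' = sset (sset s t r) z l.
suff [l [-> ->]] : P [::] (den N (drain t (RPush z false ;; RPush z true)
    (RPush z true ;; RPush z true)) s1) by [].
apply: den_drain.
- by rewrite /s1 sset_neq.
- rewrite {1}/s1 sset_neq //; exists [:: false, false & s z]; split.
    by rewrite /enc_str -catA.
  by rewrite (@sset_id s t).
move=> c r s' _ [l [E ->]].
have -> : (if c then RPush z true ;; RPush z true else RPush z false ;; RPush z true) =
   (RPush z c ;; RPush z true) by case: (c).
have E2 : den N (RPush z c;; RPush z true) (sset (sset (sset s t (c :: r)) z l) t r) =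
   sset (sset s t r) z (true :: c :: l).
  rewrite /= !ssetE [sset _ t r z]sset_neq 1?eq_sym // ssetE.
  by store_eq.
split; first by rewrite E2 sset_neq // ssetE.
exists (true :: c :: l); split=> //.
by rewrite E rev_cons -cats1 map_cat flatten_cat -catA.
Qed.

Lemma den_tk B a t s : a != t ->
  den N (tk B a t) s = sset (sset s a (drop B (s a))) t (catrev (take B (s a)) (s t)).
Proof.
move=> at_; elim: B s => [|B IH] s.
  by rewrite /= drop0 take0 (@sset_id s) // (@sset_id s).
rewrite /=; case E: (s a) => [|b r].
  by rewrite /= (@sset_id s) // (@sset_id s).
have H : den N (tk B a t) (sset (sset s a r) t (b :: s t)) =
   sset (sset s a (drop B r)) t (catrev (take B r) (b :: s t)).
  by rewrite IH ssetE sset_neq // ssetE; store_eq.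
by case: b H {E}; rewrite /= [sset _ a _ t]sset_neq 1?eq_sym.
Qed.

Lemma den_constake B a t z s : a != t -> a != z -> t != z -> s t = [::] ->
  size (s a) <= N ->
  den N (constake B a t z) s = sset (sset s a [::]) z (enc_str (take B (s a)) ++ s z).
Proof.
move=> at_ az tz st HN; rewrite /constake 2!den_seq den_tk // st catrevE cats0.
have Hd : size (drop B (s a)) <= N by rewrite size_drop; lia.
have Ht : size (take B (s a)) <= N by rewrite size_take; case: ltnP => // H; lia.
rewrite den_clear; last by rewrite sset_neq // ssetE.
rewrite den_consstr //; rewrite ![sset _ a [::] _]sset_neq 1?eq_sym // ?ssetE ?size_rev //.
rewrite revK sset_neq 1?eq_sym // sset_neq 1?eq_sym //.
by store_eq.
Qed.

Lemma den_emit l o s : den N (emit l o) s = sset s o (l ++ s o).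
Proof.
elim: l s => [|b l IH] s /=; first by rewrite sset_id.
by rewrite IH ssetE sset_ss.
Qed.

Lemma den_tab B acc a F o s : a != o ->
  den N (tab B acc a F o) s =
  sset (sset s a (drop B (s a))) o (F (acc ++ take B (s a)) ++ s o).
Proof.
move=> ao; elim: B acc s => [|B IH] acc s.
  by rewrite /= den_emit drop0 take0 cats0 (@sset_id s a).
rewrite /=; case E: (s a) => [|b r].
  by rewrite /= den_emit cats0 (@sset_id s a).
by case: b {E}; rewrite IH ssetE sset_ss cat_rcons sset_neq 1?eq_sym.
Qed.

Lemma den_eqstr a b e s : a != b -> a != e -> b != e -> s e = [::] ->
  size (s a) <= N -> size (s b) <= N ->
  den N (eqstr a b e) s =
  sset (sset (sset s a [::]) b [::]) e (if s a == s b then [:: true] else [::]).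
Proof.
move=> ab ae be se HNa HNb; rewrite /eqstr !den_seq den_push se.
(* g records that no mismatch has occurred, so g together with equality of the two remainders stays
   equivalent to equality of the whole strings. *)
pose P r s' := exists y (g : bool), [/\ (s a == s b) = g && (r == y), size y <= N &
   s' = sset (sset (sset s a r) b y) e (nseq g true)].
pose mis := RCase e RSkip RSkip RSkip.
rewrite -/mis; set c0 := RCase b mis RSkip mis; set c1 := RCase b mis mis RSkip.
set c2 := RCase b RSkip mis mis.
have [y [g [Eg Hy ->]]] : P [::] (den N (drain a c0 c1) (sset s e [:: true])).
  apply: den_drain.
  - by rewrite sset_neq.
  - rewrite sset_neq //; exists (s b), true; split=> //.
    by rewrite (@sset_id s a) // (@sset_id s b).
  move=> c r s' _ [y [g [Eg Hy ->]]].
  set s2 := sset _ a r; have E2 : s2 = sset (sset (sset s a r) b y) e (nseq g true).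
    by rewrite /s2; clear s2; store_eq.
  clearbody s2.
  have Eb : s2 b = y by rewrite E2 sset_neq // ssetE.
  have Ee : s2 e = nseq g true by rewrite E2 ssetE.
  have [y' [g' [Eg' Hy' ->]]] : exists y' (g' : bool), [/\ g && (c :: r == y) = g' && (r == y'),
      size y' <= N & den N (if c then c1 else c0) s2 =
      sset (sset (sset s a r) b y') e (nseq g' true)].
    case: y Hy Eb E2 {Eg} => [|d y] Hy Eb E2.
      exists [::], false; split; [by rewrite andbF|by []|].
      have -> : den N (if c then c1 else c0) s2 = den N (RCase e RSkip RSkip RSkip) s2.
        by case: (c); rewrite (den_case0 _ _ _ _ Eb).
      by case: g Ee E2 => Ee E2; rewrite /= Ee E2 /=; store_eq.
    have [Ecd | ne] := eqVneq c d.
      subst d.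
      exists y, g; split; [by rewrite eqseq_cons eqxx|exact: ltnW|].
      have -> : den N (if c then c1 else c0) s2 = sset s2 b y.
        by case: (c) Eb => Eb; rewrite (den_case1 _ _ _ _ Eb).
      by rewrite E2; store_eq.
    exists y, false; split; [by rewrite eqseq_cons (negbTE ne) andbF|exact: ltnW|].
    have -> : den N (if c then c1 else c0) s2 = den N (RCase e RSkip RSkip RSkip) (sset s2 b y).
      by case: (c) (d) ne Eb => [] [] // _ Eb; rewrite (den_case1 _ _ _ _ Eb).
    by case: g Ee E2 => Ee E2; rewrite /= sset_neq 1?eq_sym // Ee E2 /=; store_eq.
  split; first by rewrite sset_neq // sset_neq // ssetE.
  by exists y', g'; rewrite Eg Eg'; split.
set s2 := sset _ e _.
have E2 : s2 = sset (sset (sset s a [::]) b y) e (nseq g true) by [].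
have Eb : s2 b = y by rewrite /s2 sset_neq // ssetE.
have Ee : s2 e = nseq g true by rewrite /s2 ssetE.
clearbody s2.
have [y' Hy' ->] : exists2 y', size y' <= N & den N c2 s2 =
    sset (sset (sset s a [::]) b y') e (if s a == s b then [:: true] else [::]).
  case: y Hy Eb E2 Eg => [|d y] Hy Eb E2 Eg.
    exists [::] => //; rewrite (den_case0 _ _ _ _ Eb) Eg /=.
    by rewrite E2 andbT; case: (g).
  exists y; first exact: ltnW.
  rewrite Eg andbF.
  have -> : den N c2 s2 = den N (RCase e RSkip RSkip RSkip) (sset s2 b y).
    by rewrite /c2 (den_case1 _ _ _ _ Eb); case: (d).
  by case: (g) Ee E2 => Ee E2; rewrite /= sset_neq 1?eq_sym // Ee E2; store_eq.
rewrite den_clear; last by rewrite sset_neq // ssetE.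
by store_eq.
Qed.

Fixpoint binc (x : bits) : bits :=
  match x with
  | [::] => [:: true]
  | false :: r => true :: r
  | true :: r => false :: binc r
  end.

Lemma den_incr a t f s : a != t -> a != f -> t != f -> s t = [::] -> s f = [::] ->
  size (s a) < N -> den N (incr a t f) s = sset s a (binc (s a)).
Proof.
move=> at_ af tf st sf HN; rewrite /incr /until !den_seq den_push sf.
set c := RCase f _ _ _; rewrite -[den N (RRep c) _]/(iter N (den N c) (sset s f [:: true])).
(* The zeros left behind by the carry wait in reverse order on t, so only [catrev y x] is the
   incremented numeral; the final [mv] puts it together. *)
suff it k s1 : size (s1 a) < k -> s1 f = [:: true] ->
    exists x y, [/\ iter k (den N c) s1 = sset (sset (sset s1 a x) t y) f [::],
      catrev y x = catrev (s1 t) (binc (s1 a)) & size y <= size (s1 t) + size (s1 a)].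
  have [||x [y [-> E Hy]]] := it N (sset s f [:: true]).
  + by rewrite sset_neq.
  + by rewrite ssetE.
  rewrite !sset_neq // st /= in E Hy.
  rewrite den_mv 1?eq_sym //; last by rewrite sset_neq // ssetE; lia.
  rewrite [sset _ f _ t]sset_neq // ssetE.
  rewrite [sset _ f _ a]sset_neq // [sset _ t _ a]sset_neq // ssetE E.
  by store_eq.
elim: k s1 => // k IH s1 Hk Hf.
rewrite iterSr {2}/c (den_case1 _ _ _ _ Hf).
have Ea : sset s1 f [::] a = s1 a by rewrite sset_neq.
case E: (s1 a) Hk => [|[] r] Hk.
- rewrite (den_case0 _ _ _ _ (etrans Ea E)) iter_case_stop; last first.
    by rewrite /= sset_neq 1?eq_sym // ssetE.
  exists [:: true], (s1 t); split=> //; last by lia.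
  by rewrite /= Ea E; store_eq.
- rewrite (den_case1 _ _ _ _ (etrans Ea E)).
  set s2 := den _ _ _.
  have E2 : s2 = sset (sset s1 a r) t (false :: s1 t).
    rewrite /s2; clear s2; rewrite /=.
    have -> : sset (sset s1 f [::]) a r t = s1 t by store_at.
    set S := sset _ t _; have -> : S f = [::] by rewrite /S; clear S; store_at.
    by rewrite /S; clear S; store_eq.
  have [||x [y [-> Exy Hy]]] := IH s2.
  + by rewrite E2 sset_neq // ssetE.
  + by rewrite E2 sset_neq 1?eq_sym // sset_neq 1?eq_sym.
  exists x, y; split; first by rewrite E2; store_eq.
    by rewrite Exy E2 ssetE sset_neq // ssetE.
  by move: Hy; rewrite E2 ssetE sset_neq // ssetE /=; lia.
- rewrite (den_case1 _ _ _ _ (etrans Ea E)) iter_case_stop; last first.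
    by rewrite /= sset_neq 1?eq_sym // sset_neq 1?eq_sym // ssetE.
  exists (true :: r), (s1 t); split=> //; last by lia.
  by rewrite /= ssetE; store_eq.
Qed.

Lemma den_peek0 i c0 c1 s : s i = [::] -> den N (peek_if i c0 c1) s = den N c0 s.
Proof. exact: den_case0. Qed.

Lemma den_peek1 i c0 c1 s : s i != [::] -> den N (peek_if i c0 c1) s = den N c1 s.
Proof.
case E: (s i) => [|b r] // _; rewrite /peek_if (den_case1 _ _ _ _ E).
by case: b E => E; rewrite den_seq den_push ssetE sset_ss (@sset_id s).
Qed.

End Den.

Lemma rregs_emit V l o : o < V -> rregs V (emit l o).
Proof. by move=> Ho; elim: l => //= b l ->. Qed.

Lemma rregs_tab V B acc a F o : a < V -> o < V -> rregs V (tab B acc a F o).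
Proof.
move=> Ha Ho; elim: B acc => [|B IH] acc /=; first exact: rregs_emit.
by rewrite Ha !IH rregs_emit.
Qed.

Lemma rregs_tk V B a t : a < V -> t < V -> rregs V (tk B a t).
Proof. by move=> Ha Ht; elim: B => //= B ->; rewrite Ha Ht. Qed.

Lemma rregs_constake V B a t z : a < V -> t < V -> z < V ->
  rregs V (constake B a t z).
Proof. by move=> Ha Ht Hz; rewrite /constake /= rregs_tk // Ha Ht Hz. Qed.

(** * Register files as explicit lists *)

Arguments den : simpl never.
Opaque rd clear mv copy constake consstr tab eqstr incr writestr peek_if.

(** On explicit lists [set_nth] computes, so straight-line programs are executed by rewriting,
    without case analyses on register indices. *)
Definition rf (l : seq bits) : store := fun i => nth [::] l i.

Lemma sset_rf l i v : sset (rf l) i v = rf (set_nth [::] l i v).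
Proof. by apply: functional_extensionality => j; rewrite /sset /rf nth_set_nth. Qed.

Section Rf.
Variable N : nat.

Lemma rf_rd a b t f l x r :
  [&& a != b, a != t, a != f, b != t & t != f] ->
  rf l f = [::] -> rf l t = [::] -> rf l a = enc_str x ++ r -> size x < N ->
  den N (rd a b t f) (rf l) = rf (set_nth [::] (set_nth [::] l a r) b (x ++ rf l b)).
Proof.
move=> /and5P[ab at_ af bt tf] sf st sa HN.
by rewrite (den_rd ab at_ af bt tf sf st sa HN) !sset_rf.
Qed.

Lemma rf_clear a l : size (rf l a) <= N ->
  den N (clear a) (rf l) = rf (set_nth [::] l a [::]).
Proof. by move=> H; rewrite den_clear // sset_rf. Qed.

Lemma rf_mv a b l : a != b -> size (rf l a) <= N ->
  den N (mv a b) (rf l) = rf (set_nth [::] (set_nth [::] l a [::]) b (catrev (rf l a) (rf l b))).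
Proof. by move=> ab H; rewrite den_mv // !sset_rf. Qed.

Lemma rf_copy a b t l : [&& a != b, a != t & b != t] -> rf l t = [::] ->
  size (rf l a) <= N ->
  den N (copy a b t) (rf l) = rf (set_nth [::] l b (rf l a ++ rf l b)).
Proof. by move=> /and3P[ab at_ bt] st H; rewrite den_copy // !sset_rf. Qed.

Lemma rf_writestr a o l : a != o -> size (rf l a) <= N ->
  den N (writestr a o) (rf l) =
  rf (set_nth [::] (set_nth [::] l a [::]) o (rev (enc_str (rf l a)) ++ rf l o)).
Proof. by move=> ao H; rewrite den_writestr // !sset_rf. Qed.

Lemma rf_consstr t z l : t != z -> size (rf l t) <= N ->
  den N (consstr t z) (rf l) =
  rf (set_nth [::] (set_nth [::] l t [::]) z (enc_str (rev (rf l t)) ++ rf l z)).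
Proof. by move=> tz H; rewrite den_consstr // !sset_rf. Qed.

Lemma rf_constake B a t z l : [&& a != t, a != z & t != z] -> rf l t = [::] ->
  size (rf l a) <= N ->
  den N (constake B a t z) (rf l) =
  rf (set_nth [::] (set_nth [::] l a [::]) z (enc_str (take B (rf l a)) ++ rf l z)).
Proof. by move=> /and3P[at_ az tz] st H; rewrite den_constake // !sset_rf. Qed.

Lemma rf_tab B acc a F o l : a != o ->
  den N (tab B acc a F o) (rf l) =
  rf (set_nth [::] (set_nth [::] l a (drop B (rf l a))) o (F (acc ++ take B (rf l a)) ++ rf l o)).
Proof. by move=> ao; rewrite den_tab // !sset_rf. Qed.

Lemma rf_eqstr a b e l : [&& a != b, a != e & b != e] -> rf l e = [::] ->
  size (rf l a) <= N -> size (rf l b) <= N ->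
  den N (eqstr a b e) (rf l) =
  rf (set_nth [::] (set_nth [::] (set_nth [::] l a [::]) b [::]) e
    (if rf l a == rf l b then [:: true] else [::])).
Proof. by move=> /and3P[ab ae be] se Ha Hb; rewrite den_eqstr // !sset_rf. Qed.

Lemma rf_incr a t f l : [&& a != t, a != f & t != f] -> rf l t = [::] -> rf l f = [::] ->
  size (rf l a) < N ->
  den N (incr a t f) (rf l) = rf (set_nth [::] l a (binc (rf l a))).
Proof. by move=> /and3P[at_ af tf] st sf H; rewrite den_incr // !sset_rf. Qed.

Lemma rf_push i b l : den N (RPush i b) (rf l) = rf (set_nth [::] l i (b :: rf l i)).
Proof. by rewrite den_push sset_rf. Qed.

Lemma rf_case1 i c0 cF cT l b r : rf l i = b :: r ->
  den N (RCase i c0 cF cT) (rf l) = den N (if b then cT else cF) (rf (set_nth [::] l i r)).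
Proof. by move=> H; rewrite (den_case1 _ _ _ _ H) sset_rf. Qed.

Lemma den_rep c s : den N (RRep c) s = iter N (den N c) s.
Proof. by []. Qed.

Lemma den_skip s : den N RSkip s = s.
Proof. by []. Qed.

Lemma iter_peek_stop i c s k : s i = [::] -> iter k (den N (peek_if i RSkip c)) s = s.
Proof. by move=> H; elim: k => //= k ->; rewrite den_peek0. Qed.

End Rf.

(** * Decoding tuples and their sizes *)

Fixpoint dec_from (acc s : bits) : seq bits :=
  match s with
  | true :: b :: s' => dec_from (rcons acc b) s'
  | false :: _ :: s' => acc :: dec_from [::] s'
  | _ => [::]
  end.
Definition dec := dec_from [::].

Lemma dec_from_str acc x r : dec_from acc (enc_str x ++ r) = (acc ++ x) :: dec_from [::] r.
Proof.
elim: x acc => [|b x IH] acc; first by rewrite cats0.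
by rewrite enc_str_cons /= IH cat_rcons.
Qed.

Lemma dec_enc ss : dec (enc_tuple ss) = ss.
Proof. by elim: ss => //= x ss IH; rewrite /dec dec_from_str /= -/(enc_tuple ss) -/dec IH. Qed.

Lemma enc_tuple_cons x ss : enc_tuple (x :: ss) = enc_str x ++ enc_tuple ss.
Proof. by []. Qed.

Lemma enc_tuple_cat s1 s2 : enc_tuple (s1 ++ s2) = enc_tuple s1 ++ enc_tuple s2.
Proof. by rewrite /enc_tuple map_cat flatten_cat. Qed.

Lemma size_enc_str x : size (enc_str x) = (size x).*2.+2.
Proof. by elim: x => //= b x; rewrite -/(enc_str x) => ->. Qed.

Lemma size_enc_tuple ss : size (enc_tuple ss) = sumn [seq (size x).*2.+2 | x <- ss].
Proof. by elim: ss => //= x ss <-; rewrite size_cat size_enc_str. Qed.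

Lemma size_mem_enc (x : bits) (ss : seq bits) : x \in ss -> (size x).*2.+2 <= size (enc_tuple ss).
Proof.
rewrite size_enc_tuple; elim: ss => //= y ss IH; rewrite inE => /orP[/eqP->|/IH]; lia.
Qed.

Lemma size_enc_tuple_ge ss : (size ss).*2 <= size (enc_tuple ss).
Proof. by rewrite size_enc_tuple; elim: ss => //= y ss IH; lia. Qed.

(** * The verifier's program *)

Section Verifier.
Variables (B BB : nat) (F : bits -> bool).

(** A neighbour with an empty label claims to be no terminal and is left out. The accumulator
    mirrors the register that the program pushes on, so the entries come out in reverse order. *)
Fixpoint vz (ws ls acc : seq bits) : seq bits :=
  match ws, ls with
  | w :: ws', x :: ls' =>
      vz ws' ls' (if x is [::] then acc else take B w :: take B x :: acc)
  | _, _ => acc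
  end.

Definition vstr (tm l : bits) (ws ls : seq bits) : bits :=
  enc_tuple (take 1 tm :: take B l :: vz ws ls [::]).

Definition ver : verifier_t := fun I l ls =>
  F (take BB (vstr (nth [::] (dec I) 1) l (drop 2 (dec I)) ls)).

(* Registers: 0 output, 1 input, 2 local input, 3 loop flag, 4 scratch, 5 own
   label, 6 terminal bit, 7 weight, 8 neighbour label, 9 table input, 10 identifier. *)
Definition vbody :=
  rd 2 7 4 3 ;; rd 1 8 4 3 ;;
  peek_if 8 (clear 7) (constake B 8 4 9 ;; constake B 7 4 9).

Definition vprog :=
  rd 1 2 4 3 ;; rd 1 5 4 3 ;; rd 2 10 4 3 ;; clear 10 ;; rd 2 6 4 3 ;;
  RRep (peek_if 2 RSkip vbody) ;;
  constake B 5 4 9 ;; constake 1 6 4 9 ;; tab BB [::] 9 (fun z => [:: F z]) 0.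

Transparent rd clear peek_if.
Lemma vprog_regs : rregs 11 vprog.
Proof. by rewrite /vprog /= !rregs_constake ?rregs_tab. Qed.
Opaque rd clear peek_if.

Lemma vloop N k (ws ls : seq bits) (l tm : bits) acc : size ws <= k -> size ws = size ls ->
  (forall w, w \in ws -> size w < N) -> (forall x, x \in ls -> size x < N) ->
  iter k (den N (peek_if 2 RSkip vbody))
    (rf [:: [::]; enc_tuple ls; enc_tuple ws; [::]; [::]; l; tm; [::]; [::]; enc_tuple acc; [::]])
  = rf [:: [::]; [::]; [::]; [::]; [::]; l; tm; [::]; [::]; enc_tuple (vz ws ls acc); [::]].
Proof.
elim: k ws ls acc => [|k IH] [|w ws] [|x ls] acc // Hk Hs Hw Hl.
  by rewrite iter_peek_stop.
have {}Hs : size ws = size ls by case: Hs.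
have Hw0 : size w < N by apply: Hw; rewrite mem_head.
have Hx0 : size x < N by apply: Hl; rewrite mem_head.
rewrite iterSr den_peek1; last by rewrite /rf /=; case: (w).
rewrite /vbody den_seq (@rf_rd _ _ _ _ _ _ w (enc_tuple ws)) //=.
rewrite den_seq (@rf_rd _ _ _ _ _ _ x (enc_tuple ls)) //= /rf /= !cats0.
have Hwt u : u \in ws -> size u < N by move=> H; apply: Hw; rewrite inE H orbT.
have Hlt u : u \in ls -> size u < N by move=> H; apply: Hl; rewrite inE H orbT.
have IH' acc' := IH ws ls acc' Hk Hs Hwt Hlt.
case: x Hx0 {Hl} => [|b x] Hx0.
  by rewrite den_peek0 // -/(rf _) rf_clear //= 1?ltnW // IH'.
rewrite den_peek1 // -/(rf _) den_seq rf_constake //=; last exact: ltnW.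
rewrite rf_constake //=; last exact: ltnW.
by rewrite /rf /= -!enc_tuple_cons -/(rf _) IH'.
Qed.

Lemma vprog_spec (id : bits) (tm : bool) (ws : seq bits) (l : bits) (ls : seq bits) :
  let I := enc_tuple (id :: [:: tm] :: ws) in
  let x := enc_tuple (I :: l :: ls) in
  size ws = size ls ->
  den (size x) vprog (input_store x) 0 = rev [:: ver I l ls].
Proof.
move=> I x Hs; set N := size x.
have Hm (y : bits) : y \in I :: l :: ls -> size y < N.
  by move=> /size_mem_enc; rewrite /N /x; lia.
have HI : size I < N by apply: Hm; rewrite mem_head.
have Hl : size l < N by apply: Hm; rewrite !inE eqxx orbT.
have Hls (y : bits) : y \in ls -> size y < N by move=> H; apply: Hm; rewrite !inE H !orbT.
have Hm2 (y : bits) : y \in id :: [:: tm] :: ws -> size y < N.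
  by move=> /size_mem_enc; rewrite -/I; lia.
have Hid : size id < N by apply: Hm2; rewrite mem_head.
have Hws (y : bits) : y \in ws -> size y < N by move=> H; apply: Hm2; rewrite !inE H !orbT.
have Htm : 1 < N by apply: (Hm2 [:: tm]); rewrite !inE eqxx orbT.
have HwsN : size ws <= N.
  by have := size_enc_tuple_ge (id :: [:: tm] :: ws); rewrite -/I /=; lia.
have -> : input_store x = rf [:: [::]; x; [::]; [::]; [::]; [::]; [::]; [::]; [::]; [::]; [::]].
  apply: functional_extensionality => j; rewrite /input_store /sset /rf.
  by do 11 (case: j => [|j] //); rewrite nth_default.
rewrite /vprog den_seq (@rf_rd _ _ _ _ _ _ I (enc_tuple (l :: ls))) //=.
rewrite den_seq (@rf_rd _ _ _ _ _ _ l (enc_tuple ls)) //=.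
rewrite den_seq (@rf_rd _ _ _ _ _ _ id (enc_tuple ([:: tm] :: ws))) //=; last first.
  by rewrite /rf /= cats0.
rewrite den_seq rf_clear /=; last by rewrite /rf /= cats0 ltnW.
rewrite den_seq (@rf_rd _ _ _ _ _ _ [:: tm] (enc_tuple ws)) //=.
rewrite /rf /= !cats0 -/(rf _) den_seq den_rep.
rewrite (@vloop N N ws ls l [:: tm] [::]) //.
rewrite den_seq rf_constake //=; last by rewrite ltnW.
rewrite den_seq rf_constake //=; last by rewrite ltnW.
rewrite rf_tab // /rf /=; congr (_ :: _).
by rewrite /ver dec_enc /= drop0.
Qed.

End Verifier.

(** * Binary numerals *)

Lemma bin_auxE f n : n <= f -> bin_aux f n = bin n.
Proof.
rewrite /bin; elim/ltn_ind: n f => -[|n] IH [|f] //= Hf; congr cons.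
by rewrite !(IH (uphalf n)) //; lia.
Qed.

Lemma bin_succ n : bin n.+1 = odd n.+1 :: bin n.+1./2.
Proof. by rewrite {1}/bin /=; congr cons; rewrite bin_auxE //; lia. Qed.

Lemma binc_bin n : binc (bin n) = bin n.+1.
Proof.
elim/ltn_ind: n => -[|n] IH //.
rewrite [RHS]bin_succ bin_succ; case E: (odd n.+1).
  have -> : odd n.+2 = false by lia.
  have -> : n.+2./2 = n.+1./2.+1 by lia.
  by rewrite -IH //; lia.
have -> : odd n.+2 = true by lia.
by have -> : n.+2./2 = n.+1./2 by lia.
Qed.

Fixpoint val2 (x : bits) : nat := if x is b :: x' then b + (val2 x').*2 else 0.

Lemma val2_bin n : val2 (bin n) = n.
Proof.
elim/ltn_ind: n => -[|n] IH //; rewrite bin_succ -[LHS]/(odd n.+1 + (val2 (bin n.+1./2)).*2).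
by rewrite IH ?odd_double_half //; lia.
Qed.

Lemma bin_inj : injective bin.
Proof. exact: can_inj val2_bin. Qed.

Lemma size_bin_le n : size (bin n) <= n.
Proof.
elim/ltn_ind: n => -[|n] IH //; rewrite bin_succ -[size _]/(size (bin n.+1./2)).+1.
have H : n.+1./2 < n.+1 by lia.
by have := IH _ H; lia.
Qed.

(** * The prover's program *)

(** What the input says about one node, free of the dependent types of [inst], so that the program
    can be verified on plain lists. *)
Record nrow := Row { r_id : bits; r_tm : bool; r_ws : seq bits; r_ps : seq bits }.
Definition r_local r := enc_tuple (r_id r :: [:: r_tm r] :: r_ws r).
Definition r_ports r := enc_tuple (r_ps r).

Definition pinput (rows : seq nrow) : bits :=
  enc_tuple (bin (size rows) :: map r_local rows ++ map r_ports rows).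

Section Prover.
Variables (B BB : nat) (Fl : bits -> seq bits).

(** Port targets are node indices, so a terminal is looked up by the numeral of its index rather
    than by its identifier. *)
Fixpoint names v (rows : seq nrow) : seq bits :=
  if rows is r :: rs then
    (if r_tm r then bin v :: names v.+1 rs else names v.+1 rs) else [::].

(** One triple for each edge to a terminal. The ranks among the terminals are in unary because the
    program obtains them by counting. *)
Fixpoint zports (nm : seq bits) (u : nat) (ps ws acc : seq bits) : seq bits :=
  match ps, ws with
  | p :: ps', w :: ws' =>
      zports nm u ps' ws'
        (if p \in nm then [:: nseq u true, nseq (index p nm) true, take B w & acc] else acc)
  | _, _ => acc
  end.

Fixpoint zrows (nm : seq bits) (u : nat) (rows : seq nrow) (acc : seq bits) : seq bits :=
  if rows is r :: rs then
    if r_tm r then zrows nm u.+1 rs (zports nm u (r_ps r) (r_ws r) acc)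
    else zrows nm u rs acc
  else acc.

Definition zall (rows : seq nrow) : bits :=
  enc_tuple (nseq (count r_tm rows) true :: zrows (names 0 rows) 0 rows [::]).

(** The default [[:: true]] keeps the labels of terminals nonempty when the table returns too few
    labels, in particular none for an oversized input. *)
Fixpoint distribute (fl : seq bool) (ls : seq bits) : seq bits :=
  match fl with
  | [::] => [::]
  | false :: fl' => [::] :: distribute fl' ls
  | true :: fl' => head [:: true] ls :: distribute fl' (behead ls)
  end.

Definition plabels (rows : seq nrow) : seq bits :=
  distribute (map r_tm rows) (Fl (take BB (zall rows))).

(* Registers: 0 output, 1 and 2 read positions in the input (ports, local inputs),
   3 loop flag, 4 scratch, 5 n, 6 index of the current node, 7 and 8 names of the
   terminals (reversed, in order), 9 table input, 10 and 11 terminal bits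
   (reversed, in order), 12 ports, 13 local input, 14 identifier, 15 terminal bit,
   16 port target (later a label), 17 weight, 18 rank of the target in unary,
   19 target found, 20 remaining names, 21 and 22 copies to compare, 23 result of
   the comparison, 24 terminals so far in unary, 25 labels from the table. *)
Definition lbody :=
  rd 20 21 4 3 ;; copy 16 22 4 ;; eqstr 21 22 23 ;;
  RCase 23 (peek_if 19 (RPush 18 true) RSkip) RSkip
    (peek_if 19 (RPush 19 true) RSkip).

Definition pbody :=
  rd 12 16 4 3 ;; rd 13 17 4 3 ;; copy 8 20 4 ;; RRep (peek_if 20 RSkip lbody) ;;
  clear 16 ;;
  RCase 19 (clear 17 ;; clear 18) RSkip
    (* A triple is pushed back to front: the weight, the rank of the target, the own rank. *)
    (constake B 17 4 9 ;; consstr 18 9 ;; copy 24 21 4 ;; consstr 21 9).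

Definition body1 :=
  rd 1 12 4 3 ;; rd 12 14 4 3 ;; clear 14 ;; rd 12 15 4 3 ;; clear 12 ;;
  RCase 15 RSkip (RPush 10 false) (RPush 10 true ;; copy 6 21 4 ;; writestr 21 7) ;;
  incr 6 4 3.

(** Local inputs and port lists follow one another without a separator, so the end of the local
    inputs is found by counting up to n. Register 1 then stands at the port lists, while its copy in
    register 2 still stands at the local inputs. *)
Definition loop1 :=
  copy 6 21 4 ;; copy 5 22 4 ;; eqstr 21 22 23 ;; RCase 23 body1 RSkip RSkip.

Definition body2 :=
  rd 1 12 4 3 ;; rd 2 13 4 3 ;; rd 13 14 4 3 ;; clear 14 ;; rd 13 15 4 3 ;;
  RCase 15 RSkip (clear 12 ;; clear 13)
    (RRep (peek_if 12 RSkip pbody) ;; RPush 24 true).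

Definition loop3 :=
  RCase 11 RSkip (RPush 0 false ;; RPush 0 false)
    (peek_if 25 (RPush 0 true ;; RPush 0 true ;; RPush 0 false ;; RPush 0 false)
       (rd 25 16 4 3 ;; writestr 16 0)).

Definition pprog :=
  rd 1 5 4 3 ;; copy 1 2 4 ;; RRep loop1 ;; mv 7 8 ;; mv 10 11 ;;
  RRep (peek_if 1 RSkip body2) ;; consstr 24 9 ;;
  tab BB [::] 9 (fun z => enc_tuple (Fl z)) 25 ;; RRep loop3.

Transparent rd clear mv copy consstr eqstr incr writestr peek_if.
Lemma pprog_regs : rregs 26 pprog.
Proof. by rewrite /pprog /= !rregs_constake ?rregs_tab. Qed.
Opaque rd clear mv copy consstr eqstr incr writestr peek_if.

Definition pst o A A2 NN CN TL TLf Z FL FLf P L p w rk fd TC UR LB : store :=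
  rf [:: o; A; A2; [::]; [::]; NN; CN; TL; TLf; Z; FL; FLf; P; L; [::]; [::]; p; w;
         rk; fd; TC; [::]; [::]; [::]; UR; LB].

Section Run.
Variable N : nat.

Lemma lookup_loop k o A A2 NN CN TL TLf Z FL FLf P L p w UR LB (nm : seq bits) r (g : bool) :
  size nm <= k -> size p <= N -> (forall q : bits, q \in nm -> size q < N) ->
  iter k (den N (peek_if 20 RSkip lbody))
    (pst o A A2 NN CN TL TLf Z FL FLf P L p w (nseq r true) (nseq g true) (enc_tuple nm) UR LB)
  = pst o A A2 NN CN TL TLf Z FL FLf P L p w
      (nseq (if g then r else r + index p nm) true) (nseq (g || (p \in nm)) true) [::] UR LB.
Proof.
elim: k nm r g => [|k IH] [|q nm] r g // Hk Hp Hq.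
- by rewrite /= addn0 if_same orbF.
- by rewrite iter_peek_stop //= addn0 if_same orbF.
have Hq0 : size q < N by apply: Hq; rewrite mem_head.
have Hqt (u : bits) : u \in nm -> size u < N by move=> H; apply: Hq; rewrite inE H orbT.
rewrite iterSr den_peek1; last by rewrite /pst /rf /=; case: (q).
rewrite /pst /lbody den_seq (@rf_rd _ _ _ _ _ _ q (enc_tuple nm)) //=.
rewrite den_seq rf_copy //= den_seq rf_eqstr //=; last 2 first.
- by rewrite /rf /= cats0 ltnW.
- by rewrite /rf /= cats0.
rewrite /rf /= !cats0 eq_sym inE -/(rf _).
have [Epq | ne] := eqVneq p q.
  rewrite (@rf_case1 _ _ _ _ _ _ true [::]) //=.
  case: g.
    by rewrite den_peek1 // -/(pst _ _ _ _ _ _ _ _ _ _ _ _ _ _ _ [:: true] _ _ _)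
      -[[:: true]]/(nseq true true) (IH nm r true).
  rewrite den_peek0 // rf_push /= -[[:: true]]/(nseq true true).
  by rewrite -/(pst _ _ _ _ _ _ _ _ _ _ _ _ _ _ _ _ _ _ _) (IH nm r true) //= ?Epq ?eqxx ?addn0.
rewrite den_case0 //=.
case: g.
  by rewrite den_peek1 // -/(pst _ _ _ _ _ _ _ _ _ _ _ _ _ _ _ [:: true] _ _ _)
      -[[:: true]]/(nseq true true) (IH nm r true).
rewrite den_peek0 // rf_push /= -[true :: nseq r true]/(nseq r.+1 true).
rewrite -[[::] in X in rf X]/(nseq false true).
by rewrite -/(pst _ _ _ _ _ _ _ _ _ _ _ _ _ _ _ _ _ _ _) (IH nm r.+1 false) // addSnnS.
Qed.

Lemma ports_loop k o A A2 NN CN TL FL FLf LB (nm ps ws acc : seq bits) u :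
  size ps <= k -> size ps = size ws -> size (enc_tuple nm) <= N -> u <= N ->
  (forall p : bits, p \in ps -> size p < N) -> (forall w : bits, w \in ws -> size w < N) ->
  iter k (den N (peek_if 12 RSkip pbody))
    (pst o A A2 NN CN TL (enc_tuple nm) (enc_tuple acc) FL FLf (enc_tuple ps) (enc_tuple ws)
       [::] [::] [::] [::] [::] (nseq u true) LB)
  = pst o A A2 NN CN TL (enc_tuple nm) (enc_tuple (zports nm u ps ws acc)) FL FLf
      [::] [::] [::] [::] [::] [::] [::] (nseq u true) LB.
Proof.
move=> Hk Hs Hnm Hu.
have Hnmq (q : bits) : q \in nm -> size q < N by move=> /size_mem_enc; lia.
have Hnms : size nm <= N by have := size_enc_tuple_ge nm; lia.
elim: k ps ws acc Hk Hs => [|k IH] [|p ps] [|w ws] acc // Hk Hs Hps Hws.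
  by rewrite iter_peek_stop.
have {}Hs : size ps = size ws by case: Hs.
have Hp : size p < N by apply: Hps; rewrite mem_head.
have Hw : size w < N by apply: Hws; rewrite mem_head.
have Hpt (x : bits) : x \in ps -> size x < N by move=> H; apply: Hps; rewrite inE H orbT.
have Hwt (x : bits) : x \in ws -> size x < N by move=> H; apply: Hws; rewrite inE H orbT.
rewrite iterSr den_peek1; last by rewrite /pst /rf /=; case: (p).
rewrite /pst /pbody den_seq (@rf_rd _ _ _ _ _ _ p (enc_tuple ps)) //=.
rewrite den_seq (@rf_rd _ _ _ _ _ _ w (enc_tuple ws)) //=.
rewrite den_seq rf_copy //= /rf /= !cats0 -/(rf _) den_seq den_rep.
rewrite [iter N _ _](@lookup_loop N _ _ _ _ _ _ _ _ _ _ _ _ p w _ _ nm 0 false) //; last exact: ltnW.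
have Hix : index p nm <= N by apply: leq_trans Hnms; apply: index_size.
rewrite add0n /pst den_seq rf_clear //=; last exact: ltnW.
case pnm: (p \in nm).
  rewrite (@rf_case1 _ _ _ _ _ _ true [::]) //=.
  rewrite den_seq rf_constake //=; last exact: ltnW.
  rewrite den_seq rf_consstr //=; last by rewrite /rf /= size_nseq.
  rewrite den_seq rf_copy //=; last by rewrite /rf /= size_nseq.
  rewrite rf_consstr //= /rf /= ?cats0 ?rev_nseq ?size_nseq // -!enc_tuple_cons -/(rf _).
  by rewrite -/(pst _ _ _ _ _ _ _ _ _ _ _ _ _ _ _ _ _ _ _) IH //= pnm.
rewrite den_case0 //= den_seq rf_clear //=; last exact: ltnW.
rewrite rf_clear //=; last by rewrite /rf /= size_nseq.
by rewrite -/(pst _ _ _ _ _ _ _ _ _ _ _ _ _ _ _ _ _ _ _) IH //= pnm.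
Qed.

Definition row_ok r := [/\ size (r_local r) < N, size (r_ports r) < N & size (r_ps r) = size (r_ws r)].

Lemma row_ok_bounds r : row_ok r -> [/\ size (r_id r) < N, 1 < N,
  forall w : bits, w \in r_ws r -> size w < N & forall p : bits, p \in r_ps r -> size p < N].
Proof.
move=> [Hl Hp _]; split.
- have := @size_mem_enc (r_id r) (r_id r :: [:: r_tm r] :: r_ws r).
  by rewrite mem_head => /(_ isT); rewrite -/(r_local r); lia.
- have := @size_mem_enc [:: r_tm r] (r_id r :: [:: r_tm r] :: r_ws r).
  by rewrite !inE eqxx orbT => /(_ isT) /=; rewrite -/(r_local r); lia.
- move=> w Hw; have := @size_mem_enc w (r_id r :: [:: r_tm r] :: r_ws r).
  by rewrite !inE Hw !orbT => /(_ isT); rewrite -/(r_local r); lia.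
- by move=> p /size_mem_enc; rewrite -/(r_ports r); lia.
Qed.

Lemma names_loop k o A2 n v Z UR LB (nm rest : seq bits) fl rs :
  size rs <= k -> v + size rs = n -> n < N -> (forall r, List.In r rs -> row_ok r) ->
  iter k (den N loop1)
    (pst o (enc_tuple (map r_local rs ++ rest)) A2 (bin n) (bin v) (rev (enc_tuple nm)) [::]
       Z fl [::] [::] [::] [::] [::] [::] [::] [::] UR LB)
  = pst o (enc_tuple rest) A2 (bin n) (bin n) (rev (enc_tuple (nm ++ names v rs))) [::]
       Z (catrev (map r_tm rs) fl) [::] [::] [::] [::] [::] [::] [::] [::] UR LB.
Proof.
move=> Hk Hv Hn.
have Hbin i : i <= n -> size (bin i) < N by have := size_bin_le i; lia.
elim: k v nm fl rs Hk Hv => [|k IH] v nm fl rs Hk Hv Hok.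
  by case: rs Hk Hv {Hok} => // _; rewrite addn0 cats0 => ->.
rewrite iterSr.
have -> s : den N loop1 s = den N (RCase 23 body1 RSkip RSkip)
   (den N (eqstr 21 22 23) (den N (copy 5 22 4) (den N (copy 6 21 4) s))) by [].
rewrite /pst rf_copy //=; last by rewrite ltnW // Hbin; lia.
rewrite rf_copy //=; last by rewrite ltnW // Hbin.
rewrite /rf /= !cats0 -/(rf _) rf_eqstr //=; last 2 first.
- by rewrite ltnW // Hbin; lia.
- by rewrite ltnW // Hbin.
rewrite /rf /= (inj_eq bin_inj) -/(rf _).
case: rs Hk Hv Hok => [|r rs] /= Hk Hv Hok.
  rewrite addn0 in Hv; rewrite Hv eqxx (@rf_case1 _ _ _ _ _ _ true [::]) //= den_skip.
  by rewrite -/(pst _ _ _ _ _ _ _ _ _ _ _ _ _ _ _ _ _ _ _) (IH n nm fl [::]) ?addn0.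
have -> : (v == n) = false by apply/eqP; lia.
have Hr := Hok r (or_introl erefl).
have [Hid N1 _ _] := row_ok_bounds Hr; have [Hl _ _] := Hr.
rewrite den_case0 // /body1.
rewrite den_seq (@rf_rd _ _ _ _ _ _ (r_local r) (enc_tuple (map r_local rs ++ rest))) //=.
rewrite den_seq (@rf_rd _ _ _ _ _ _ (r_id r) (enc_tuple ([:: r_tm r] :: r_ws r))) //=; last first.
  by rewrite /rf /= cats0.
rewrite den_seq rf_clear //=; last by rewrite /rf /= cats0 ltnW.
rewrite den_seq (@rf_rd _ _ _ _ _ _ [:: r_tm r] (enc_tuple (r_ws r))) //=.
rewrite den_seq rf_clear //=; last first.
  rewrite /rf /=; apply: leq_trans (ltnW Hl).
  by rewrite /r_local !enc_tuple_cons !size_cat; lia.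
rewrite den_seq (@rf_case1 _ _ _ _ _ _ (r_tm r) [::]) //=.
have Hok' r' : List.In r' rs -> row_ok r' by move=> H; apply: Hok; right.
have Hv' : v.+1 + size rs = n by lia.
have Hbv : size (bin v) < N by apply: Hbin; lia.
case: (r_tm r); last first.
  rewrite rf_push /= rf_incr //= /rf /= binc_bin -/(rf _).
  by rewrite -/(pst _ _ _ _ _ _ _ _ _ _ _ _ _ _ _ _ _ _ _) IH.
rewrite den_seq rf_push /= den_seq rf_copy //=; last exact: ltnW.
rewrite rf_writestr //=; last by rewrite /rf /= cats0 ltnW.
rewrite rf_incr //= /rf /= !cats0 binc_bin -/(rf _).
have -> : rev (enc_str (bin v)) ++ rev (enc_tuple nm) = rev (enc_tuple (rcons nm (bin v))).
  by rewrite -cats1 enc_tuple_cat rev_cat /enc_tuple /= cats0.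
by rewrite -/(pst _ _ _ _ _ _ _ _ _ _ _ _ _ _ _ _ _ _ _) IH // cat_rcons.
Qed.

Lemma rows_loop k o NN CN FL FLf LB (nm rest acc : seq bits) u rs :
  size rs <= k -> u + size rs <= N -> size (enc_tuple nm) <= N ->
  (forall r, List.In r rs -> row_ok r) ->
  iter k (den N (peek_if 1 RSkip body2))
    (pst o (enc_tuple (map r_ports rs)) (enc_tuple (map r_local rs ++ rest)) NN CN [::]
      (enc_tuple nm) (enc_tuple acc) FL FLf [::] [::] [::] [::] [::] [::] [::] (nseq u true) LB)
  = pst o [::] (enc_tuple rest) NN CN [::]
      (enc_tuple nm) (enc_tuple (zrows nm u rs acc)) FL FLf [::] [::] [::] [::] [::] [::] [::]
      (nseq (u + count r_tm rs) true) LB.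
Proof.
move=> Hk Hu Hnm.
elim: k u acc rs Hk Hu => [|k IH] u acc rs Hk Hu Hok.
  by case: rs Hk {Hok Hu} => // _; rewrite addn0.
case: rs Hk Hu Hok => [|r rs] Hk Hu Hok.
  by rewrite iter_peek_stop ?addn0.
have Hr := Hok r (or_introl erefl).
have [Hid N1 Hws Hps] := row_ok_bounds Hr; have [Hl Hp Hsz] := Hr.
have Hok' r' : List.In r' rs -> row_ok r' by move=> H; apply: Hok; right.
have HpsN : size (r_ps r) <= N.
  by have := size_enc_tuple_ge (r_ps r); rewrite -/(r_ports r); lia.
have Hlw : size (enc_tuple (r_ws r)) <= N.
  apply: leq_trans (ltnW Hl).
  by rewrite /r_local !enc_tuple_cons !size_cat; lia.
rewrite iterSr den_peek1; last by rewrite /pst /rf /=; case: (r_ports r).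
rewrite /pst /body2.
rewrite den_seq (@rf_rd _ _ _ _ _ _ (r_ports r) (enc_tuple (map r_ports rs))) //=.
rewrite den_seq (@rf_rd _ _ _ _ _ _ (r_local r) (enc_tuple (map r_local rs ++ rest))) //=.
rewrite den_seq (@rf_rd _ _ _ _ _ _ (r_id r) (enc_tuple ([:: r_tm r] :: r_ws r))) //=; last first.
  by rewrite /rf /= cats0.
rewrite den_seq rf_clear //=; last by rewrite /rf /= cats0 ltnW.
rewrite den_seq (@rf_rd _ _ _ _ _ _ [:: r_tm r] (enc_tuple (r_ws r))) //=.
rewrite (@rf_case1 _ _ _ _ _ _ (r_tm r) [::]) //= /rf /= !cats0 -/(rf _).
case: (r_tm r); last first.
  rewrite den_seq rf_clear //=; last exact: ltnW.
  rewrite rf_clear //= -/(pst _ _ _ _ _ _ _ _ _ _ _ _ _ _ _ _ _ _ _) IH //.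
  by move: Hu => /=; lia.
rewrite den_seq den_rep.
rewrite [iter N _ _](@ports_loop N o (enc_tuple (map r_ports rs)) (enc_tuple (map r_local rs ++ rest)) NN CN [::] FL FLf LB nm (r_ps r) (r_ws r) acc u) //; last first.
  by move: Hu => /=; lia.
rewrite /pst rf_push /= -[true :: nseq u true]/(nseq u.+1 true).
rewrite -/(pst _ _ _ _ _ _ _ _ _ _ _ _ _ _ _ _ _ _ _) IH //.
  by rewrite add1n addSnnS.
by move: Hu => /=; lia.
Qed.

Lemma dist_loop k o A A2 NN CN TL TLf Z FL (fl : bits) P L w rk fd TC UR (ls : seq bits) :
  size fl <= k -> (forall l : bits, l \in ls -> size l < N) ->
  iter k (den N loop3)
    (pst o A A2 NN CN TL TLf Z FL fl P L [::] w rk fd TC UR (enc_tuple ls)) 0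
  = rev (enc_tuple (distribute fl ls)) ++ o.
Proof.
elim: k fl ls o => [|k IH] fl ls o Hk Hls.
  by case: fl Hk.
rewrite iterSr.
case: fl Hk => [|b fl] Hk.
  by rewrite /loop3 den_case0 // iter_case_stop.
rewrite /pst /loop3 (@rf_case1 _ _ _ _ _ _ b fl) //= -/loop3.
case: b Hk => Hk; last first.
  rewrite den_seq !rf_push /= /rf /= -/(rf _) -/(pst _ _ _ _ _ _ _ _ _ _ _ _ _ _ _ _ _ _ _) IH //.
  by rewrite enc_tuple_cons rev_cat -catA.
case: ls Hls => [|l ls] Hls.
  rewrite den_peek0 // !den_seq !rf_push /= /rf /= -/(rf _).
  rewrite -[[::] in X in rf X]/(enc_tuple [::]).
  rewrite -/(pst _ _ _ _ _ _ _ _ _ _ _ _ _ _ _ _ _ _ _) IH //=.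
  by rewrite enc_tuple_cons rev_cat -catA.
have Hl : size l < N by apply: Hls; rewrite mem_head.
have Hlt (x : bits) : x \in ls -> size x < N by move=> H; apply: Hls; rewrite inE H orbT.
rewrite den_peek1; last by rewrite /rf /=; case: (l).
rewrite den_seq (@rf_rd _ _ _ _ _ _ l (enc_tuple ls)) //=.
rewrite rf_writestr //=; last by rewrite /rf /= cats0 ltnW.
rewrite /rf /= !cats0 -/(rf _) -/(pst _ _ _ _ _ _ _ _ _ _ _ _ _ _ _ _ _ _ _) IH //=.
by rewrite enc_tuple_cons rev_cat -catA.
Qed.

End Run.

(** The list of names must fit into N bits to be copied by a bounded loop. The numeral of v has at
    most v bits, and a local input with about n weight fields is longer than that. *)
Lemma size_names n v rs : v + size rs <= n -> (forall r, List.In r rs -> n <= (size (r_ws r)).+1) ->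
  size (enc_tuple (names v rs)) <= size (enc_tuple (map r_local rs)).
Proof.
elim: rs v => [|r rs IH] v //= Hv Hr.
rewrite -[enc_tuple (r_local r :: _)]/(enc_str (r_local r) ++ enc_tuple (map r_local rs)).
have H1 : size (enc_tuple (names v.+1 rs)) <= size (enc_tuple (map r_local rs)).
  by apply: IH => [|r' H']; [lia|apply: Hr; right].
have := size_enc_tuple_ge (r_id r :: [:: r_tm r] :: r_ws r).
rewrite -/(r_local r) /= size_cat size_enc_str => H2.
have := Hr r (or_introl erefl); have := size_bin_le v.
move: (r_local r) H2 => x H2.
by case: (r_tm r); rewrite ?enc_tuple_cons ?[size (enc_str _ ++ _)]size_cat ?size_enc_str; lia.
Qed.

Lemma in_mem_enc (A : Type) (f : A -> bits) (l : seq A) a : List.In a l ->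
  (size (f a)).*2.+2 <= size (enc_tuple (map f l)).
Proof.
elim: l => //= b l IH.
rewrite -[enc_tuple (f b :: _)]/(enc_str (f b) ++ enc_tuple (map f l)).
rewrite [size (enc_str _ ++ _)]size_cat size_enc_str => -[->|/IH]; first by lia.
by move: (size (f a)) (size (f b)) => ? ?; lia.
Qed.

Lemma pprog_spec (rows : seq nrow) : let N := size (pinput rows) in
  (forall r, List.In r rows -> size (r_ps r) = size (r_ws r)) ->
  (forall r, List.In r rows -> size rows <= (size (r_ws r)).+1) ->
  (forall l : bits, l \in Fl (take BB (zall rows)) -> size l < N) ->
  den N pprog (input_store (pinput rows)) 0 = rev (enc_tuple (plabels rows)).
Proof.
move=> N Hps Hws Hl; set n := size rows.
have EN : N = (size (bin n)).*2.+2 + (size (enc_tuple (map r_local rows)) +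
   size (enc_tuple (map r_ports rows))).
  by rewrite /N /pinput enc_tuple_cons enc_tuple_cat [LHS]size_cat size_enc_str [size (enc_tuple _ ++ _)]size_cat.
have Hnl : n.*2 <= size (enc_tuple (map r_local rows)).
  by have := size_enc_tuple_ge (map r_local rows); rewrite size_map.
have Hok r : List.In r rows -> row_ok N r.
  move=> Hr; split; last exact: Hps.
    by have := in_mem_enc r_local Hr; lia.
  by have := in_mem_enc r_ports Hr; lia.
have Hnm : size (enc_tuple (names 0 rows)) <= N.
  by have := @size_names n 0 rows (leqnn _) Hws; lia.
have -> : input_store (pinput rows) =
    pst [::] (pinput rows) [::] [::] [::] [::] [::] [::] [::] [::] [::] [::] [::] [::] [::]
      [::] [::] [::] [::].
  apply: functional_extensionality => j; rewrite /input_store /sset /pst /rf.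
  by do 26 (case: j => [|j] //); rewrite nth_default.
rewrite /pprog /pst.
rewrite den_seq (@rf_rd _ _ _ _ _ _ (bin n) (enc_tuple (map r_local rows ++ map r_ports rows))) //=; last by lia.
rewrite den_seq rf_copy //=; last first.
  by rewrite /rf /= enc_tuple_cat size_cat; lia.
rewrite /rf /= !cats0 -/(rf _) den_seq den_rep.
rewrite [iter N _ _](@names_loop N N [::] (enc_tuple (map r_local rows ++ map r_ports rows)) n 0 [::] [::] [::] [::] (map r_ports rows) [::] rows) //; try by lia.
rewrite /pst den_seq rf_mv //= ?size_rev // ?catrevE ?revK ?cats0 ?cat0s.
rewrite den_seq rf_mv //=; last by rewrite /rf /= ?catrevE ?cats0 ?size_rev size_map -/n; lia.
rewrite /rf /= ?catrevE ?cats0 ?revK -/(rf _) den_seq den_rep.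
rewrite [iter N _ _](@rows_loop N N [::] (bin n) (bin n) [::] (map r_tm rows) [::] (names 0 rows) (map r_ports rows) [::] 0 rows) //; try by rewrite ?add0n; lia.
rewrite /pst den_seq rf_consstr //=; last first.
  by rewrite /rf /= size_nseq; have := count_size r_tm rows; rewrite -/n; lia.
rewrite den_seq rf_tab //= /rf /= rev_nseq !cats0 -/(rf _) den_rep.
apply: etrans (@dist_loop N N [::] _ _ _ _ _ _ _ _ _ _ _ _ _ _ _ _ _ _ Hl) _.
  by rewrite size_map -/n; lia.
by rewrite cats0.
Qed.

End Prover.

(** * Walks, thresholds and Prim's algorithm *)

Fixpoint pcost (V : Type) (d : V -> V -> nat) (x : V) (s : seq V) : nat :=
  if s is y :: s' then d x y + pcost d y s' else 0.

Lemma pcost_cat V (d : V -> V -> nat) x s1 s2 :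
  pcost d x (s1 ++ s2) = pcost d x s1 + pcost d (last x s1) s2.
Proof. by elim: s1 x => //= y s1 IH x; rewrite IH addnA. Qed.

Lemma pcost_sum V (M : nat) (d : 'I_M -> V -> V -> nat) x s :
  \sum_(i < M) pcost (d i) x s = pcost (fun a b => \sum_(i < M) d i a b) x s.
Proof.
elim: s x => /= [|y s IH] x; first by rewrite big1.
by rewrite big_split /= IH.
Qed.

(** Skipping a vertex is a shortcut by the triangle inequality. *)
Lemma pcost_filter V (d : V -> V -> nat) (P : pred V) x s :
  (forall a b c, d a c <= d a b + d b c) ->
  pcost d x (filter P s) <= pcost d x s.
Proof.
move=> tri.
have skip z y s' : pcost d z s' <= d z y + pcost d y s'.
  by case: s' => //= y' s'; have := tri z y y'; lia.
elim: s x => //= y s IH x; case: ifP => _ /=; first by rewrite leq_add2l.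
by apply: leq_trans (skip x y _) _; rewrite leq_add2l.
Qed.

(** A colour that does not occur again after x is left at the first step. *)
Lemma pcost_changes (V : Type) (C : eqType) (c : V -> C) x s :
  size (undup (map c (x :: s))) <= (pcost (fun a b => c a != c b : nat) x s).+1.
Proof.
elim: s x => // y s IH x; rewrite [map _ _]/= [undup _]/=.
have := IH y; rewrite [pcost _ x _]/= => {}IH.
case: ifP => H; first by apply: leq_trans IH _; lia.
rewrite /=; have -> : c x != c y by apply: contraFneq H => ->; rewrite mem_head.
by rewrite add1n ltnS.
Qed.

(** Layer-cake formula: a number is the count of the thresholds below it. *)
Lemma sum_ltn M d : \sum_(t < M) (t < d) = minn d M.
Proof.
elim: M => [|M IH]; first by rewrite big_ord0 minn0.
by rewrite big_ord_recr /= IH; lia.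
Qed.

Definition is_tree (G : inst) (VT : {set 'I_(nn G)}) (ET : {set 'I_(nn G) * 'I_(nn G)}) :=
  [/\ forall e, e \in ET -> [/\ e.1 \in VT, e.2 \in VT & (e.1 < e.2)%N],
      VT != set0,
      #|ET|.+1 = #|VT|
    & forall x y, x \in VT -> y \in VT -> connect (tadj (n := nn G) ET) x y].

Section Trees.
Variables (cid : nat) (G : inst).
Hypothesis vG : valid cid G.
Notation V := 'I_(nn G).

(** [valid] leaves the size of [wt] on the diagonal free; with zero there, the triangle inequality
    holds for all triples. *)
Definition dist (x y : V) : nat := if x == y then 0 else wt G x y.

Lemma wtC u v : wt G u v = wt G v u. Proof. by case: vG => _ _ _ [H _] _. Qed.
Lemma wt_gt0 u v : u != v -> 0 < wt G u v.
Proof. by case: vG => _ _ _ [_ H] _; apply: H. Qed.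

Lemma dist_tri a b c : dist a c <= dist a b + dist b c.
Proof.
rewrite /dist; have [->|ac] := eqVneq a c; first by [].
have [Eab|ab] := eqVneq a b; first by rewrite -Eab (negbTE ac).
have [<-|bc] := eqVneq b c; first by rewrite addn0.
by case: vG => _ _ _ _ H; apply: H.
Qed.

Lemma tadj_sym (ET : {set V * V}) : symmetric (tadj (n := nn G) ET).
Proof. by move=> x y; rewrite /tadj orbC. Qed.

Lemma detour_arith p1 p2 w A A' :
  A + w <= A' -> p1 + p2 <= 2 * A -> p1 + (w + (w + p2)) <= 2 * A'.
Proof. by clear; lia. Qed.

Section Walk.
Variables (VT : {set V}) (ET : {set V * V}).
Hypothesis tr : is_tree VT ET.

Definition inner_edges (C : {set V}) := [set e in ET | (e.1 \in C) && (e.2 \in C)].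

Lemma crossing_edge (C : {set V}) x : x \in C -> C \subset VT -> C != VT ->
  exists c u, [/\ c \in C, u \in VT, u \notin C & tadj ET c u].
Proof.
case: tr => Hed _ _ Hconn xC CV CneV.
have /subsetPn[y yV yC] : ~~ (VT \subset C).
  by apply: contra CneV => H; rewrite eqEsubset CV.
case: (boolP [exists c : V, exists u : V, [&& c \in C, u \notin C & tadj ET c u]]).
  case/existsP=> c /existsP[u /and3P[cC uC cu]]; exists c, u; split=> //.
  by case/orP: cu => /Hed[].
move=> H; suff clip : closed (tadj ET) (mem C).
  have := closed_connect clip (Hconn x y (subsetP CV _ xC) yV).
  by rewrite xC (negbTE yC).
have half a b : tadj ET a b -> a \in C -> b \in C.
  move=> ab aC; apply: contraNT H => bC.
  by apply/existsP; exists a; apply/existsP; exists b; rewrite aC bC.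
move=> a b ab; apply/idP/idP; first exact: half.
by apply: half; rewrite tadj_sym.
Qed.

(** This is the walk around the doubled tree. The visited set C grows along a crossing edge from c
    to u, and the detour to u and back to c is spliced in at an occurrence of c. Its cost is charged
    twice to that edge, which becomes an inner edge of C at this moment. *)
Lemma tour_exists : exists x s,
  {subset VT <= x :: s} /\ pcost dist x s <= 2 * tree_weight G ET.
Proof.
have /set0Pn[x xV] : VT != set0 by case: tr.
suff grow m (C : {set V}) : #|VT :\: C| <= m -> x \in C -> C \subset VT ->
    (exists s, {subset C <= x :: s} /\
       pcost dist x s <= 2 * \sum_(e in inner_edges C) wt G e.1 e.2) ->
    exists s, {subset VT <= x :: s} /\ pcost dist x s <= 2 * tree_weight G ET.
  exists x; apply: (grow #|VT :\: [set x]| [set x]) => //.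
  - exact: set11.
  - by rewrite sub1set.
  - by exists [::]; split=> // y /set1P->; rewrite mem_head.
have Hsum (A B : {set V * V}) : A \subset B ->
    \sum_(e in A) wt G e.1 e.2 <= \sum_(e in B) wt G e.1 e.2.
  by move=> AB; rewrite [leqRHS](big_setID A) /= (setIidPr AB) leq_addr.
elim: m C => [|m IH] C Hm xC CV [s [Hs Hc]].
  move: Hm; rewrite leqn0 cards_eq0 setD_eq0 => VC.
  exists s; split; first by move=> y /(subsetP VC)/Hs.
  apply: leq_trans Hc _; rewrite leq_mul2l; apply: Hsum.
  by apply/subsetP=> e; rewrite inE => /andP[].
have [E | ne] := eqVneq C VT.
  by apply: (IH C); rewrite ?E ?setDv ?cards0 //; rewrite -E; exists s.
have [c [u [cC uV uC cu]]] := crossing_edge xC CV ne.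
apply: (IH (u |: C)).
- rewrite -ltnS; apply: leq_trans Hm; apply: proper_card.
  apply/properP; split; first by apply: setDS; apply: subsetUr.
  by exists u; rewrite !inE ?uC ?uV ?eqxx.
- by rewrite inE xC orbT.
- by rewrite subUset sub1set uV.
have [e [eE e1 e2 we]] : exists e, [/\ e \in ET, e.1 \in u |: C, e.2 \in u |: C &
    (wt G e.1 e.2 = wt G c u) /\ ~~ ((e.1 \in C) && (e.2 \in C))].
  case/orP: cu => H; [exists (c, u) | exists (u, c)]; rewrite /= !inE eqxx cC orbT;
    by split; rewrite // (negbTE uC) ?andbF // wtC.
have neq : c != u by apply: contraNneq uC => <-.
have Hsum2 : \sum_(e in inner_edges C) wt G e.1 e.2 + wt G c u <=
    \sum_(e in inner_edges (u |: C)) wt G e.1 e.2.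
  have eI : e \in inner_edges (u |: C) by rewrite inE eE e1 e2.
  rewrite (big_setD1 e eI) /= we.1 addnC leq_add2l; apply: Hsum.
  apply/subsetP=> e'; rewrite !inE => /and3P[-> He1 He2].
  rewrite He1 He2 !orbT !andbT; apply: contraNneq we.2 => <-.
  by rewrite He1 He2.
have cs : c \in x :: s by apply: Hs.
move: Hs Hc; case/splitPl: cs => s1 s2 Hl Hs Hc.
exists (s1 ++ [:: u, c & s2]); split.
  move=> y; rewrite !inE mem_cat !inE => /orP[->|/Hs]; first by rewrite !orbT.
  by rewrite inE mem_cat => /or3P[] ->; rewrite ?orbT.
have d1 : dist c u = wt G c u by rewrite /dist (negbTE neq).
have d2 : dist u c = wt G c u by rewrite /dist eq_sym (negbTE neq) wtC.
move: Hc; rewrite !pcost_cat /= Hl d1 d2.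
exact: detour_arith Hsum2.
Qed.

Lemma tree_weight_ge_card : #|ET| <= tree_weight G ET.
Proof.
rewrite -sum1_card; apply: leq_sum => e eE; apply: wt_gt0.
by case: tr => /(_ _ eE)[_ _]; rewrite ltn_neqAle => /andP[].
Qed.

End Walk.

Section Threshold.
Variables (T : {set V}) (rk gp : V -> nat).
Hypotheses (rk_inj : {in T &, injective rk})
  (sep : forall u v l, u \in T -> v \in T -> l \in T -> u != v ->
     rk u < rk l <= rk v -> gp l <= wt G u v).

Definition above (t : nat) : {set V} := [set l in T | (rk l != 0) && (t < gp l)].
(** The ranks in [above t] cut the ranking into intervals; this is the number of the interval that
    contains x. *)
Definition block (t : nat) (x : V) : nat := #|[set l in above t | rk l <= rk x]|.

(** Between the ranks of vertices in different blocks lies some l with gap above t, and [sep] passes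
    this on to the edge. *)
Lemma block_sep t x y : x \in T -> y \in T -> block t x != block t y -> t < dist x y.
Proof.
move=> xT yT H; have ne : x != y by apply: contraNneq H => ->.
rewrite /dist (negbTE ne).
wlog lt : x y xT yT ne H / rk x < rk y.
  move=> W; have : rk x != rk y by apply: contraNneq ne => /rk_inj ->.
  rewrite neq_ltn => /orP[|] lt; first exact: W.
  by rewrite wtC; apply: W => //; rewrite eq_sym.
have [l lA /andP[lx ly]] : exists2 l, l \in above t & rk x < rk l <= rk y.
  case: (pickP [pred l in above t | rk x < rk l <= rk y]) => [l /andP[? ?]|H0]; first by exists l.
  case/eqP: H; rewrite /block; apply: eq_card => l; rewrite !inE.
  have := H0 l; rewrite !inE; case: (l \in T) => //=; case: (rk l != 0) => //=.
  case: (t < gp l) => //= h; move: h lt; move: (rk l) (rk x) (rk y) => a b c; clear; lia.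
move: lA; rewrite inE => /and3P[lT _ lt_g]; apply: leq_trans lt_g _.
by apply: sep => //; rewrite lx.
Qed.

Lemma gaps_le_walk x s r0 : r0 \in T -> rk r0 = 0 ->
  {subset x :: s <= T} -> {subset T <= x :: s} ->
  \sum_(l in T | rk l != 0) gp l <= pcost dist x s.
Proof.
move=> r0T r00 sT Ts.
pose M := \max_(l in T) gp l.
have HM l : l \in T -> gp l <= M by move=> lT; apply: leq_bigmax_cond.
have Eg l : l \in T -> gp l = \sum_(t < M) (t < gp l).
  by move=> /HM lM; rewrite sum_ltn (minn_idPl lM).
have -> : \sum_(l in T | rk l != 0) gp l = \sum_(t < M) #|above t|.
  rewrite (eq_bigr (fun l => \sum_(t < M) (t < gp l))); last by move=> l /andP[/Eg].
  rewrite exchange_big /=; apply: eq_bigr => t _.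
  rewrite -sum1_card big_mkcond /= [RHS]big_mkcond /=; apply: eq_bigr => l _.
  by rewrite inE; case: (l \in T) => //=; case: (rk l != 0) => //=; case: ifP.
apply: (@leq_trans (\sum_(t < M) pcost (fun a b => block t a != block t b : nat) x s)).
  apply: leq_sum => t _; rewrite -ltnS; apply: leq_trans (pcost_changes (block t) x s).
  (* The root r0 lies in block 0, and the members of [above t] lie in distinct positive blocks, as
     each of them opens a new one. *)
  have -> : #|above t|.+1 = size (map (block t) (r0 :: enum (above t))).
    by rewrite size_map /= -cardE.
  have sub l : l \in above t -> l \in T by rewrite inE => /andP[].
  have Eb z v : (z \in [set l in above t | rk l <= rk v]) = (z \in above t) && (rk z <= rk v).
    by rewrite in_set.
  have mono l l' : l \in above t -> l' \in above t -> rk l < rk l' -> block t l < block t l'.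
    move=> lA l'A lt; apply: proper_card; apply/properP; split.
      by apply/subsetP=> z; rewrite !Eb => /andP[-> /leq_trans->] //; apply: ltnW.
    by exists l'; rewrite Eb l'A ?leqnn // -ltnNge.
  have r0_0 : block t r0 = 0.
    apply/eqP; rewrite cards_eq0; apply/eqP/setP => z; rewrite !inE r00 leqn0.
    by case: (rk z == 0); rewrite ?andbF.
  apply: uniq_leq_size.
    rewrite /= map_inj_in_uniq ?enum_uniq ?andbT.
      apply/mapP => -[l]; rewrite mem_enum => lA; rewrite r0_0 => /esym/eqP.
      rewrite cards_eq0 => /eqP/setP/(_ l); rewrite in_set0 in_set leqnn andbT.
      by rewrite lA.
    move=> l l'; rewrite !mem_enum => lA l'A E; apply: rk_inj; try exact: sub.
    have irr a b : a \in above t -> b \in above t -> block t a = block t b -> rk a <= rk b.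
      by move=> aA bA Eab; rewrite leqNgt; apply/negP=> /(mono _ _ bA aA); rewrite Eab ltnn.
    by apply/eqP; rewrite eqn_leq !irr.
  move=> b /mapP[l Hl ->]; rewrite mem_undup; apply: map_f; apply: Ts.
  by move: Hl; rewrite inE mem_enum => /orP[/eqP->//|/sub].
rewrite pcost_sum.
elim: s x sT {Ts} => //= y s IH x sT.
apply: leq_add; last by apply: IH => z Hz; apply: sT; rewrite inE Hz orbT.
have xT : x \in T by apply: sT; rewrite mem_head.
have yT : y \in T by apply: sT; rewrite !inE eqxx orbT.
(* A step of length d changes blocks only for thresholds t < d, so it is counted at most d times in
   all. *)
apply: (@leq_trans (\sum_(t < M) (t < dist x y))).
  apply: leq_sum => t _; case: (boolP (block t x == block t y)) => //= H.
  by rewrite block_sep.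
by rewrite sum_ltn geq_minl.
Qed.

End Threshold.
End Trees.

(** The inequalities speak of terminals only, so the tour of the tree is first shortcut to them. *)
Lemma gaps_le_double_tree cid G VT ET (T : {set 'I_(nn G)}) (rk gp : 'I_(nn G) -> nat) r0 :
  valid cid G -> is_tree VT ET -> T \subset VT ->
  {in T &, injective rk} ->
  (forall u v l, u \in T -> v \in T -> l \in T -> u != v ->
     rk u < rk l <= rk v -> gp l <= wt G u v) ->
  r0 \in T -> rk r0 = 0 ->
  \sum_(l in T | rk l != 0) gp l <= 2 * tree_weight G ET.
Proof.
move=> vG tr TV rk_inj sep r0T r00.
have [x [s [Vs Hc]]] := tour_exists vG tr.
apply: leq_trans Hc.
have Tf z : (z \in filter (mem T) (x :: s)) = (z \in T).
  rewrite mem_filter; case zT: (z \in T); rewrite /= zT //=.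
  by rewrite Vs // (subsetP TV).
have tri := dist_tri vG.
case E: (filter (mem T) (x :: s)) Tf => [|y z] Tf.
  by have := Tf r0; rewrite r0T.
apply: (@leq_trans (pcost (dist (G := G)) y z)).
  by apply: (gaps_le_walk vG rk_inj sep r0T r00) => l; rewrite ?Tf // -Tf.
apply: leq_trans (pcost_filter (mem T) x s tri).
(* If x is no terminal, the shortcut walk starts at the first terminal y, and the approach from x to
   y is dropped. *)
move: E => /=; case: ifP => _ E; first by case: E => <- <-.
by rewrite E /= leq_addl.
Qed.

(* [s] lists the points 0, ..., t-1 in the order in which Prim's algorithm adds
   them; point number l is attached to [pi l] at cost [g l]. *)
Definition prim_order (t : nat) (D : nat -> nat -> nat) m (s : seq nat) (g pi : nat -> nat) :=
  [/\ size s = m, uniq s, {subset s <= iota 0 t} &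
   forall l, 0 < l < m -> [/\ pi l \in take l s, g l = D (pi l) (nth 0 s l) &
     forall a b, a \in take l s -> b < t -> b \notin take l s -> g l <= D a b]].

(** The order grows by one point at a time: some point is still outside by counting, and a cheapest
    crossing pair exists because costs are natural numbers. *)
Lemma prim_exists t D : 0 < t -> exists s g pi, prim_order t D t s g pi.
Proof.
move=> t0; suff grow m : 0 < m <= t -> exists s g pi, prim_order t D m s g pi.
  by apply: grow; rewrite t0 leqnn.
elim: m => [//|[|m] IH] /andP[_ mt].
  exists [:: 0], id, id; split=> //; last by case.
  by move=> x; rewrite inE => /eqP->; rewrite mem_iota.
have [s [g [pi [ss us sub step]]]] := IH (ltnW mt).
pose cand v := [exists a : 'I_t, exists b : 'I_t,
   [&& val a \in s, val b \notin s & D a b == v]].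
have [v0 Hv0] : exists v, cand v.
  have s0 : nth 0 s 0 \in s by rewrite mem_nth // ss.
  have lt0 : nth 0 s 0 < t by have := sub _ s0; rewrite mem_iota.
  have [b bt bs] : exists2 b, b < t & b \notin s.
    case: (boolP (all (mem s) (iota 0 t))) => [/allP H|/allPn[b]].
      have := uniq_leq_size (iota_uniq 0 t) H; rewrite size_iota ss; lia.
    by rewrite mem_iota => bt bs; exists b.
  exists (D (nth 0 s 0) b).
  by apply/existsP; exists (Ordinal lt0); apply/existsP; exists (Ordinal bt); rewrite /= s0 bs eqxx.
have [v Hv vmin] := ex_minnP (ex_intro _ v0 Hv0).
have /existsP[a /existsP[b /and3P[as_ bs /eqP Dab]]] := Hv.
exists (rcons s b), (fun l => if l == m.+1 then v else g l),
  (fun l => if l == m.+1 then val a else pi l); split.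
- by rewrite size_rcons ss.
- by rewrite rcons_uniq bs.
- by move=> x; rewrite mem_rcons inE => /orP[/eqP->|/sub //]; rewrite mem_iota /=.
move=> l /andP[l0]; rewrite ltnS leq_eqVlt => /orP[/eqP->|lm].
  rewrite eqxx -ss -cats1 take_size_cat // nth_cat ltnn subnn /=; split=> //.
  move=> a' b' a's b't b's; apply: vmin; apply/existsP.
  have a't : a' < t by have := sub _ a's; rewrite mem_iota.
  by exists (Ordinal a't); apply/existsP; exists (Ordinal b't); rewrite /= a's b's eqxx.
rewrite (ltn_eqF lm) -cats1 takel_cat ?nth_cat ?ss ?lm //; last exact: ltnW.
by apply: step; rewrite l0.
Qed.

(** * The tree of a Prim order *)

Section Span.
Variables (cid : nat) (G : inst).
Hypothesis vG : valid cid G.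
Notation V := 'I_(nn G).

Lemma is_tree1 (v : V) : is_tree [set v] set0.
Proof.
split.
- by move=> e; rewrite inE.
- by apply/set0Pn; exists v; rewrite set11.
- by rewrite cards0 cards1.
- by move=> x y /set1P-> /set1P->; apply: connect0.
Qed.

Lemma is_tree_leaf VT ET (c u : V) : is_tree VT ET -> c \in VT -> u \notin VT ->
  exists ET', is_tree (u |: VT) ET' /\ tree_weight G ET' = tree_weight G ET + wt G c u.
Proof.
move=> [Hed Hne Hcard Hconn] cV uV.
pose e := if c < u then (c, u) else (u, c).
have ne : c != u by apply: contraNneq uV => <-.
have eNE : e \notin ET.
  by apply/negP=> /Hed; rewrite /e; case: ifP => _ [] /= h1 h2; rewrite ?(negbTE uV) in h1 h2.
have eadj : tadj (e |: ET) c u.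
  by rewrite /tadj /e !inE; case: ifP; rewrite eqxx ?orbT.
have sube : subrel (tadj ET) (connect (tadj (e |: ET))).
  by move=> x y /orP[] h; apply: connect1; rewrite /tadj !inE h ?orbT.
have symc := sym_connect_sym (@tadj_sym G (e |: ET)).
have toc x : x \in u |: VT -> connect (tadj (e |: ET)) c x.
  case/setU1P=> [->|xV]; first exact: connect1.
  exact: connect_sub sube _ _ (Hconn _ _ cV xV).
exists (e |: ET); split; last first.
  rewrite /tree_weight big_setU1 //= addnC; congr addn.
  by rewrite /e; case: ifP => //= _; rewrite (wtC vG).
split.
- move=> e' /setU1P[->|/Hed[h1 h2 h3]]; last by rewrite !inE h1 h2 !orbT.
  rewrite /e; case: ifP => /= h; rewrite !inE eqxx cV orbT; split=> //.
  by rewrite ltn_neqAle leqNgt h andbT eq_sym.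
- by apply/set0Pn; exists u; rewrite !inE eqxx.
- by rewrite !cardsU1 eNE uV -Hcard.
- by move=> x y xV yV; apply: connect_trans (toc _ yV); rewrite symc; apply: toc.
Qed.

(** The order is Prim's for an arbitrary cost D, later the truncated weights, whereas the tree is
    weighed by [wt]. Each new point is attached as a leaf. *)
Lemma prim_tree t D (f : nat -> V) s g pi :
  {in iota 0 t &, injective f} -> prim_order t D t s g pi -> 0 < t ->
  exists VT ET, [/\ is_tree VT ET, (forall i, i < t -> f i \in VT) &
    tree_weight G ET = \sum_(1 <= l < t) wt G (f (pi l)) (f (nth 0 s l))].
Proof.
move=> f_inj [ss us sub step] t0.
suff grow m : 0 < m <= t -> exists ET,
   is_tree [set f (val i) | i in [pred i : 'I_t | val i \in take m s]] ET /\
   tree_weight G ET = \sum_(1 <= l < m) wt G (f (pi l)) (f (nth 0 s l)).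
  have [|ET [Htr Hw]] := grow t; first by rewrite t0 leqnn.
  eexists; exists ET; split; [exact: Htr| |exact: Hw].
  move=> i it; apply/imsetP; exists (Ordinal it) => //; rewrite inE /=.
  have [|_ E] := uniq_min_size us sub; first by rewrite size_iota ss.
  by rewrite -ss take_size E mem_iota.
elim: m => [//|[|m] IH] /andP[_ mt].
  have s0 : nth 0 s 0 < t.
    by have := sub (nth 0 s 0); rewrite mem_nth ?ss // mem_iota => /(_ isT).
  exists set0; rewrite /tree_weight big_set0 big_geq //; split=> //.
  have -> : [set f (val i) | i in [pred i : 'I_t | val i \in take 1 s]] = [set f (nth 0 s 0)].
    apply/setP=> v; rewrite inE; apply/imsetP/eqP.
      move=> [i]; rewrite inE; case: (s) ss => [|x s'] /= Hs; first by rewrite -Hs in t0.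
      by rewrite take0 inE => /eqP -> ->.
    move=> ->; exists (Ordinal s0) => //; rewrite inE /=.
    by case: (s) ss => [|x s'] /= Hs; [rewrite -Hs in t0|rewrite take0 inE].
  exact: is_tree1.
have [ET [Htr Hw]] := IH (ltnW mt).
have [pin Hg _] := step m.+1 mt.
set l := m.+1 in pin Hg Htr Hw *.
have lt_l : nth 0 s l < t.
  by have := sub (nth 0 s l); rewrite mem_nth ?ss // mem_iota => /(_ isT).
have lt_pi : pi l < t by have := sub _ (mem_take pin); rewrite mem_iota.
have nl : nth 0 s l \notin take l s.
  by move: us; rewrite -{1}(cat_take_drop l s) (drop_nth 0) ?ss // cat_uniq /= negb_or => /and3P[_ /andP[]].
have [||ET' [Htr' Hw']] := is_tree_leaf (c := f (pi l)) (u := f (nth 0 s l)) Htr.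
- by apply/imsetP; exists (Ordinal lt_pi).
- apply/imsetP=> -[i]; rewrite inE => Hi E; move: nl; rewrite (f_inj _ _ _ _ E) ?Hi //.
    by rewrite mem_iota.
  by rewrite mem_iota /=.
exists ET'; split; last by rewrite Hw' Hw [RHS]big_nat_recr.
have -> : [set f (val i) | i in [pred i : 'I_t | val i \in take l.+1 s]] =
    f (nth 0 s l) |: [set f (val i) | i in [pred i : 'I_t | val i \in take l s]].
  apply/setP=> v; rewrite in_setU1 (take_nth 0) ?ss //.
  apply/imsetP/orP => [[i]|].
    rewrite inE mem_rcons inE => /orP[/eqP Ei ->|Hi ->]; first by left; rewrite Ei.
    by right; apply/imsetP; exists i.
  case=> [/eqP->|/imsetP[i Hi ->]].
    by exists (Ordinal lt_l) => //; rewrite inE /= mem_rcons mem_head.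
  by exists i => //; rewrite inE mem_rcons inE; move: Hi; rewrite inE => ->; rewrite orbT.
exact: Htr'.
Qed.

End Span.

(** Either some term reaches K, and then so does the truncated sum, or no term is changed. *)
Lemma min_sum_le (I : Type) (r : seq I) (P : pred I) (F : I -> nat) K :
  minn K (\sum_(i <- r | P i) F i) <= \sum_(i <- r | P i) minn K (F i).
Proof.
elim/big_rec2: _ => [|i y1 y2 _ IH]; first by rewrite minn0.
by move: IH; rewrite /minn; do 3 case: ifP; lia.
Qed.

Lemma size_bin_mono x y : x <= y -> size (bin x) <= size (bin y).
Proof.
elim/ltn_ind: y x => -[|y] IH [|x] // H.
rewrite !bin_succ -[size (_ :: bin y.+1./2)]/(size (bin y.+1./2)).+1.
rewrite -[size (_ :: _)]/(size (bin x.+1./2)).+1 ltnS.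
by apply: IH; lia.
Qed.

Lemma exp_size_bin x : 0 < x -> 2 ^ (size (bin x)).-1 <= x.
Proof.
elim/ltn_ind: x => -[|x] IH // _; rewrite bin_succ -[size _]/(size (bin x.+1./2)).+1 -pred_Sn.
case E: x.+1./2 => [|z] //; rewrite -E.
have H : 0 < x.+1./2 by rewrite E.
have := IH x.+1./2 ltac:(lia) H.
have -> : size (bin x.+1./2) = (size (bin x.+1./2)).-1.+1.
  by rewrite prednK // E bin_succ.
by rewrite -pred_Sn expnS; lia.
Qed.

Lemma size_bin_log x y : x <= y -> size (bin x) <= (trunc_log 2 y).+1.
Proof.
case: (posnP x) => [->//|x0 xy].
have := exp_size_bin x0; case: (size (bin x)) => //= n H.
by rewrite ltnS; apply: trunc_log_max => //; apply: leq_trans xy.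
Qed.

(** * The scheme for a fixed threshold *)

Definition label (r g : nat) : bits := enc_tuple [:: bin r; bin g].
Definition rk_of (x : bits) : nat := val2 (nth [::] (dec x) 0).
Definition gp_of (x : bits) : nat := val2 (nth [::] (dec x) 1).

Lemma rk_label r g : rk_of (label r g) = r.
Proof. by rewrite /rk_of dec_enc val2_bin. Qed.
Lemma gp_label r g : gp_of (label r g) = g.
Proof. by rewrite /gp_of dec_enc val2_bin. Qed.
Lemma size_label r g : size (label r g) = (size (bin r)).*2 + (size (bin g)).*2 + 4.
Proof. by rewrite size_enc_tuple /=; lia. Qed.
Lemma label_neq0 r g : label r g != [::].
Proof. by rewrite -size_eq0 size_label addn4. Qed.

Fixpoint pairs (s : seq bits) : seq (bits * bits) :=
  if s is a :: b :: s' then (a, b) :: pairs s' else [::].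
Definition unpairs (es : seq (bits * bits)) : seq bits :=
  flatten [seq [:: e.1; e.2] | e <- es].
Lemma unpairsK : cancel unpairs pairs.
Proof. by elim=> //= -[a b] es IH /=; rewrite -/(unpairs es) IH. Qed.

Fixpoint triples (s : seq bits) : seq (bits * bits * bits) :=
  if s is a :: b :: c :: s' then (a, b, c) :: triples s' else [::].
Definition untriples (es : seq (bits * bits * bits)) : seq bits :=
  flatten [seq [:: e.1.1; e.1.2; e.2] | e <- es].
Lemma untriplesK : cancel untriples triples.
Proof. by elim=> //= -[[a b] c] es IH /=; rewrite -/(untriples es) IH. Qed.

Section Fixed_threshold.
Variable K : nat.

(** A label with rank and gap at most K has at most 4 K + 4 bits and survives whole, while a weight
    with this many bits exceeds K. *)
Definition cut := 4 * K + 8.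

Definition clip (s : bits) : nat := if cut <= size s then K else minn K (val2 s).

Lemma clip_take w : clip (take cut (bin w)) = minn K w.
Proof.
rewrite /clip size_take; case: ltnP => H.
  by rewrite leqnn; have := size_bin_le w; rewrite /cut in H *; lia.
by rewrite take_oversize // val2_bin; case: leqP => // H2; have := size_bin_le w; rewrite /cut in H H2 *; lia.
Qed.

(* The first components of es are truncated weights of edges towards the
   terminals whose labels are the second components; l is the own label. *)
Definition check (l : bits) (es : seq (bits * bits)) : bool :=
  let ls := l :: map snd es in
  [&& all (fun e => (rk_of l != rk_of e.2) &&
        all (fun x => ((rk_of l < rk_of x <= rk_of e.2) || (rk_of e.2 < rk_of x <= rk_of l))
                        ==> (gp_of x <= clip e.1)) ls) es,
      has (fun x => rk_of x == 0) ls
    & K <= \sum_(x <- ls | rk_of x != 0) gp_of x].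

(** A terminal that sees K others may accept at once, since every Steiner tree then has at least K
    edges. A node outside must see some terminal unless K = 0: without terminals, a single vertex is
    a solution of weight 0. *)
Definition local_check (tm : bool) (l : bits) (es : seq (bits * bits)) : bool :=
  (tm == (l != [::])) &&
  ((K <= size es) || (if tm then check l es else es != [::])).

(** The sizes of the encoded terminal bit, own label and K entries, all at their maximum. A string
    that reaches this length has at least K entries, and then [local_check] does not look at their
    contents. *)
Definition vlen := 4 + (cut.*2 + 2) + K * (cut * 4 + 4).

Definition vtable (z : bits) : bool :=
  let ss := dec z in
  let tm := nth [::] ss 0 == [:: true] in
  let l := nth [::] ss 1 in
  if vlen <= size z then tm == (l != [::]) else local_check tm l (pairs (drop 2 ss)).

Definition ents (ws ls : seq bits) : seq (bits * bits) :=
  [seq (take cut p.1, take cut p.2) | p <- zip ws ls & p.2 != [::]].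

Lemma vz_ents ws ls : vz cut ws ls [::] = unpairs (rev (ents ws ls)).
Proof.
suff gen es : vz cut ws ls (unpairs es) = unpairs (catrev (ents ws ls) es) by apply: (gen [::]).
elim: ws ls es => [|w ws IH] [|[|b x] ls] es //=.
exact: IH ((_, _) :: es).
Qed.

Lemma dec_take_str acc x n r : size (enc_str x) <= n ->
  dec_from acc (take n (enc_str x ++ r)) =
  (acc ++ x) :: dec_from [::] (take (n - size (enc_str x)) r).
Proof.
by move=> H; rewrite take_cat ltnNge H /= dec_from_str.
Qed.

Lemma vtable_spec (tm : bool) l ws ls :
  vtable (take vlen (vstr cut [:: tm] l ws ls)) =
  local_check tm (take cut l) (rev (ents ws ls)).
Proof.
rewrite /vstr vz_ents; set es := rev _.
have Hes e : e \in es -> size e.1 <= cut /\ size e.2 <= cut.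
  by rewrite mem_rev => /mapP[p _ ->]; rewrite !size_take_min !geq_minl.
have Hl : size (take cut l) <= cut by rewrite size_take_min geq_minl.
have Hsz : size (enc_tuple (unpairs es)) <= size es * (cut * 4 + 4).
  elim: (es) Hes => //= e es' IH He.
  rewrite /unpairs /= -/(unpairs es') -[enc_tuple _]/(enc_str e.1 ++ (enc_str e.2 ++ enc_tuple (unpairs es'))).
  rewrite size_cat [size (_ ++ enc_tuple _)]size_cat !size_enc_str.
  have [|h1 h2] := He e; first by rewrite mem_head.
  have := IH (fun e' h => He e' (mem_behead (s := e :: es') h)).
  by move: (size _) (size _) (size _) h1 h2 => a b c; lia.
set z := enc_tuple _.
have Ez : z = enc_str [:: tm] ++ (enc_str (take cut l) ++ enc_tuple (unpairs es)) by [].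
have szz : size z = 4 + ((size (take cut l)).*2.+2 + size (enc_tuple (unpairs es))).
  by rewrite Ez [LHS]size_cat [size (_ ++ enc_tuple _)]size_cat !size_enc_str.
have Etm : ([:: tm] == [:: true]) = tm by case: tm {Ez szz z}.
rewrite /vtable size_take_min leq_min leqnn andTb.
case: (leqP vlen (size z)) => Hv.
  have Hl2 : size (enc_str (take cut l)) <= vlen - size (enc_str [:: tm]).
    by rewrite !size_enc_str /vlen /=; lia.
  have H4 : size (enc_str [:: tm]) <= vlen by rewrite size_enc_str /vlen /=; lia.
  rewrite Ez /dec dec_take_str // dec_take_str // /= Etm /local_check.
  suff -> : K <= size es by rewrite andbT.
  have : K * (cut * 4 + 4) <= size es * (cut * 4 + 4).
    by apply: leq_trans Hsz; rewrite szz /vlen in Hv; lia.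
  by rewrite leq_pmul2r // addn4.
rewrite take_oversize; last exact: ltnW.
by rewrite /z dec_enc /= Etm drop0 unpairsK.
Qed.

Lemma local_check_perm tm l es es' : perm_eq es es' -> local_check tm l es = local_check tm l es'.
Proof.
move=> H; have Hls : perm_eq (l :: map snd es) (l :: map snd es').
  by rewrite perm_cons; apply: perm_map.
rewrite /local_check (perm_size H) -!size_eq0 (perm_size H); congr (_ && (_ || _)).
case: tm => //; rewrite /check (perm_has _ Hls) (perm_big _ Hls); congr [&& _, _ & _].
rewrite (perm_all _ H); apply: eq_all => e.
by rewrite (perm_all _ Hls).
Qed.

Section Instance.
Variables (cid : nat) (G : inst).
Hypothesis vG : valid cid G.
Notation V := 'I_(nn G).

Definition others (v : V) : seq V := [seq port G v i | i <- enum 'I_(nn G).-1].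

(** The n - 1 ports have distinct targets other than v, so by counting they reach every other
    node. *)
Lemma others_perm v : perm_eq (v :: others v) (enum V).
Proof.
have [_ [pinj pne] _ _ _] := vG.
have U : uniq (v :: others v).
  rewrite /= map_inj_uniq ?enum_uniq ?andbT; last exact: pinj.
  by apply/mapP => -[i _ E]; have := pne v i; rewrite -E eqxx.
apply: uniq_perm; rewrite ?enum_uniq //.
have [||_ E] := @uniq_min_size _ (v :: others v) (enum V) U.
- by move=> x _; rewrite mem_enum.
- rewrite size_enum_ord -[size (v :: _)]/(size (others v)).+1 size_map size_enum_ord.
  by case: (nn G) v {U} => // -[].
by move=> x; rewrite E.
Qed.

Lemma mem_others v u : (u \in others v) = (u != v).
Proof.
have U : uniq (v :: others v) by rewrite (perm_uniq (others_perm v)) enum_uniq.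
have := perm_mem (others_perm v) u; rewrite mem_enum inE.
by case: eqVneq => [->|] //= _; move: U => /= /andP[/negbTE].
Qed.

Lemma others_uniq v : uniq (others v).
Proof. by have := perm_uniq (others_perm v); rewrite enum_uniq /= => /andP[]. Qed.

Definition view (L : V -> bits) (v : V) : seq (bits * bits) :=
  [seq (take cut (bin (wt G v u)), take cut (L u)) | u <- others v & L u != [::]].

Lemma ents_view L v :
  ents [seq bin (wt G v (port G v i)) | i <- enum 'I_(nn G).-1] (nbr_labels G L v) = view L v.
Proof.
rewrite /ents /nbr_labels /view /others.
by elim: (enum 'I_(nn G).-1) => //= i s IH; case: ifP => /= _; rewrite IH.
Qed.

Lemma ver_view L v :
  ver cut vlen vtable (local_input G v) (L v) (nbr_labels G L v) =
  local_check (term G v) (take cut (L v)) (view L v).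
Proof.
rewrite /ver /local_input dec_enc [nth _ _ 1]/= drop_size_cat // vtable_spec ents_view.
by apply: local_check_perm; rewrite perm_rev.
Qed.

Lemma take_eq0 (x : bits) : (take cut x == [::]) = (x == [::]).
Proof. by case: x => [|b x]; rewrite ?take0 // /cut (addnS _ 7). Qed.

(** * Soundness *)

Section Sound.
Variable L : V -> bits.
Hypothesis acc : verifier_accepts (ver cut vlen vtable) G L.
Let T : {set V} := [set v | term G v].
(** Labels of a cheating prover may be longer than [cut], but all nodes read the same truncation, so
    ranks and gaps are still well defined. *)
Let lab (v : V) := take cut (L v).

Lemma acc_term v : term G v = (L v != [::]).
Proof. by have := acc v; rewrite ver_view /local_check take_eq0 => /andP[/eqP]. Qed.

(** Every terminal sees the same labels up to order, so what one terminal checks about the gap sum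
    and rank 0 holds globally. *)
Lemma view_perm v : v \in T ->
  perm_eq (lab v :: map snd (view L v)) [seq lab u | u <- enum T].
Proof.
move=> vT; rewrite /view -map_comp -[X in perm_eq X]/(map lab (v :: _)).
apply: perm_map.
have -> : v :: [seq u <- others v | L u != [::]] = [seq u <- v :: others v | L u != [::]].
  by rewrite /=; move: vT; rewrite inE acc_term => ->.
rewrite (permPl (perm_filter _ (others_perm v))).
by rewrite {1}enumT /enum_mem; apply/permP => p; rewrite !count_filter; apply: eq_count => u; rewrite /= inE acc_term.
Qed.

Lemma size_view v : v \in T -> (size (view L v)).+1 = #|T|.
Proof.
by move=> vT; move: (perm_size (view_perm vT)); rewrite -[size (_ :: _)]/(size (map snd (view L v))).+1 !size_map -cardE.
Qed.

Lemma sound VT ET : steiner_tree G VT ET -> K <= 2 * tree_weight G ET.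
Proof.
move=> [TV Hed Hne Hcard Hconn].
have tr : is_tree VT ET by split.
have sTV : T \subset VT by apply/subsetP => v; rewrite inE => /TV.
case: (posnP K) => [->//|K0].
(* Without terminals all labels are empty, so every node sees no entry and rejects, because K >
   0. *)
have [r rT] : exists r, r \in T.
  have [n0 _ _ _ _] := vG; pose v := Ordinal n0.
  case: (set_0Vmem T) => [T0|[r rT]]; last by exists r.
  have Lv0 u : L u = [::].
    by apply/eqP; move: (acc_term u); case: (L u == [::]) => //= h; move: (in_set0 u); rewrite -T0 inE h.
  have E0 : view L v = [::].
    rewrite /view (eq_filter (a2 := pred0)) ?filter_pred0 //.
    by move=> u; rewrite Lv0.
  have := acc v; rewrite ver_view /local_check E0 leqNgt K0 /=.
  have -> : term G v = false by rewrite acc_term Lv0.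
  by rewrite andbF.
have Tc : #|T| <= #|VT| by apply: subset_leq_card.
have wge := tree_weight_ge_card vG tr.
case: (leqP K #|T|.-1) => [HK|HK].
  by move: Hcard Tc wge HK; move: (tree_weight _ _) (#|ET|) (#|VT|) (#|T|) => a b c d; clear; lia.
have chk v : v \in T -> check (lab v) (view L v).
  move=> vT; have := acc v; rewrite ver_view /local_check.
  have := vT; rewrite inE => ->; have := size_view vT.
  by rewrite leqNgt => E; rewrite -E /= in HK; rewrite HK /= => /andP[].
have lab_rk u v : u \in T -> v \in T -> u != v ->
   (take cut (bin (wt G u v)), lab v) \in view L u.
  move=> uT vT ne; apply/mapP; exists v => //.
  by rewrite mem_filter mem_others [v == u]eq_sym ne andbT; move: vT; rewrite inE acc_term.
pose rk v := rk_of (lab v); pose gp v := gp_of (lab v).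
have rk_inj : {in T &, injective rk}.
  move=> u v uT vT E; apply/eqP; apply/negPn/negP => ne.
  have /and3P[/allP/(_ _ (lab_rk _ _ uT vT ne))] := chk u uT.
  by rewrite /= -/(rk u) -/(rk v) E eqxx.
have sep u v l : u \in T -> v \in T -> l \in T -> u != v ->
     rk u < rk l <= rk v -> gp l <= wt G u v.
  move=> uT vT lT ne lt.
  have /and3P[/allP/(_ _ (lab_rk _ _ uT vT ne))] := chk u uT.
  move=> /andP[_ /allP H] _ _; have := H (lab l).
  rewrite (perm_mem (view_perm uT)) map_f ?mem_enum // => /(_ isT).
  rewrite -/(rk u) -/(rk l) -/(rk v) lt /= clip_take => h.
  by apply: leq_trans h _; apply: geq_minr.
have [r0 r0T r00] : exists2 r0, r0 \in T & rk r0 = 0.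
  have /and3P[_ /hasP[x]] := chk r rT.
  rewrite (perm_mem (view_perm rT)) => /mapP[r0]; rewrite mem_enum => r0T -> /eqP E _.
  by exists r0.
have := gaps_le_double_tree vG tr sTV rk_inj sep r0T r00.
apply: leq_trans; have /and3P[_ _] := chk r rT.
by rewrite (perm_big _ (view_perm rT)) /= big_map big_enum_cond.
Qed.

End Sound.
End Instance.
End Fixed_threshold.

(** * The labels as a function of the truncated weights *)

Definition prim_data (t : nat) (D : nat -> nat -> nat) : seq nat * (nat -> nat) * (nat -> nat) :=
  epsilon (inhabits ([::], id, id)) (fun p => prim_order t D t p.1.1 p.1.2 p.2).

Lemma prim_dataP t D : 0 < t ->
  prim_order t D t (prim_data t D).1.1 (prim_data t D).1.2 (prim_data t D).2.
Proof.
move=> t0; apply: (epsilon_spec (inhabits ([::], id, id))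
  (fun p => prim_order t D t p.1.1 p.1.2 p.2)).
by have [s [g [pi H]]] := prim_exists D t0; exists (s, g, pi).
Qed.

Lemma nth_distribute (V : eqType) (tm : pred V) (vs : seq V) ls v :
  v \in vs -> uniq vs ->
  nth [::] (distribute (map tm vs) ls) (index v vs) =
  if tm v then nth [:: true] ls (index v (filter tm vs)) else [::].
Proof.
elim: vs ls => //= u vs IH ls; rewrite inE => Hv /andP[uvs U].
have [->|ne] := eqVneq u v; first by case: (tm v) => //=; rewrite eqxx nth0.
have vvs : v \in vs by move: Hv; rewrite eq_sym (negbTE ne).
case: (tm u) => /=; rewrite IH // (negbTE ne) //.
by case: (tm v) => //; rewrite nth_behead.
Qed.

Lemma size_distribute fl ls : size (distribute fl ls) = size fl.
Proof. by elim: fl ls => //= -[] fl IH ls /=; rewrite IH. Qed.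

Section Labels.
Variable K : nat.

Definition mat (ss : seq bits) (i j : nat) : nat :=
  if [seq e.2 | e <- triples (behead ss) & e.1 == (nseq i true, nseq j true)] is w :: _
  then clip K w else 0.

(** Room for the number of terminals in unary and for K * K triples, each with two unary ranks and a
    weight of at most [cut] bits; the final 1 makes the bound of [size_zall] strict. *)
Definition plen := (K.*2 + 2) + K * K * (4 * K + (cut K).*2 + 6) + 1.

(** Depends on the truncated string z alone, as a table must. A string that fills the window means
    more than K terminals, where any nonempty labels are accepted. *)
Definition chosen (z : bits) : seq bits :=
  if plen <= size z then [::] else
  let ss := dec z in
  let t := size (nth [::] ss 0) in
  let p := prim_data t (mat ss) in
  [seq label (index i p.1.1) (if index i p.1.1 == 0 then 0 else p.1.2 (index i p.1.1))
     | i <- iota 0 t].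

Section Instance.
Variables (cid : nat) (G : inst).
Hypothesis vG : valid cid G.
Notation V := 'I_(nn G).

Definition row_of (v : V) : nrow :=
  Row (bin (ident G v)) (term G v)
    [seq bin (wt G v (port G v i)) | i <- enum 'I_(nn G).-1]
    [seq bin (port G v i) | i <- enum 'I_(nn G).-1].

Definition rows := [seq row_of v | v <- enum V].

Lemma size_rows : size rows = nn G.
Proof. by rewrite size_map size_enum_ord. Qed.

Lemma enc_instE : enc_inst G = pinput rows.
Proof.
rewrite /enc_inst /pinput size_rows -[_ :: (_ ++ _)]/([:: bin (nn G)] ++ (_ ++ _)) -!map_comp.
by [].
Qed.

Definition terms : seq V := [seq v <- enum V | term G v].
Definition tnames : seq bits := [seq bin (val v) | v <- terms].
Notation t := (size terms).

Lemma terms_uniq : uniq terms. Proof. by rewrite filter_uniq ?enum_uniq. Qed.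
Lemma mem_terms v : (v \in terms) = term G v.
Proof. by rewrite mem_filter mem_enum andbT. Qed.

Lemma binv_inj : injective (fun v : V => bin (val v)).
Proof. by move=> u v /bin_inj /val_inj. Qed.

Lemma names_rows : names 0 rows = tnames.
Proof.
rewrite /rows /tnames /terms.
have : map val (enum V) = iota 0 (size (enum V)) by rewrite val_enum_ord size_enum_ord.
elim: (enum V) 0 => //= v vs IH a [Ev /IH {}IH].
by rewrite IH; case: (term G v) => //=; rewrite Ev.
Qed.

Lemma count_rows : count r_tm rows = t.
Proof. by rewrite count_map size_filter. Qed.

Lemma mem_tnames v : (bin (val v) \in tnames) = term G v.
Proof. by rewrite (mem_map binv_inj) mem_terms. Qed.

Lemma index_tnames v : index (bin (val v)) tnames = index v terms.
Proof. exact: index_map binv_inj _ _. Qed.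

Definition row_entries (u : nat) (v : V) : seq (bits * bits * bits) :=
  [seq (nseq u true, nseq (index x terms) true, take (cut K) (bin (wt G v x)))
     | x <- others v & term G x].

Fixpoint entries (u : nat) (vs : seq V) acc : seq (bits * bits * bits) :=
  if vs is v :: vs' then
    if term G v then entries u.+1 vs' (catrev (row_entries u v) acc) else entries u vs' acc
  else acc.

Lemma zports_entries u v acc :
  zports (cut K) tnames u (r_ps (row_of v)) (r_ws (row_of v)) (untriples acc) =
  untriples (catrev (row_entries u v) acc).
Proof.
rewrite /row_of /= /row_entries /others.
elim: (enum 'I_(nn G).-1) acc => //= i s IH acc.
rewrite mem_tnames; case: ifP => _; last exact: IH.
by rewrite index_tnames; apply: (IH ((_, _, _) :: acc)).
Qed.

Lemma zrows_entries u vs acc :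
  zrows (cut K) tnames u (map row_of vs) (untriples acc) = untriples (entries u vs acc).
Proof.
elim: vs u acc => //= v vs IH u acc; case: (term G v) => //.
by rewrite -IH -zports_entries.
Qed.

Lemma zall_entries :
  zall (cut K) rows = enc_tuple (nseq t true :: untriples (entries 0 (enum V) [::])).
Proof. by rewrite /zall count_rows names_rows -zrows_entries. Qed.

Lemma mem_entries (v0 : V) e u vs acc : reflect
  (e \in acc \/ exists a x, [/\ a < size (filter (term G) vs),
      x != nth v0 (filter (term G) vs) a, term G x &
      e = (nseq (u + a) true, nseq (index x terms) true,
           take (cut K) (bin (wt G (nth v0 (filter (term G) vs) a) x)))])
  (e \in entries u vs acc).
Proof.
elim: vs u acc => [|v vs IH] u acc /=.
  by apply: (iffP idP) => [|[//|[a [x []]]]]; [left|].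
case: ifP => tv; last exact: IH.
apply: (iffP (IH _ _)) => -[].
- rewrite catrevE mem_cat mem_rev => /orP[/mapP[x]|]; last by left.
  rewrite mem_filter (mem_others vG) => /andP[tx xv] ->; right; exists 0, x.
  by rewrite addn0; split.
- move=> [a [x [Ha xv tx ->]]]; right; exists a.+1, x.
  by rewrite addnS; split.
- by move=> H; left; rewrite catrevE mem_cat H orbT.
move=> [[|a] [x [Ha xv tx ->]]].
  left; rewrite catrevE mem_cat mem_rev; apply/orP; left; apply/mapP; exists x.
    by rewrite mem_filter tx (mem_others vG).
  by rewrite addn0.
by right; exists a, x; rewrite addSnnS; split.
Qed.

Lemma size_entries u vs acc :
  size (entries u vs acc) <= size acc + size (filter (term G) vs) * t.
Proof.
elim: vs u acc => [|v vs IH] u acc /=; first by rewrite addn0.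
case: ifP => // _; apply: leq_trans (IH _ _) _.
rewrite catrevE size_cat size_rev size_map /= mulSn.
have : size [seq x <- others v | term G x] <= t.
  apply: uniq_leq_size; first by rewrite filter_uniq // (others_uniq vG).
  by move=> x; rewrite mem_filter mem_terms => /andP[].
lia.
Qed.

Lemma size_untriples es c : (forall e, e \in es ->
    (size e.1.1).*2 + (size e.1.2).*2 + (size e.2).*2 + 6 <= c) ->
  size (enc_tuple (untriples es)) <= size es * c.
Proof.
elim: es => //= e es IH H.
rewrite -[enc_tuple _]/(enc_str e.1.1 ++ (enc_str e.1.2 ++ (enc_str e.2 ++ enc_tuple (untriples es)))).
rewrite [size _]size_cat [size (enc_str _ ++ (enc_str _ ++ _))]size_cat [size (_ ++ enc_tuple _)]size_cat.
rewrite !size_enc_str.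
have := H e; rewrite mem_head => /(_ isT).
have : size (enc_tuple (untriples es)) <= size es * c.
  by apply: IH => e' He'; apply: H; rewrite inE He' orbT.
by rewrite mulSn; clear; move: (size (enc_tuple _)); lia.
Qed.

Lemma size_zall : t <= K -> size (zall (cut K) rows) < plen.
Proof.
move=> tK; rewrite zall_entries enc_tuple_cons [size _]size_cat size_enc_str size_nseq.
have Hs : size (entries 0 (enum V) [::]) <= t * t by apply: size_entries.
have := @size_untriples (entries 0 (enum V) [::]) (4 * K + (cut K).*2 + 6).
set E := entries _ _ _ in Hs *; set S := size (enc_tuple _) => H.
have HS : S <= size E * (4 * K + (cut K).*2 + 6).
  apply: H => e; have [n0 _ _ _ _] := vG; move=> /(mem_entries (Ordinal n0)) [//|[a [x [Ha _ tx ->]]]] /=.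
  rewrite !size_nseq size_take_min add0n.
  have : index x terms < t by rewrite index_mem mem_terms.
  by move: Ha; rewrite -/terms; have := geq_minl (cut K) (size (bin (wt G (nth (Ordinal n0) terms a) x))); clear -tK; lia.
rewrite /plen addn1 ltnS; apply: leq_add; first by lia.
apply: leq_trans HS _; rewrite leq_mul2r; apply/orP; right.
by apply: leq_trans Hs _; apply: leq_mul.
Qed.

Lemma matE (v0 : V) i j : i < t -> j < t -> i != j ->
  mat (nseq t true :: untriples (entries 0 (enum V) [::])) i j =
  minn K (wt G (nth v0 terms i) (nth v0 terms j)).
Proof.
move=> it jt ij; rewrite /mat /= untriplesK.
set E := entries _ _ _; set P := fun e => e.1 == _.
pose e0 : bits * bits * bits := (nseq i true, nseq j true, take (cut K) (bin (wt G (nth v0 terms i) (nth v0 terms j)))).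
(* [mat] takes the first match, which is safe because all triples for the same pair of ranks carry
   the same weight. *)
have key e : e \in E -> P e -> e.2 = e0.2.
  move=> /(mem_entries v0)[//|[a [x [Ha _ tx ->]]]] /eqP[/(congr1 size)].
  rewrite !size_nseq add0n => -> /(congr1 size); rewrite !size_nseq => E2.
  by rewrite /e0 /= -E2 nth_index // mem_terms.
have e0E : e0 \in E.
  apply/(mem_entries v0); right; exists i, (nth v0 terms j); split=> //.
  - by rewrite nth_uniq ?terms_uniq // eq_sym.
  - by rewrite -mem_terms mem_nth.
  - by rewrite index_uniq ?terms_uniq.
have : e0 \in filter P E by rewrite mem_filter e0E andbT /P eqxx.
case F: (filter P E) => [|e es] //= _.
have : e \in filter P E by rewrite F mem_head.
by rewrite mem_filter => /andP[Pe eE]; rewrite (key e) // clip_take.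
Qed.

Definition prover_at (v : V) : bits := nth [::] (plabels (cut K) plen chosen rows) v.

Lemma prover_atE v : prover_at v =
  if term G v then nth [:: true] (chosen (take plen (zall (cut K) rows))) (index v terms) else [::].
Proof.
rewrite /prover_at /plabels -map_comp -{1}(index_enum_ord v).
by rewrite nth_distribute ?mem_enum ?enum_uniq.
Qed.

Lemma plabels_prover : [seq prover_at v | v <- enum V] = plabels (cut K) plen chosen rows.
Proof.
have E : size (plabels (cut K) plen chosen rows) = nn G.
  by rewrite size_distribute size_map size_rows.
apply: (@eq_from_nth _ [::]); first by rewrite size_map size_enum_ord E.
move=> i; rewrite size_map size_enum_ord => Hi.
by rewrite (nth_map (Ordinal Hi)) ?size_enum_ord // /prover_at nth_enum_ord.
Qed.

End Instance.
End Labels.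

(** * Completeness *)

Lemma map_index_uniq (T : eqType) (s : seq T) : uniq s ->
  [seq index x s | x <- s] = iota 0 (size s).
Proof.
case: s => // x0 s U; apply: (@eq_from_nth _ 0); rewrite size_map ?size_iota // => i Hi.
by rewrite (nth_map x0) // index_uniq // nth_iota.
Qed.

Section Completeness.
Variables (K cid : nat) (G : inst).
Hypothesis vG : valid cid G.
Notation V := 'I_(nn G).
Let ts := terms G.
Let t := size ts.
Let D := mat K (nseq t true :: untriples (entries K 0 (enum V) [::])).
Let s := (prim_data t D).1.1.
Let g := (prim_data t D).1.2.
Let pi := (prim_data t D).2.
Let rho (i : nat) := index i s.
Let lab (i : nat) := label (rho i) (if rho i == 0 then 0 else g (rho i)).

Lemma chosenE : size (zall (cut K) (rows G)) < plen K ->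
  chosen K (take (plen K) (zall (cut K) (rows G))) = [seq lab i | i <- iota 0 t].
Proof.
move=> H; rewrite take_oversize ?(ltnW H) // /chosen leqNgt H /=.
by rewrite zall_entries dec_enc /= size_nseq.
Qed.

Lemma prim_data_terms : 0 < t -> prim_order t D t s g pi.
Proof. exact: prim_dataP. Qed.

Lemma order_perm : 0 < t -> perm_eq s (iota 0 t).
Proof.
move=> t0; have [ss us sub _] := prim_data_terms t0.
apply: uniq_perm; rewrite ?iota_uniq //.
by have [|_ E] := uniq_min_size us sub; first by rewrite size_iota ss.
Qed.

Lemma gap_wt l (v0 : V) : 0 < l < t ->
  [/\ pi l < t, nth 0 s l < t, pi l != nth 0 s l &
    g l = minn K (wt G (nth v0 ts (pi l)) (nth v0 ts (nth 0 s l)))].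
Proof.
move=> Hl; have t0 : 0 < t by case/andP: Hl => _ /(leq_trans _); apply.
have [ss us sub step] := prim_data_terms t0; have [pin gE _] := step l Hl.
have [l0 lt] := andP Hl.
have h1 : pi l < t by have := sub _ (mem_take pin); rewrite mem_iota.
have h2 : nth 0 s l < t by have := sub (nth 0 s l); rewrite mem_nth ?ss // mem_iota => /(_ isT).
have ne : pi l != nth 0 s l.
  apply: contraTneq pin => ->; rewrite in_take ?mem_nth ?ss // index_uniq ?ss //.
  by rewrite ltnn.
by split=> //; rewrite gE /D (matE K vG v0).
Qed.

(** For the size bounds: the rank is below n, and the gap is 0 or at most the weight of an edge of
    G, so it needs no more bits than that weight. *)
Lemma prover_shape (v : V) : [\/ prover_at K v = [::], prover_at K v = [:: true] |
  exists r w, [/\ r < nn G, prover_at K v = label r w &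
    w = 0 \/ exists u u' : V, u != u' /\ w = minn K (wt G u u')]].
Proof.
rewrite prover_atE; case: ifP => tv; last by constructor 1.
case: (ltnP (size (zall (cut K) (rows G))) (plen K)) => H; last first.
  by constructor 2; rewrite /chosen size_take_min leq_min leqnn H nth_nil.
have it : index v ts < t by rewrite index_mem mem_terms.
have t0 : 0 < t by apply: leq_trans it.
constructor 3; rewrite chosenE // (nth_map 0) ?size_iota // nth_iota // add0n.
have [ss us _ _] := prim_data_terms t0.
have rt : rho (index v ts) < t by rewrite -[X in _ < X]ss index_mem (perm_mem (order_perm t0)) mem_iota.
exists (rho (index v ts)), (if rho (index v ts) == 0 then 0 else g (rho (index v ts))).
split=> //.
  apply: leq_trans rt _; rewrite -[X in _ <= X](size_enum_ord (nn G)).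
  by rewrite /t /ts size_filter count_size.
case: eqP => [_|/eqP r0]; first by left.
right; have [|h1 h2 ne ->] := @gap_wt (rho (index v ts)) v; first by rewrite lt0n r0 rt.
do 2 eexists; split; last by [].
by rewrite nth_uniq ?terms_uniq.
Qed.

Lemma chosen_prover (l : bits) : l \in chosen K (take (plen K) (zall (cut K) (rows G))) ->
  exists v : V, prover_at K v = l.
Proof.
case: (ltnP (size (zall (cut K) (rows G))) (plen K)) => H; last first.
  by rewrite /chosen size_take_min leq_min leqnn H.
rewrite chosenE // => /mapP[i]; rewrite mem_iota /= add0n => it El.
have [v0 _] : exists v0 : V, true.
  by move: it; rewrite /t; case: (ts) => // v0; exists v0.
exists (nth v0 ts i); rewrite prover_atE -mem_terms mem_nth // index_uniq ?terms_uniq //.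
by rewrite chosenE // (nth_map 0) ?size_iota // nth_iota.
Qed.

Hypothesis opt_ge : forall VT ET, steiner_tree G VT ET -> K <= tree_weight G ET.

(** Prim's algorithm ran on truncated weights, so its tree need not be minimal for [wt]. It is a
    Steiner tree all the same, hence weighs at least K, and [min_sum_le] carries this over to the
    truncated edges. *)
Lemma sum_gaps_ge (v0 : V) : 0 < t -> K <= \sum_(1 <= l < t) g l.
Proof.
move=> t0; have f_inj : {in iota 0 t &, injective (nth v0 ts)}.
  move=> i j; rewrite !mem_iota /= add0n => it jt /eqP.
  by rewrite nth_uniq ?terms_uniq // => /eqP.
have [VT [ET [[Hed Hne Hcard Hconn] Hf Hw]]] := prim_tree vG f_inj (prim_data_terms t0) t0.
have st : steiner_tree G VT ET.
  split=> // v tv; have := Hf (index v ts).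
  by rewrite index_mem nth_index ?mem_terms // => ->.
have := opt_ge st; rewrite Hw => HK.
rewrite -{1}(minn_idPl HK); apply: leq_trans (min_sum_le _ _ _ _) _.
rewrite big_nat [leqRHS]big_nat; apply: leq_sum => l Hl.
by have [_ _ _ <-] := gap_wt v0 Hl.
Qed.

Lemma prover_term (v : V) : (prover_at K v != [::]) = term G v.
Proof.
rewrite prover_atE; case: (term G v) => //.
case: (leqP (size (chosen K (take (plen K) (zall (cut K) (rows G))))) (index v (terms G))) => H.
  by rewrite nth_default.
have := mem_nth [:: true] H; rewrite /chosen; case: ifP => // _ /mapP[i _ ->].
exact: label_neq0.
Qed.

Lemma complete : verifier_accepts (ver (cut K) (vlen K) (vtable K)) G (@prover_at K G).
Proof.
move=> v; rewrite ver_view /local_check take_eq0 prover_term eqxx andTb.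
set es := view _ _ _; case: (leqP K (size es)) => //= HK.
(* Otherwise a single vertex is a Steiner tree of weight 0, while [size es < K] gives K > 0. *)
have t0 : 0 < t.
  rewrite lt0n size_eq0; apply/negP=> /eqP T0.
  have st : steiner_tree G [set v] set0.
    have [h1 h2 h3 h4] := is_tree1 v; split=> // u tu.
    by have := mem_terms u; rewrite -/ts T0 tu.
  by have := opt_ge st; rewrite /tree_weight big_set0 leqNgt (leq_ltn_trans (leq0n _) HK).
have Ees : es = [seq (take (cut K) (bin (wt G v u)), take (cut K) (prover_at K u)) | u <- others v & term G u].
  by rewrite /es /view; congr map; apply: eq_filter => u; apply: prover_term.
case tv: (term G v); last first.
  have uT : nth v ts 0 \in ts by rewrite mem_nth.
  have : nth v ts 0 \in [seq u <- others v | term G u].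
    rewrite mem_filter (mem_others vG) -mem_terms uT /=.
    by apply: contraFneq tv => <-; rewrite -mem_terms.
  by rewrite Ees; case: [seq u <- others v | term G u].
have Hperm : perm_eq (v :: [seq u <- others v | term G u]) ts.
  have -> : v :: [seq u <- others v | term G u] = [seq u <- v :: others v | term G u].
    by rewrite /= tv.
  exact: perm_filter (others_perm vG v).
(* v itself is the one terminal missing from es, so the strict bound on [size es] gives t <= K, and
   the prover's table input is not truncated. *)
have tK : t <= K.
  by rewrite /t -(perm_size Hperm) /=; move: HK; rewrite Ees size_map.
have zsmall := size_zall vG tK.
have [ss us sub step] := prim_data_terms t0.
have rho_lt i : i < t -> rho i < t.
  by move=> it; rewrite -[X in _ < X]ss index_mem (perm_mem (order_perm t0)) mem_iota.
have gK l : 0 < l < t -> g l <= K.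
  by move=> Hl; have [_ _ _ ->] := gap_wt v Hl; apply: geq_minl.
have labB i : i < t -> take (cut K) (lab i) = lab i.
  move=> it; rewrite take_oversize // size_label.
  have h1 : size (bin (rho i)) <= K by apply: leq_trans (size_bin_le _) _; apply: leq_trans (ltnW (rho_lt _ it)) tK.
  have h2 : size (bin (if rho i == 0 then 0 else g (rho i))) <= K.
    apply: leq_trans (size_bin_le _) _; case: posnP => // r0.
    by apply: gK; rewrite r0 rho_lt.
  by rewrite /cut; clear -h1 h2; lia.
have pE u : term G u -> take (cut K) (prover_at K u) = lab (index u ts).
  move=> tu; have it : index u ts < t by rewrite index_mem mem_terms.
  by rewrite prover_atE tu chosenE // (nth_map 0) ?size_iota // nth_iota // add0n labB.
have {}Ees : es = [seq (take (cut K) (bin (wt G v u)), lab (index u ts)) | u <- others v & term G u].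
  by rewrite Ees; apply/eq_in_map => u; rewrite mem_filter => /andP[/pE ->].
rewrite pE //; set i := index v ts.
have Els : perm_eq (lab i :: map snd es) [seq lab j | j <- iota 0 t].
  rewrite Ees -map_comp -(map_index_uniq (terms_uniq G)) -map_comp.
  exact: (perm_map (lab \o index^~ ts) Hperm).
have it : i < t by rewrite index_mem mem_terms.
have rho_inj a b : a < t -> b < t -> rho a = rho b -> a = b.
  move=> at_ bt E; have h c : c < t -> c \in s by rewrite (perm_mem (order_perm t0)) mem_iota.
  by rewrite -(nth_index 0 (h _ at_)) -(nth_index 0 (h _ bt)) -/(rho a) E.
(* When l was attached, a was already in the tree and b was not, so the pair a, b competed with the
   cheapest one. *)
have sep a b l : a < t -> b < t -> l < t -> a != b -> rho a < rho l <= rho b ->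
    gp_of (lab l) <= D a b.
  move=> at_ bt lt ab /andP[al lb].
  have r0 : 0 < rho l by apply: leq_ltn_trans al.
  have := step (rho l); rewrite r0 rho_lt // => /(_ isT)[_ _ Hmin].
  have h c : c < t -> c \in s by rewrite (perm_mem (order_perm t0)) mem_iota.
  rewrite gp_label gtn_eqF //; apply: Hmin => //.
    by rewrite in_take ?h.
  by rewrite in_take ?h // -leqNgt.
apply/and3P; split.
- apply/allP => e; rewrite Ees => /mapP[u]; rewrite mem_filter (mem_others vG) => /andP[tu uv] ->.
  set j := index u ts; have jt : j < t by rewrite index_mem mem_terms.
  have ij : i != j.
    apply: contraNneq uv => E; rewrite -(nth_index v (_ : u \in ts)) ?mem_terms //.
    by rewrite -/j -E nth_index ?mem_terms.
  have cE : clip K (take (cut K) (bin (wt G v u))) = D i j.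
    by rewrite clip_take /D (matE K vG v) // !nth_index ?mem_terms.
  have cE' : clip K (take (cut K) (bin (wt G v u))) = D j i.
    by rewrite clip_take /D (matE K vG v) // 1?eq_sym // !nth_index ?mem_terms // (wtC vG).
  apply/andP; split.
    by rewrite [(_, _).2]/= !rk_label; apply: contraNneq ij => /rho_inj ->.
  apply/allP => x; rewrite -Ees (perm_mem Els) => /mapP[l]; rewrite mem_iota /= add0n => lt ->.
  rewrite /= !rk_label; apply/implyP => /orP[] H; first by rewrite cE; apply: sep.
  by rewrite cE'; apply: sep; rewrite // eq_sym.
- apply/hasP; exists (lab (nth 0 s 0)); last first.
    by rewrite rk_label /rho index_uniq ?ss.
  rewrite (perm_mem Els) map_f //.
  by rewrite -(perm_mem (order_perm t0)) mem_nth ?ss.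
rewrite (perm_big _ Els) big_map /=.
under eq_bigl => j do rewrite rk_label.
under eq_bigr => j Hj do rewrite gp_label (negbTE Hj).
rewrite -(perm_big _ (order_perm t0)) /=.
apply: leq_trans (sum_gaps_ge v t0) _.
(* Along s the ranks are 0, ..., t - 1, so the sum over the terminals of nonzero rank becomes the
   sum of the gaps from 1 on. *)
rewrite -(big_map rho (fun l => l != 0) g) /rho (map_index_uniq us) ss.
have -> : iota 0 t = 0 :: index_iota 1 t.
  by rewrite /index_iota subn1 -[in LHS](prednK t0).
rewrite big_cons /= big_nat [leqRHS]big_nat_cond; apply/eq_leq/eq_bigl => -[|l] //.
by rewrite andbT.
Qed.

End Completeness.

(** * Proof size, machines and conclusion *)

Lemma wt_le_maxw G (u v : 'I_(nn G)) : u != v -> wt G u v <= maxw G.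
Proof.
move=> ne; apply: (bigmax_sup u) => //.
by apply: (bigmax_sup v) => //; rewrite eq_sym.
Qed.

(** Each numeral has at most one bit more than its logarithm, and the pair code doubles both and
    adds 4 bits: 2 (log n + log W) + 8 in all. *)
Lemma prover_size K cid G (v : 'I_(nn G)) : valid cid G ->
  size (prover_at K v) <= 8 * (trunc_log 2 (nn G) + trunc_log 2 (maxw G)).+1.
Proof.
move=> vG; case: (prover_shape K vG v) => [->|->|[r [w [rn -> Hw]]]] //.
rewrite size_label.
have h1 := size_bin_log (ltnW rn).
have h2 : size (bin w) <= (trunc_log 2 (maxw G)).+1.
  apply: size_bin_log; case: Hw => [->//|[u [u' [ne ->]]]].
  by apply: leq_trans (geq_minr _ _) (wt_le_maxw ne).
by move: h1 h2; clear; lia.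
Qed.

(** The program reads a label from the table by a loop of N rounds, so the label must be shorter
    than the input. The numeral of n and the weight of the edge behind the gap both occur there,
    encoded at least as wastefully. *)
Lemma prover_lt_input K cid G (v : 'I_(nn G)) : valid cid G ->
  size (prover_at K v) < size (enc_inst G).
Proof.
move=> vG; have Hloc u : (size (local_input G u)).*2.+2 <= size (enc_tuple [seq local_input G u | u <- enum 'I_(nn G)]).
  by apply: size_mem_enc; apply: map_f; rewrite mem_enum.
have Hw u u' : u != u' -> (size (bin (wt G u u'))).*2 <= size (local_input G u).
  move=> ne; have : bin (wt G u u') \in ([:: bin (ident G u); [:: term G u]] ++
      [seq bin (wt G u (port G u i)) | i <- enum 'I_(nn G).-1]).
    rewrite mem_cat; apply/orP; right.
    have : u' \in others u by rewrite (mem_others vG) eq_sym.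
    by case/mapP=> i iI ->; apply: (map_f (fun i => bin (wt G u (port G u i)))).
  by move=> /size_mem_enc; rewrite -/(local_input G u); clear; lia.
have -> : size (enc_inst G) = (size (bin (nn G))).*2.+2 +
   (size (enc_tuple [seq local_input G u | u <- enum 'I_(nn G)]) +
    size (enc_tuple [seq enc_tuple [seq bin (port G u i) | i <- enum 'I_(nn G).-1] | u <- enum 'I_(nn G)])).
  by rewrite /enc_inst !enc_tuple_cat [size _]size_cat [size (enc_tuple _ ++ _)]size_cat /enc_tuple /= cats0 size_enc_str.
have n0 : 0 < size (bin (nn G)).
  by case: (nn G) v {Hloc Hw vG} => [[]|n] // _; rewrite bin_succ.
case: (prover_shape K vG v) => [->|->|[r [w [rn -> Hwr]]]]; try by move: n0; clear; rewrite /=; lia.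
rewrite size_label; have h1 := size_bin_mono (ltnW rn).
case: Hwr => [->|[u [u' [ne ->]]]].
  have := Hloc v; have : 4 <= size (local_input G v).
    by rewrite /local_input size_enc_tuple /=; clear; lia.
  by move: h1; clear; rewrite /=; lia.
have h2 := size_bin_mono (geq_minr K (wt G u u')).
have := Hloc u; have := Hw _ _ ne; have : 4 <= size (local_input G u).
  by rewrite /local_input size_enc_tuple /=; clear; lia.
by move: h1 h2; clear; lia.
Qed.

Lemma verifier_machine K cid : exists (M : TM) (a d : nat),
  forall G (L : 'I_(nn G) -> bits) v, valid cid G ->
    tm_computes_within M (verifier_input G L v)
      [:: ver (cut K) (vlen K) (vtable K) (local_input G v) (L v) (nbr_labels G L v)]
      (a * (size (verifier_input G L v)).+1 ^ d).
Proof.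
have [//|M [a [d H]]] := @program_computes 11 (vprog (cut K) (vlen K) (vtable K)) _ (vprog_regs _ _ _).
exists M, a, d => G L v _; apply: H.
by apply: vprog_spec; rewrite !size_map.
Qed.

Lemma in_rows G r : List.In r (rows G) -> exists v : 'I_(nn G), r = row_of v.
Proof. by rewrite /rows; elim: (enum _) => //= v vs IH [<-|//]; exists v. Qed.

Lemma prover_machine K cid : exists (M : TM) (a d : nat),
  forall G, valid cid G ->
    tm_computes_within M (enc_inst G) (enc_labels G (@prover_at K G))
      (a * (size (enc_inst G)).+1 ^ d).
Proof.
have [//|M [a [d H]]] := @program_computes 26 (pprog (cut K) (plen K) (chosen K)) _ (pprog_regs _ _ _).
exists M, a, d => G vG; apply: H.
rewrite /enc_labels plabels_prover enc_instE; apply: pprog_spec.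
- by move=> r /in_rows[v ->]; rewrite /= !size_map.
- move=> r /in_rows[v ->]; rewrite size_rows /= size_map size_enum_ord.
  by case: (nn G).
move=> l /chosen_prover[v <-]; rewrite -enc_instE.
exact: (prover_lt_input _ _ vG).
Qed.

Theorem theorem5p22 :
  forall cid : nat, exists c : nat, forall k : int,
    exists (P : prover_t) (ver : verifier_t),
      [/\ gpls_correct (valid cid) (FY k) (FN 2 k) P ver,
          proof_size_le c (valid cid) (FY k) P
        & seq_efficient (valid cid) (FY k) P ver].
Proof.
move=> cid; exists 8 => k.
(* For negative k every instance is a yes-instance and none is a no-instance, exactly as for 0. *)
pose K := if k is Posz K' then K' else 0.
exists (@prover_at K), (ver (cut K) (vlen K) (vtable K)); split.
- split=> G vG [m [[[VT [ET [st wE]]] opt] km]].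
    apply: (complete vG) => VT' ET' /opt; apply: leq_trans.
    by move: km; rewrite /K; case: (k) => //= n; rewrite lez_nat.
  move=> L acc; have := sound vG acc st; rewrite wE.
  by move: km; rewrite /K; case: (k) => //= n; rewrite ltz_nat ltnNge => /negbTE ->.
- by move=> G vG _ v; apply: prover_size vG.
split.
  have [M [a [d H]]] := prover_machine K cid.
  by exists M, a, d => G vG _; apply: H.
exact: verifier_machine.
Qed.
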